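(* Let $\theta\in\Theta_{pe}$, and let $(U_n)_{n\ge0}$, $(Y_n)_{n\ge-d+1}$, $\widehat\theta_n$, $\theta^\ast$ and $\Gamma$ be as defined in the context. Then, as $n\to\infty$, $$\widehat\theta_n\to\theta^\ast\quad\text{almost surely}$$ and $$\sqrt n\,\bigl(\widehat\theta_n-\theta^\ast\bigr)\ \stackrel{\mathcal D}{\longrightarrow}\ \frac{\sigma}{\theta_d}\,\Gamma^{-1/2}N_d,$$ where $N_d$ is an $\mathbb R^d$-valued random vector with distribution $N(0,I_d)$, $\Gamma^{-1/2}=(\Gamma^{1/2})^{-1}$, and $\stackrel{\mathcal D}{\to}$ means convergence in distribution.
   Context: All random variables are defined on a probability space $(\Omega,\mathcal F,P)$. Fix $d\in\mathbb N$, $d\ge1$, and $\theta=(\theta_1,\dots,\theta_d)^T\in\mathbb R^d$. $(Z_n)_{n\ge1}$ is an i.i.d. sequence of real random variables with $Z_1$ square-integrable, $E(Z_1)=0$ and $\sigma^2=\mathrm{Var}(Z_1)>0$ ($\sigma>0$). $B=B(\theta)\in\mathbb R^{d\times d}$ is the companion matrix whose first row is $(\theta_1,\dots,\theta_d)$ and whose $i$-th row, $2\le i\le d$, is $e_{i-1}^T$ ($e_1,\dots,e_d$ the unit vectors of $\mathbb R^d$; for $d=1$, $B=\theta_1$). $W_n=(Z_n,0,\dots,0)^T=Z_ne_1$. $\Theta_{pe}$ is the set of $\theta\in\mathbb R^d$ such that all complex eigenvalues of $B(\theta)$ have absolute value $>1$; for such $\theta$, $\theta_d\neq0$ and $B$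 is invertible. The standing assumption is $\theta\in\Theta_{pe}$. We write $B^{-j}=(B^{-1})^j$. The process $(Y_n)_{n\ge-d+1}$ satisfies $Y_n=\theta_1Y_{n-1}+\dots+\theta_dY_{n-d}+Z_n$ for $n\ge1$, and $U_n=(Y_n,Y_{n-1},\dots,Y_{n-d+1})^T$, $n\ge0$, so $U_n=BU_{n-1}+W_n$ for $n\ge1$; the initial value is $U_0=(Y_0,\dots,Y_{-d+1})^T=-\sum_{j=1}^\infty B^{-j}W_j$ (the series converges absolutely almost surely). Consequently $U_n=-\sum_{k=1}^\infty B^{-k}e_1Z_{n+k}$ almost surely for $n\ge0$. $\Gamma=E(U_0U_0^T)$ is the covariance matrix of $U_0$; it is symmetric and positive definite, and $\Gamma^{1/2}$ is its symmetric positive definite square root. $\theta^\ast=\left(-\frac{\theta_{d-1}}{\theta_d},\dots,-\frac{\theta_1}{\theta_d},\frac1{\theta_d}\right)^T$ (so $\theta^\ast=1/\theta_1$ for $d=1$). The least squares estimator is $\widehat\theta_n=\left(\sum_{k=1}^nU_{k-1}U_{k-1}^T\right)^{-1}\sum_{k=1}^nU_{k-1}Y_k$, $n\ge1$, where the inverse is defined to be $0$ whenever the random matrix $\sum_{k=1}^nU_{k-1}U_{k-1}^T$ is singular. *)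

(* Defs.v *)
From HB Require Import structures.
From mathcomp Require Import all_boot all_order all_algebra.
From mathcomp Require Import complex.
From mathcomp Require Import all_classical all_reals all_analysis.

Set Implicit Arguments.
Unset Strict Implicit.
Unset Printing Implicit Defensive.

Import Order.TTheory GRing.Theory Num.Theory.
Import numFieldNormedType.Exports.

Local Open Scope classical_set_scope.
Local Open Scope ring_scope.

(* Dimensions: the order of the autoregression is d.+1 (so it is at least 1),
   and the 1-based coordinate theta_k is [theta (inord k.-1) 0]; in particular
   the last coordinate is [theta ord_max 0]. *)

Section companion.
Variables (R : realType) (d : nat).

(* The entry (i, j) with i > 0 is 1 exactly when j = i - 1. *)
Definition companion (theta : 'cV[R]_d.+1) : 'M[R]_d.+1 :=
  \matrix_(i, j) if i == ord0 then theta j 0 else (j.+1 == i :> nat)%:R.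

(* The matrix is mapped to R[i] so that all complex eigenvalues are covered. *)
Definition Theta_pe : set 'cV[R]_d.+1 :=
  [set theta | forall z : R[i],
     eigenvalue (map_mx (real_complex R) (companion theta)) z -> 1 < `|z|].

(* In 1-based notation and with D = d.+1, the entry of 0-based index i is
   - theta_(D - (i + 1)) / theta_D, where theta_(D - (i + 1)) has
   0-based index d - (i + 1); the last entry is 1 / theta_D. *)
Definition theta_star (theta : 'cV[R]_d.+1) : 'cV[R]_d.+1 :=
  \col_i if i == ord_max then (theta ord_max 0)^-1
         else - (theta (inord (d - i.+1)) 0 / theta ord_max 0).

Definition posdef n (A : 'M[R]_n) : Prop :=
  A^T = A /\ forall x : 'cV[R]_n, x != 0 -> 0 < (x^T *m A *m x) 0 0.

(* The symmetric positive definite square root, picked by choice; the default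
   value 0 is only taken when there is no such root (it exists and is unique
   when A is symmetric positive definite). *)
Definition sqrtmx n (A : 'M[R]_n) : 'M[R]_n :=
  xget 0 [set S : 'M[R]_n | posdef S /\ S *m S = A].

(* [invmx] returns its argument on singular matrices; the convention here is
   that the inverse is then 0. *)
Definition invmx0 n (A : 'M[R]_n) : 'M[R]_n :=
  if A \in unitmx then invmx A else 0.

End companion.

Section probability.
Context (disp : measure_display) (T : measurableType disp) (R : realType)
  (P : probability T R).

Definition mutually_independent (I : eqType) (X : I -> {RV P >-> R}) : Prop :=
  forall (J : seq I) (A : I -> set R), uniq J ->
    (forall i, i \in J -> measurable (A i)) ->
    P (\bigcap_(i in [set i | i \in J]) (X i @^-1` A i)) =
    (\prod_(i <- J) P (X i @^-1` A i))%E.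

Definition identically_distributed (I : Type) (X : I -> {RV P >-> R}) : Prop :=
  forall i j (A : set R), measurable A ->
    distribution P (X i) A = distribution P (X j) A.

Definition iid (I : eqType) (X : I -> {RV P >-> R}) : Prop :=
  mutually_independent X /\ identically_distributed X.

Definition rvec n (X : 'I_n -> {RV P >-> R}) (w : T) : 'cV[R]_n :=
  \col_i X i w.

(* The law of [rvec X] is N(0, I_n), i.e. the n-fold product of N(0, 1). *)
Definition std_normal_vector n (X : 'I_n -> {RV P >-> R}) : Prop :=
  mutually_independent X /\
  forall i (A : set R), measurable A ->
    distribution P (X i) A = normal_prob 0 1 A.

End probability.

Definition cvg_in_distribution (R : realType) (n : nat)
    (disp : measure_display) (T : measurableType disp) (P : probability T R)
    (X : nat -> T -> 'cV[R]_n)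
    (disp' : measure_display) (T' : measurableType disp')
    (P' : probability T' R) (X' : T' -> 'cV[R]_n) : Prop :=
  forall f : 'cV[R]_n -> R, continuous f ->
    (exists M : R, forall x, `|f x| <= M) ->
    ('E_P[f \o X k] @[k --> \oo] --> 'E_P'[f \o X'])%E.

Section autoregression.
Context (disp : measure_display) (T : measurableType disp) (R : realType)
  (P : probability T R) (d : nat).
(* [Y] is indexed by all integers, but only indices >= - d matter;
   [Z 0] is never used. *)
Variables (theta : 'cV[R]_d.+1) (Z : nat -> {RV P >-> R})
  (Y : int -> {RV P >-> R}).

Definition W (n : nat) (w : T) : 'cV[R]_d.+1 := Z n w *: delta_mx ord0 0.

Definition U (n : nat) (w : T) : 'cV[R]_d.+1 :=
  \col_(i < d.+1) Y (n%:Z - i%:Z) w.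

Definition AR_recursion : Prop :=
  forall (n : nat) (w : T), (1 <= n)%N ->
    Y n%:Z w = \sum_(i < d.+1) theta i 0 * Y (n%:Z - i.+1%:Z) w + Z n w.

(* U_0 = - \sum_(j >= 1) B^(-j) W_j almost surely *)
Definition explosive_start : Prop :=
  {ae P, forall w,
    - (\sum_(1 <= j < n) invmx (companion theta) ^+ j *m W j w)
      @[n --> \oo] --> U 0 w}.

Definition Gamma : 'M[R]_d.+1 :=
  \matrix_(i, j) fine 'E_P[fun w => (U 0 w *m (U 0 w)^T) i j].

Definition theta_hat (n : nat) (w : T) : 'cV[R]_d.+1 :=
  invmx0 (\sum_(1 <= k < n.+1) U k.-1 w *m (U k.-1 w)^T) *m
    \sum_(1 <= k < n.+1) Y k%:Z w *: U k.-1 w.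

End autoregression.

(* Main.v *)
Require Import Defs.
From HB Require Import structures.
From mathcomp Require Import all_boot all_order all_algebra.
From mathcomp Require Import complex.
From mathcomp Require Import all_classical all_reals all_analysis.
From mathcomp Require Import measurable_realfun spectral sesquilinear ring lra zify.

Set Implicit Arguments.
Unset Strict Implicit.
Unset Printing Implicit Defensive.

Import Order.TTheory GRing.Theory Num.Theory.
Import numFieldNormedType.Exports.

Local Open Scope classical_set_scope.
Local Open Scope ring_scope.

(** The state [U n] solves an explosive recursion, and inverting its expanding
    matrix [companion theta] expresses it by the future: [dotp t (U n)] is the
    sum of [future_coef theta t j * Z (n + j).+1] over [j], with geometrically
    decaying coefficients ([future_coef_decay], [state_future]).  The process is
    therefore stationary and square integrable, and each innovation [Z n] is
    independent of the state [U n], which depends on later innovations only.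

    Solving the scalar recursion for its oldest term shows that the
    time-reversed series is an autoregression with parameter
    [theta_star theta] whose residuals are the innovations divided by
    [- theta_d] ([backward_recursion]).  Least squares sees the series only
    through sums of lagged products, and these are unchanged by time reversal
    except for finitely many products at the two ends ([lag_sum_reversal]).
    Hence the score, the sum of [(Y k.+1 - dotp (theta_star theta) (U k)) *: U k],
    equals up to boundary terms [- theta_d^-1] times the sum of
    [Z k.+1 *: U k.+1] with the order of the coordinates reversed
    ([normal_equations]), and the estimation error is the inverse Gram matrix
    applied to the score ([estimation_error]).

    Consistency.  The products [Z k *: U k] are orthogonal in L2, so their means
    tend to zero almost surely ([slln_orthogonal], [lin_slln]).  By the recursion
    and the strong law for the squared innovations ([slln_iid]), the mean Gram
    matrix solves, up to a vanishing error, the Lyapunov equation that [Gamma]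
    solves exactly; for an expanding matrix this equation is stable
    ([lyapunov_stable]), so the mean Gram matrix tends to [Gamma]
    ([empirical_covariance]).  [Gamma] is positive definite ([future_norm_eq0]),
    hence the inverses converge too and the error tends to zero.

    Asymptotic normality.  Replacing the summands [Z k * dotp s (U k)] one at a
    time, from the first to the last, multiplies the expectation of a cosine of
    the normalised sum by nearly constant factors, because each innovation is
    centred given the later ones ([clt_step], [clt_bounded]); truncation of the
    innovations and of the moving average costs little in L2 ([clt_finite],
    [lin_clt]).  Replacing the mean Gram matrix by [Gamma] and dropping the
    boundary terms costs an error tending to zero in probability
    ([scaled_error_asymptotics]).  The reversal of coordinates does not alter
    the limiting variance since [Gamma] is a symmetric Toeplitz matrix
    ([Gamma_rev], [limit_variance]).  The limit of the cosine transforms is that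
    of the stated Gaussian vector ([normal_cf], [gaussian_limit_cf]), and with
    tightness this gives convergence in distribution ([levy_cvg]). *)

(** * Expectation and square integrability *)

Section expectation.
Context {disp : measure_display} {T : measurableType disp} {R : realType}
  (P : probability T R).

Definition intg (F : T -> R) : Prop := P.-integrable setT (EFin \o F).
Definition Ex (F : T -> R) : R := \int[P]_w F w.

Lemma intg_meas F : intg F -> measurable_fun setT F.
Proof. by move=> /measurable_int /measurable_EFinP. Qed.

Lemma ExE F : intg F -> ('E_P[F] = (Ex F)%:E)%E.
Proof. by move=> iF; rewrite unlock /Ex /Rintegral fineK// integrable_fin_num. Qed.

Lemma intg_bd (F : T -> R) M : measurable_fun setT F -> (forall w, `|F w| <= M) -> intg F.
Proof.
move=> mF bF; apply: measurable_bounded_integrable => //.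
  by rewrite (le_lt_trans (probability_le1 _ _)) ?ltry.
exists M; split; first by rewrite num_real.
by move=> K MK w _ /=; rewrite (le_trans (bF w)) ?ltW.
Qed.

Lemma intg_le (F G : T -> R) : measurable_fun setT F -> (forall w, `|F w| <= G w) ->
  intg G -> intg F.
Proof.
move=> mF FG; apply: le_integrable => //; first exact/measurable_EFinP.
by move=> w _ /=; rewrite lee_fin (le_trans (FG w)) ?ler_norm.
Qed.

Lemma intg_cst c : intg (fun=> c).
Proof. by apply: (@intg_bd _ `|c|). Qed.

Lemma intgD F G : intg F -> intg G -> intg (fun w => F w + G w).
Proof. by move=> iF iG; have := integrableD measurableT iF iG. Qed.

Lemma intgZ c F : intg F -> intg (fun w => c * F w).
Proof. by move=> iF; have := integrableZl measurableT c iF. Qed.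

Lemma intgB F G : intg F -> intg G -> intg (fun w => F w - G w).
Proof. by move=> iF iG; have := integrableB measurableT iF iG. Qed.

Lemma intg_abs F : intg F -> intg (fun w => `|F w|).
Proof. exact: integrable_norm. Qed.

Lemma intg_sum (I : Type) (s : seq I) (Q : pred I) (F : I -> T -> R) :
  (forall i, Q i -> intg (F i)) -> intg (fun w => \sum_(i <- s | Q i) F i w).
Proof.
move=> iF; have := @integrable_sum _ T R P _ measurableT I s Q (fun i => EFin \o F i) iF.
apply: eq_integrable => // w _ /=.
by rewrite sumEFin.
Qed.

Lemma ExD F G : intg F -> intg G -> Ex (fun w => F w + G w) = Ex F + Ex G.
Proof. by move=> iF iG; exact: RintegralD. Qed.

Lemma ExB F G : intg F -> intg G -> Ex (fun w => F w - G w) = Ex F - Ex G.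
Proof. by move=> iF iG; exact: RintegralB. Qed.

Lemma ExZ c F : intg F -> Ex (fun w => c * F w) = c * Ex F.
Proof. by move=> iF; exact: RintegralZl. Qed.

Lemma Ex_cst c : Ex (fun=> c) = c.
Proof. by rewrite /Ex Rintegral_cst// [X in _ * fine X](_ : _ = 1%E) ?mulr1//; exact: probability_setT. Qed.

Lemma Ex_ge0 (F : T -> R) : (forall w, 0 <= F w) -> 0 <= Ex F.
Proof. by move=> F0; apply: Rintegral_ge0. Qed.

Lemma Ex_le F G : intg F -> intg G -> (forall w, F w <= G w) -> Ex F <= Ex G.
Proof. by move=> iF iG FG; apply: le_Rintegral. Qed.

Lemma Ex_abs F : intg F -> `|Ex F| <= Ex (fun w => `|F w|).
Proof. by move=> iF; apply: le_normr_Rintegral. Qed.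

Lemma Ex_bd F M : intg F -> (forall w, `|F w| <= M) -> `|Ex F| <= M.
Proof.
move=> iF FM; rewrite (le_trans (Ex_abs iF))// -[leRHS]Ex_cst.
by apply: Ex_le => //; [exact: intg_abs|exact: intg_cst].
Qed.

Lemma Ex_sum (I : Type) (s : seq I) (F : I -> T -> R) :
  (forall i, intg (F i)) ->
  Ex (fun w => \sum_(i <- s) F i w) = \sum_(i <- s) Ex (F i).
Proof.
move=> iF; elim: s => [|i s IH].
  by rewrite big_nil -[RHS](Ex_cst 0); congr Ex; apply/funext => w; rewrite big_nil.
rewrite big_cons -IH -ExD//; last exact: intg_sum.
by congr Ex; apply/funext => w; rewrite big_cons.
Qed.

Definition L2 (F : T -> R) : Prop := measurable_fun setT F /\ intg (fun w => F w ^+ 2).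

Lemma L2M F G : L2 F -> L2 G -> intg (fun w => F w * G w).
Proof.
move=> [mF iF] [mG iG].
apply: (@intg_le _ (fun w => F w ^+ 2 + G w ^+ 2)); last exact: intgD.
  exact: measurable_funM.
move=> w; rewrite normrM -(real_normK (num_real (F w))) -(real_normK (num_real (G w))).
by nra.
Qed.

Lemma L2_intg F : L2 F -> intg F.
Proof.
move=> [mF iF]; apply: (@intg_le _ (fun w => F w ^+ 2 + 1)) => //.
  move=> w; rewrite -(real_normK (num_real (F w))); nra.
by apply: intgD => //; exact: intg_cst.
Qed.

Lemma L2D F G : L2 F -> L2 G -> L2 (fun w => F w + G w).
Proof.
move=> lF lG; have iFG := L2M lF lG; case: lF => mF iF; case: lG => mG iG.
split; first exact: measurable_funD.
rewrite (_ : (fun _ => _) = (fun w => (F w ^+ 2 + G w ^+ 2) + 2 * (F w * G w))).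
  by apply: intgD; [exact: intgD | exact: intgZ].
by apply/funext => w; ring.
Qed.

Lemma L2Z c F : L2 F -> L2 (fun w => c * F w).
Proof.
move=> [mF iF]; split; first exact: measurable_funM.
rewrite (_ : (fun _ => _) = (fun w => c ^+ 2 * F w ^+ 2)); first exact: intgZ.
by apply/funext => w; ring.
Qed.

Lemma L2N F : L2 F -> L2 (fun w => - F w).
Proof.
move=> /(L2Z (-1)); congr L2; apply/funext => w; ring.
Qed.

Lemma L2B F G : L2 F -> L2 G -> L2 (fun w => F w - G w).
Proof. by move=> lF lG; apply: L2D => //; exact: L2N. Qed.

Lemma L2_cst c : L2 (fun=> c).
Proof. by split => //; exact: intg_cst. Qed.

Lemma L2_bd (F : T -> R) M : measurable_fun setT F -> (forall w, `|F w| <= M) -> L2 F.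
Proof.
move=> mF FM; split => //; apply: (@intg_bd _ (M ^+ 2)).
  by apply: measurable_funX.
by move=> w; rewrite normrX ler_pXn2r ?nnegrE ?(le_trans _ (FM w)).
Qed.

Lemma L2_sum (I : Type) (s : seq I) (Q : pred I) (F : I -> T -> R) :
  (forall i, Q i -> L2 (F i)) -> L2 (fun w => \sum_(i <- s | Q i) F i w).
Proof.
move=> lF; elim: s => [|i s IH].
  by under eq_fun do rewrite big_nil; exact: L2_cst.
under eq_fun do rewrite big_cons.
have [Qi|//] := boolP (Q i).
by apply: L2D => //; exact: lF.
Qed.

Lemma Ex_sqr_le F : L2 F -> (Ex (fun w => `|F w|)) ^+ 2 <= Ex (fun w => F w ^+ 2).
Proof.
move=> lF; have iF := L2_intg lF; have iA := intg_abs iF.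
set a := Ex (fun w => `|F w|).
have : 0 <= Ex (fun w => (`|F w| - a) ^+ 2) by apply: Ex_ge0 => w; exact: sqr_ge0.
rewrite (_ : (fun _ => _) = (fun w => F w ^+ 2 + ((- (2 * a)) * `|F w| + a ^+ 2))).
  have iZ := intgZ (- (2 * a)) iA; have iC := intg_cst (a ^+ 2).
  rewrite ExD; [|exact: lF.2|exact: intgD].
  rewrite ExD// ExZ// Ex_cst -/a; lra.
by apply/funext => w; rewrite -[F w ^+ 2]real_normK ?num_real//; ring.
Qed.

Lemma Ex_abs_le_sqr F C : L2 F -> Ex (fun w => F w ^+ 2) <= C ->
  Ex (fun w => `|F w|) <= C + 1.
Proof.
move=> lF FC; have := le_trans (Ex_sqr_le lF) FC.
have : 0 <= Ex (fun w => `|F w|) by apply: Ex_ge0.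
have : 0 <= C by apply: le_trans FC; apply: Ex_ge0 => w; exact: sqr_ge0.
by move: (Ex _) => a a0 C0 a2; nra.
Qed.

End expectation.

(** * Independence of functions of disjoint blocks *)

Section independence.
Context {disp : measure_display} {T : measurableType disp} {R : realType}
  (P : probability T R).

(** Independence passes from a pi-system to the sigma-algebra it generates,
    because the sets independent of a fixed event form a Dynkin system. *)
Lemma dynkin_indep (G : set (set T)) (C : set T) :
  measurable C -> G `<=` measurable -> setI_closed G ->
  (forall B, G B -> P (B `&` C) = P B * P C)%E ->
  forall B, <<s G >> B -> measurable B /\ (P (B `&` C) = P B * P C)%E.
Proof.
move=> mC Gm GI GC B; rewrite -setI_closed_g_dynkin_g_sigma_algebra//.
pose D := [set B : set T | measurable B /\ (P (B `&` C) = P B * P C)%E].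
move=> /(_ D); apply; split; last by move=> A GA; split; [exact: Gm | exact: GC].
split.
- by split => //; rewrite setTI probability_setT mul1e.
- move=> A [mA AC]; split; first exact: measurableC.
  rewrite setIC -setDE measureD//; last by rewrite (le_lt_trans (probability_le1 _ _)) ?ltry.
  rewrite probability_setC// muleBl ?mul1e ?fin_num_measure//.
  by congr (_ - _)%E; rewrite setIC; exact: AC.
- move=> F tF DF; split; first by apply: bigcup_measurable => k _; exact: (DF k).1.
  rewrite setI_bigcupl.
  rewrite measure_bigcup//=; last 2 first.
    by move=> k _; apply: measurableI => //; exact: (DF k).1.
    by apply: trivIset_setIr.
  rewrite measure_bigcup//=; last by move=> k _; exact: (DF k).1.
  have fC : P C = (fine (P C))%:E by rewrite fineK ?fin_num_measure.
  rewrite muleC [X in (X * _)%E]fC -nneseriesZl//.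
  by apply: eq_eseriesr => k _; rewrite (DF k).2 muleC -fC.
Qed.

(** The joint law is the product of the two laws, so that Fubini's theorem
    factors the integral of the product. *)
Lemma Ex_prod_indep (F G : T -> R) :
  (forall A B : set R, measurable A -> measurable B ->
    P ((F @^-1` A) `&` (G @^-1` B)) = (P (F @^-1` A) * P (G @^-1` B))%E) ->
  intg P F -> intg P G ->
  intg P (fun w => F w * G w) /\ Ex P (fun w => F w * G w) = Ex P F * Ex P G.
Proof.
move=> FG iF iG; have mF := intg_meas iF; have mG := intg_meas iG.
pose F1 : {RV P >-> R} := HB.pack F (isMeasurableFun.Build _ _ _ _ F mF).
pose G1 : {RV P >-> R} := HB.pack G (isMeasurableFun.Build _ _ _ _ G mG).
have mH : measurable_fun setT (fun w => (F w, G w)) by exact: measurable_fun_pair.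
pose H : {RV P >-> (R * R)%type} := HB.pack (fun w => (F w, G w)) (isMeasurableFun.Build _ _ _ _ _ mH).
pose PF := distribution P F1; pose PG := distribution P G1.
have E : forall X, measurable X -> (PF \x PG)%E X = distribution P H X.
  by apply: product_measure_unique => A B mA mB; rewrite -FG.
have iF1 : PF.-integrable setT (EFin \o (fun x : R => x)).
  by apply: integrable_pushforward => //; exact/measurable_EFinP.
have iG1 : PG.-integrable setT (EFin \o (fun x : R => x)).
  by apply: integrable_pushforward => //; exact/measurable_EFinP.
pose f (z : R * R) := (z.1 * z.2)%:E.
have mf : measurable_fun setT f.
  by apply/measurable_EFinP/measurable_funM.
have iH : (PF \x PG)%E.-integrable setT f.
  apply/(integrable12ltyP _ _ mf).
  have mE : measurable_fun setT (fun x : R => `|x%:E|%E) by exact/measurableT_comp.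
  have aG : (\int[PG]_y `|y%:E|)%E \is a fin_num.
    by rewrite ge0_fin_numE; [have /integrableP[] := iG1 | exact: integral_ge0].
  have -> : (\int[PF]_x \int[PG]_y `|f (x, y)| = \int[PG]_y `|y%:E| * \int[PF]_x `|x%:E|)%E.
    rewrite -ge0_integralZl//; last exact: integral_ge0.
    apply: eq_integral => x _; rewrite muleC -ge0_integralZl//.
    by apply: eq_integral => y _; rewrite /f /= normrM EFinM.
  apply: lte_mul_pinfty => //; first exact: integral_ge0.
  by have /integrableP[] := iF1.
have iFG : intg P (fun w => F w * G w).
  have : (distribution P H).-integrable setT f.
    apply/integrableP; split => //; have /integrableP[_] := iH.
    congr (_ < _)%E; apply: eq_measure_integral => //= X mX _; exact: E.
  move=> /integrableP[_]; rewrite ge0_integral_distribution//; last exact: measurableT_comp.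
  by move=> lt; apply/integrableP; split => //; apply/measurable_EFinP/measurable_funM.
split => //.
apply: EFin_inj; rewrite EFinM -!ExE// !unlock.
have -> : (\int[P]_w (F w * G w)%:E = \int[distribution P H]_z f z)%E.
  by rewrite integral_distribution.
have -> : (\int[distribution P H]_z f z = \int[(PF \x PG)%E]_z f z)%E.
  by apply: eq_measure_integral => //= X mX _; rewrite E.
rewrite -integral12_prod_meas1//.
have -> : (\int[P]_w (F w)%:E = \int[PF]_x x%:E)%E by rewrite integral_distribution.
have EG : (\int[P]_w (G w)%:E = \int[PG]_x x%:E)%E by rewrite integral_distribution.
have EG' : (\int[PG]_x x%:E)%E = (Ex P G)%:E by rewrite -ExE// -EG unlock.
rewrite muleC EG EG'.
rewrite -integralZl//; apply: eq_integral => x _.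
rewrite /fubini_F /f /=.
under eq_integral do rewrite EFinM.
by rewrite integralZl// muleC EG'.
Qed.

Context {I : eqType} (X : I -> {RV P >-> R}).

(** A pi-system generating the events that depend on the coordinates in [J]
    only. *)
Definition cylinder (J : set I) : set (set T) :=
  [set B | exists s : seq I, exists A : I -> set R,
     [/\ uniq s, {in s, forall i, J i}, forall i, measurable (A i) &
         B = \bigcap_(i in [set i | i \in s]) (X i @^-1` A i)]].

Definition sgen (J : set I) : set (set T) :=
  [set B | exists i A, [/\ J i, measurable A & B = X i @^-1` A]].

Lemma cylinder_meas J : cylinder J `<=` measurable.
Proof.
move=> _ [s [A [us sJ mA ->]]].
apply: fin_bigcap_measurable; first exact: finite_seq.
by move=> i _; rewrite -[_ @^-1` _]setTI; exact: measurable_funP.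
Qed.

Lemma cylinderI J : setI_closed (cylinder J).
Proof.
move=> _ _ [s1 [A1 [us1 sJ1 mA1 ->]]] [s2 [A2 [us2 sJ2 mA2 ->]]].
pose A i := (if i \in s1 then A1 i else setT) `&` (if i \in s2 then A2 i else setT).
exists (undup (s1 ++ s2)), A; split.
- exact: undup_uniq.
- by move=> i; rewrite mem_undup mem_cat => /orP[/sJ1|/sJ2].
- by move=> i; apply: measurableI; case: ifP => // _; exact: measurableT.
- apply/seteqP; split=> w.
    move=> [h1 h2] i /= _; split; case: ifP => // hi; [exact: h1|exact: h2].
  move=> h; split => i /= hi.
    by have := h i; rewrite /= mem_undup mem_cat hi => /(_ isT) [] /=; rewrite hi.
  by have := h i; rewrite /= mem_undup mem_cat hi orbT => /(_ isT) [] /=; rewrite hi.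
Qed.

Lemma sgen_cylinder J : sgen J `<=` cylinder J.
Proof.
move=> _ [i [A [Ji mA ->]]]; exists [:: i], (fun=> A); split => //.
  by move=> j; rewrite inE => /eqP ->.
apply/seteqP; split => w /=; last by move=> /(_ i); apply => /=; rewrite inE.
by move=> h j /=; rewrite inE => /eqP ->.
Qed.

Lemma sgen_meas J B : <<s sgen J >> B -> measurable B.
Proof.
move=> /(_ measurable); apply; split; last first.
  by move=> C /sgen_cylinder /cylinder_meas.
by split => [|A mA|F mF]; [|rewrite setTD; exact: measurableC|exact: bigcup_measurable].
Qed.

Hypothesis Xind : mutually_independent X.

Lemma cylinder_indep J K : J `&` K = set0 -> forall B C, cylinder J B -> cylinder K C ->
  P (B `&` C) = (P B * P C)%E.
Proof.
move=> JK _ _ [s1 [A1 [us1 sJ1 mA1 ->]]] [s2 [A2 [us2 sJ2 mA2 ->]]].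
have s12 i : i \in s1 -> i \in s2 -> False.
  by move=> /sJ1 Ji /sJ2 Ki; have : (J `&` K) i by []; rewrite JK.
pose A i := if i \in s1 then A1 i else A2 i.
have E1 : \bigcap_(i in [set i | i \in s1]) X i @^-1` A1 i =
   \bigcap_(i in [set i | i \in s1]) X i @^-1` A i.
  by apply: eq_bigcapr => i /= hi; rewrite /A hi.
have E2 : \bigcap_(i in [set i | i \in s2]) X i @^-1` A2 i =
   \bigcap_(i in [set i | i \in s2]) X i @^-1` A i.
  apply: eq_bigcapr => i /= hi; rewrite /A ifF//.
  by apply/negP => /s12; apply.
rewrite E1 E2 -bigcap_setU.
have -> : [set i | i \in s1] `|` [set i | i \in s2] = [set i | i \in s1 ++ s2].
  by apply/seteqP; split => i /=; rewrite mem_cat => /orP.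
have mA i : measurable (A i) by rewrite /A; case: ifP.
rewrite !Xind//; first by rewrite big_cat.
rewrite cat_uniq us1 us2 andbT /=; apply/hasPn => i i2; apply/negP => i1.
exact: s12 i1 i2.
Qed.

(** [dynkin_indep] is applied twice, enlarging one of the two blocks at a time
    from cylinders to the generated sigma-algebra. *)
Lemma indep_blocks J K : J `&` K = set0 -> forall B C, <<s sgen J >> B -> <<s sgen K >> C ->
  P (B `&` C) = (P B * P C)%E.
Proof.
move=> JK B C sB sC.
have sub L : <<s sgen L >> `<=` <<s cylinder L >>.
  by move=> A sA M [M1 M2]; apply: sA; split => // D /sgen_cylinder /M2.
have mC := sgen_meas sC.
have H B' : cylinder J B' -> (P (C `&` B') = P C * P B')%E.
  move=> cB; apply: (@dynkin_indep (cylinder K) B' _ _ _ _ C _).2 => //.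
  - exact: cylinder_meas cB.
  - exact: cylinder_meas.
  - exact: cylinderI.
  - by move=> D cD; rewrite setIC muleC; exact: cylinder_indep JK _ _ cB cD.
  - exact: sub.
apply: (@dynkin_indep (cylinder J) C _ _ _ _ B _).2 => //.
- exact: cylinder_meas.
- exact: cylinderI.
- by move=> D cD; rewrite setIC muleC; exact: H.
- exact: sub.
Qed.

(** [F] is a function of the variables with index in [J], encoded as
    measurability for the sigma-algebra that they generate. *)
Definition adapted (J : set I) (F : T -> R) : Prop :=
  measurable_fun (setT : set (g_sigma_algebraType (sgen J)))
    (F : g_sigma_algebraType (sgen J) -> R).

Lemma adapted_meas J F : adapted J F -> measurable_fun setT F.
Proof.
move=> aF _ A mA; rewrite setTI; apply: (@sgen_meas J).
by have := aF measurableT A mA; rewrite setTI.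
Qed.

Lemma adapted_X (J : set I) i : J i -> adapted J (X i).
Proof.
by move=> Ji _ A mA; rewrite setTI; apply: sub_gen_smallest; exists i, A.
Qed.

Lemma Ex_indep J K F G : J `&` K = set0 -> adapted J F -> adapted K G ->
  intg P F -> intg P G ->
  intg P (fun w => F w * G w) /\ Ex P (fun w => F w * G w) = Ex P F * Ex P G.
Proof.
move=> JK aF aG; apply: Ex_prod_indep => A B mA mB.
apply: (indep_blocks JK).
  by have := aF measurableT A mA; rewrite setTI.
by have := aG measurableT B mB; rewrite setTI.
Qed.

End independence.

(** * Limit theorems for expectations *)

Section limits.
Context {disp : measure_display} {T : measurableType disp} {R : realType}
  (P : probability T R).

Lemma integral_Ex (F : T -> R) : intg P F -> (\int[P]_w (F w)%:E = (Ex P F)%:E)%E.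
Proof. by move=> iF; rewrite -ExE// unlock. Qed.

Lemma ae_all (Q : nat -> T -> Prop) :
  (forall n, {ae P, forall w, Q n w}) -> {ae P, forall w, forall n, Q n w}.
Proof. by move=> h; apply/ae_foralln. Qed.

(** Carries bounds in L2 from partial sums to their almost sure limit. *)
Lemma Ex_fatou (F : nat -> T -> R) (G : T -> R) C :
  (forall n, intg P (F n)) -> (forall n w, 0 <= F n w) -> measurable_fun setT G ->
  (forall w, 0 <= G w) ->
  {ae P, forall w, F n w @[n --> \oo] --> G w} -> (forall n, Ex P (F n) <= C) ->
  intg P G /\ Ex P G <= C.
Proof.
move=> iF F0 mG G0 FG FC.
have mF n : measurable_fun setT (EFin \o F n) by apply/measurable_EFinP/(intg_meas (iF n)).
have le : (\int[P]_w (G w)%:E <= C%:E)%E.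
  have -> : (\int[P]_w (G w)%:E = \int[P]_w limn_einf (fun n => (F n w)%:E))%E.
    apply: ae_eq_integral => //; first exact/measurable_EFinP.
      rewrite (_ : (fun _ => _) = (fun w => - limn_esup (fun n => - (F n w)%:E))%E).
        have mL : measurable_fun setT (fun w => limn_esup (fun n => - (F n w)%:E))%E.
          apply: (@measurable_fun_limn_esup _ _ _ _ (fun n w => - (F n w)%:E)%E) => n.
          exact: measurableT_comp (mF n).
        exact: measurableT_comp mL.
      by apply/funext => w; rewrite (limn_esupN (fun n => (F n w)%:E)) oppeK.
    apply: filterS FG => w FGw _ /=.
    have : (F n w)%:E @[n --> \oo] --> (G w)%:E by apply: cvg_EFin => //; exact: nearW.
    by move=> /cvg_limn_einf_sup[-> _].
  apply: (le_trans (@fatou _ _ _ P _ measurableT (fun n w => (F n w)%:E) mF _)).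
    by move=> n w _; rewrite lee_fin.
  rewrite limn_einf_lim; apply: lime_le; first exact: is_cvg_einfs.
  apply: nearW => n; apply: (@le_trans _ _ (\int[P]_w (F n w)%:E)%E).
    by apply: ereal_inf_lbound; exists n => //=.
  by rewrite integral_Ex ?lee_fin.
have iG : intg P G.
  apply/integrableP; split; first exact/measurable_EFinP.
  under eq_integral do rewrite /= ger0_norm//.
  by rewrite (le_lt_trans le) ?ltry.
by split => //; rewrite -lee_fin -ExE// unlock.
Qed.

(** The series of the [F n] has a finite expectation, so it converges almost
    surely and its terms tend to zero. *)
Lemma as_cvg0 (F : nat -> T -> R) C :
  (forall n, intg P (F n)) -> (forall n w, 0 <= F n w) ->
  (forall N, \sum_(0 <= n < N) Ex P (F n) <= C) ->
  {ae P, forall w, F n w @[n --> \oo] --> 0}.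
Proof.
move=> iF F0 FC.
have mF n : measurable_fun setT (EFin \o F n) by apply/measurable_EFinP/(intg_meas (iF n)).
have mS : measurable_fun setT (fun w => \sum_(n <oo) (F n w)%:E)%E.
  apply: (@ge0_emeasurable_sum _ _ _ setT (fun n w => (F n w)%:E) xpredT).
    by move=> n w _ _; rewrite lee_fin.
  by move=> n _; exact: mF.
have iS : P.-integrable setT (fun w => \sum_(n <oo) (F n w)%:E)%E.
  apply/integrableP; split => //.
  rewrite (eq_integral (fun w => (\sum_(n <oo) (F n w)%:E)%E)); last first.
    by move=> w _; rewrite gee0_abs// nneseries_ge0// => n _ _; rewrite lee_fin.
  rewrite integral_nneseries//; last by move=> n w _; rewrite lee_fin.
  apply: (@le_lt_trans _ _ C%:E); last by rewrite ltry.
  apply: lime_le; first by apply: is_cvg_nneseries => n _ _; apply: integral_ge0 => w _; rewrite lee_fin.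
  apply: nearW => N.
  rewrite (eq_bigr (fun n => (Ex P (F n))%:E)) ?sumEFin ?lee_fin// => n _.
  by rewrite -ExE// unlock.
have := integrable_ae measurableT iS; apply: filterS => w /(_ I) fS.
apply: cvg_series_cvg_0; apply: nondecreasing_is_cvgn.
  by apply: nondecreasing_series => n _ _.
exists (fine (\sum_(n <oo) (F n w)%:E)%E) => _ [N _ <-].
rewrite -lee_fin fineK// /series /= -sumEFin.
by apply: nneseries_lim_ge => n _ _; rewrite lee_fin.
Qed.

Lemma Ex_dct (F : nat -> T -> R) (G H : T -> R) :
  (forall n, measurable_fun setT (F n)) -> measurable_fun setT G -> intg P H ->
  {ae P, forall w, F n w @[n --> \oo] --> G w} -> (forall n w, `|F n w| <= H w) ->
  intg P G /\ Ex P (F n) @[n --> \oo] --> Ex P G.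
Proof.
move=> mF mG iH FG FH.
have [] := @dominated_convergence _ T R P setT measurableT (fun n => EFin \o F n) (EFin \o G) (EFin \o H).
- by move=> n; exact/measurable_EFinP.
- exact/measurable_EFinP.
- by apply: filterS FG => w FGw _; apply: cvg_EFin => //; exact: nearW.
- exact: iH.
- by apply: nearW => w n _; rewrite lee_fin.
move=> iG _ c; split => //.
have iF n : intg P (F n) by apply: intg_le (FH n) _.
apply: fine_cvg; rewrite -/(Ex P G) fineK; last exact: integrable_fin_num.
exact: c.
Qed.

End limits.

(** * A strong law for orthogonal sequences *)

Lemma sum_inv_sq (R : realFieldType) N :
  \sum_(0 <= m < N) (m.+1%:R ^+ 2 : R)^-1 <= 2 * (1 - N.+1%:R^-1).
Proof.
elim: N => [|N IH]; first by rewrite big_geq// invr1 subrr mulr0.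
rewrite big_nat_recr//=; apply: (le_trans (lerD IH (lexx _))).
have a0 : (0 : R) < N.+1%:R by rewrite ltr0n.
have e : N.+2%:R = N.+1%:R + 1 :> R by rewrite -natr1.
have a1 : 1 <= N.+1%:R :> R by rewrite ler1n.
rewrite e; move: {IH e} (N.+1%:R : R) a0 a1 => a a0 a1.
suff : (a ^+ 2)^-1 <= 2 * (a^-1 - (a + 1)^-1) by move=> h; lra.
have -> : a^-1 - (a + 1)^-1 = (a * (a + 1))^-1 by field; lra.
rewrite ler_pdivlMr; last by nra.
rewrite mulrC ler_pdivrMr ?exprn_gt0//; nra.
Qed.

Lemma sqrt_floor (n : nat) : exists m, (m ^ 2 <= n < m.+1 ^ 2)%N.
Proof.
elim: n => [|n [m /andP[mn nm]]]; first by exists 0%N.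
have [nm1|nm1] := ltnP n.+1 (m.+1 ^ 2)%N; first by exists m; rewrite nm1 (leq_trans mn).
exists m.+1; rewrite nm1 /=; apply: (leq_ltn_trans nm).
by rewrite ltn_sqr.
Qed.

Section slln.
Context {disp : measure_display} {T : measurableType disp} {R : realType}
  (P : probability T R).

(** The means along the squares [m ^ 2] have summable second moments.  The gap
    between two consecutive squares has only [2 m + 1] elements, so that all the
    increments inside it can be controlled together, by their sum of squares. *)
Lemma slln_orthogonal (X : nat -> T -> R) C : 0 <= C ->
  (forall k, L2 P (X k)) ->
  (forall a n, Ex P (fun w => (\sum_(a <= k < a + n) X k w) ^+ 2) <= C * n%:R) ->
  {ae P, forall w, n%:R^-1 * (\sum_(0 <= k < n) X k w) @[n --> \oo] --> 0}.
Proof.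
move=> C0 lX XC.
pose V a n w := (\sum_(a <= k < a + n) X k w) ^+ 2.
have iV a n : intg P (V a n) by have [_] := L2_sum (index_iota a (a + n)) (fun k (_ : xpredT k) => lX k).
(* [2 * G m] bounds every squared mean whose index lies between the squares of [m.+1] and [m.+2] *)
pose G (m : nat) (w : T) := (m.+1%:R ^+ 4)^-1 * (\sum_(0 <= i < (2 * m.+1).+1) V (m.+1 ^ 2)%N i w + V 0%N (m.+1 ^ 2)%N w).
have iS m : intg P (fun w => \sum_(0 <= i < (2 * m.+1).+1) V (m.+1 ^ 2)%N i w).
  by apply: intg_sum => i _; exact: iV.
have G0 m w : 0 <= G m w.
  apply: mulr_ge0; first by rewrite invr_ge0 exprn_ge0.
  by apply: addr_ge0; [apply: sumr_ge0 => i _|]; exact: sqr_ge0.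
have iG m : intg P (G m) by apply: intgZ; apply: intgD.
have EG m : Ex P (G m) <= (10 * C) * (m.+1%:R ^+ 2)^-1.
  rewrite ExZ; last exact: intgD.
  rewrite ExD// Ex_sum//.
  set x := (m.+1%:R : R).
  have x1 : 1 <= x by rewrite ler1n.
  have s1 : \sum_(0 <= i < (2 * m.+1).+1) Ex P (V (m.+1 ^ 2)%N i) <= (2 * x + 1) * (C * (2 * x)).
    apply: (@le_trans _ _ (\sum_(0 <= i < (2 * m.+1).+1) C * (2 * x))); last first.
      by rewrite sumr_const_nat subn0 -[leLHS]mulr_natr -[(2 * m.+1).+1%:R]natr1 natrM [leLHS]mulrC.
    apply: ler_sum_nat => i /andP[_ im]; apply: (le_trans (XC _ _)).
    by apply: ler_wpM2l => //; rewrite /x -natrM ler_nat -ltnS.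
  have s2 : Ex P (V 0%N (m.+1 ^ 2)%N) <= C * x ^+ 2.
    by apply: (le_trans (XC _ _)); rewrite /x natrX.
  rewrite -[leRHS]mulrC.
  have -> : (x ^+ 2)^-1 * (10 * C) = (x ^+ 4)^-1 * (10 * C * x ^+ 2) by field; lra.
  apply: ler_wpM2l; first by rewrite invr_ge0 exprn_ge0//; lra.
  apply: (le_trans (lerD s1 s2)); nra.
have EGN N : \sum_(0 <= m < N) Ex P (G m) <= 10 * C * 2.
   apply: (@le_trans _ _ (\sum_(0 <= m < N) (10 * C) * (m.+1%:R ^+ 2)^-1)).
    by apply: ler_sum.
  rewrite -mulr_sumr ler_wpM2l ?mulr_ge0//.
  apply: (le_trans (sum_inv_sq _ _)); rewrite ler_piMr// lerBlDr lerDl invr_ge0//.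
have := as_cvg0 iG G0 EGN.
apply: filterS => w /cvgrPdist_le Gw; apply/cvgrPdist_le => /= e e0.
have e20 : 0 < e ^+ 2 / 2 by rewrite divr_gt0// exprn_gt0.
have [M _ HM] := Gw _ e20.
near=> n; rewrite sub0r normrN.
have [m /andP[mn nm]] := sqrt_floor n.
have Mm : (M < m)%N.
  rewrite ltnNge; apply/negP => mM.
  have : (n < M.+1 ^ 2)%N by apply: (leq_trans nm); rewrite leq_sqr.
  by rewrite ltnNge => /negP; apply; near: n; exists (M.+1 ^ 2)%N.
case: m mn nm Mm => // m mn nm; rewrite ltnS => /HM /=; rewrite sub0r normrN ger0_norm// => GM.
rewrite -(@ler_pXn2r _ 2%N) ?nnegrE ?normr_ge0 ?(ltW e0)// real_normK ?num_real//.
set x := (m.+1%:R : R); have x1 : 1 <= x by rewrite ler1n.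
have nx : x ^+ 2 <= n%:R by rewrite /x -natrX ler_nat.
have n0 : 0 < (n%:R : R) by apply: lt_le_trans nx; rewrite exprn_gt0//; lra.
set S := \sum_(0 <= k < n) X k w.
have SV : S ^+ 2 <= 2 * (V 0%N (m.+1 ^ 2)%N w + V (m.+1 ^ 2)%N (n - m.+1 ^ 2)%N w).
  rewrite /V subnKC// add0n /S (big_cat_nat (n := (m.+1 ^ 2)%N))//=.
  set a := \sum_(_ <= _ < _) _; set b := \sum_(_ <= _ < _) _.
  have := sqr_ge0 (a - b); nra.
have VG : V (m.+1 ^ 2)%N (n - m.+1 ^ 2)%N w <= \sum_(0 <= i < (2 * m.+1).+1) V (m.+1 ^ 2)%N i w.
  rewrite (big_rem (n - m.+1 ^ 2)%N) /=; last first.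
    by rewrite mem_index_iota /=; move: nm; lia.
  by rewrite lerDl sumr_ge0// => i _; exact: sqr_ge0.
rewrite exprMn exprVn; apply: (@le_trans _ _ (2 * G m w)); last by lra.
apply: (@le_trans _ _ ((x ^+ 4)^-1 * S ^+ 2)).
  apply: ler_wpM2r; first exact: sqr_ge0.
  rewrite lef_pV2 ?posrE ?exprn_gt0//.
  rewrite (_ : x ^+ 4 = (x ^+ 2) ^+ 2); last by rewrite -exprM.
  by rewrite ler_pXn2r ?nnegrE ?exprn_ge0//; lra.
rewrite /G [leRHS]mulrCA; apply: ler_wpM2l; first by rewrite invr_ge0 exprn_ge0.
apply: (le_trans SV); lra.
Unshelve. all: by end_near.
Qed.

End slln.

(** * A strong law for nonnegative functions of i.i.d. variables *)

Section dyadic.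
Variable R : realType.

Lemma pow2_gt0 j : (0 : R) < 2 ^+ j. Proof. by rewrite exprn_gt0. Qed.

(** The powers of 2 below [x] form a geometric sum dominated by its last term;
    integrated, this turns tail probabilities at dyadic levels into a first moment. *)
Lemma dyadic_tail_le (x : R) J : 0 <= x ->
  \sum_(0 <= j < J) 2 ^+ j * (if 2 ^+ j < x then 1 else 0) <= 2 * x.
Proof.
move=> x0.
have H K : \sum_(0 <= j < K) 2 ^+ j * (if 2 ^+ j < x then 1 else 0) <= 2 ^+ K - 1 :> R.
  elim: K => [|K IH]; first by rewrite big_geq// expr0 subrr.
  rewrite big_nat_recr//= exprS; have := pow2_gt0 K.
  by case: ifP => _; lra.
elim: J => [|J IH]; first by rewrite big_geq// mulr_ge0.
rewrite big_nat_recr//=; case: ifP => [xJ|_]; last by rewrite mulr0 addr0.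
by have := H J; lra.
Qed.

(** The inverse powers of 2 from the first level above [x] on form a geometric
    sum of order [1 / x]; integrated, this bounds the dyadically weighted second
    moments of truncations by a first moment. *)
Lemma dyadic_trunc_sq_le (x : R) J : 0 <= x ->
  \sum_(0 <= j < J) (2 ^+ j)^-1 * (if 2 ^+ j < x then 0 else x) ^+ 2 <= 2 * x.
Proof.
move=> x0.
have [H1 H2] : (x <= 2 ^+ J -> \sum_(0 <= j < J) (2 ^+ j)^-1 * (if 2 ^+ j < x then 0 else x) ^+ 2 <= 2 * x - 2 * (2 ^+ J)^-1 * x ^+ 2)
   /\ (2 ^+ J < x -> \sum_(0 <= j < J) (2 ^+ j)^-1 * (if 2 ^+ j < x then 0 else x) ^+ 2 = 0).
  elim: J => [|J [IH1 IH2]].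
    rewrite big_geq// expr0 invr1; split => // x1; nra.
  rewrite big_nat_recr//= exprS invfM; have p := pow2_gt0 J.
  have q : 0 < (2 ^+ J : R)^-1 by rewrite invr_gt0.
  have qp : 2 ^+ J * (2 ^+ J : R)^-1 = 1 by rewrite divff// gt_eqF.
  split => [x1|x1]; last by rewrite ifT ?IH2 ?expr0n ?mulr0 ?addr0//; lra.
  have [xJ|xJ] := ltP (2 ^+ J) x; last by have := IH1 xJ; lra.
  rewrite IH2// expr0n mulr0 addr0.
  have : (2 ^+ J : R)^-1 * x <= 2 by rewrite mulrC ler_pdivrMr//; lra.
  by nra.
have [xJ|xJ] := ltP (2 ^+ J) x; first by rewrite H2// mulr_ge0.
apply: (le_trans (H1 xJ)).
have : 0 <= (2 ^+ J : R)^-1 * x ^+ 2 by rewrite mulr_ge0 ?invr_ge0 ?sqr_ge0// ltW ?pow2_gt0.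
lra.
Qed.

(** The multiples [p * 2 ^ j] with [q <= p < 2 * q] form a grid of relative mesh
    [1 / q], while for each of the finitely many [p] they are a geometric
    sequence along which second moments are summable. *)
Lemma dyadic_locate (q n : nat) : (0 < q)%N -> (q <= n)%N ->
  exists j p, [/\ (q <= p < 2 * q)%N, (p * 2 ^ j <= n < p.+1 * 2 ^ j)%N & (n < q * 2 ^ j.+1)%N].
Proof.
move=> q0 qn; have nq0 : (0 < n %/ q)%N by rewrite divn_gt0.
pose j := trunc_log 2 (n %/ q); have /andP[j1 j2] := trunc_log_bounds (isT : (1 < 2)%N) nq0.
rewrite -/j in j1 j2.
have n1 : (q * 2 ^ j <= n)%N by rewrite mulnC -leq_divRL.
have n2 : (n < q * 2 ^ j.+1)%N by rewrite mulnC -ltn_divLR.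
have p0 : (0 < 2 ^ j)%N by rewrite expn_gt0.
exists j, (n %/ 2 ^ j)%N; split => //.
  by rewrite leq_divRL// n1 ltn_divLR//= -mulnA (mulnC q) mulnA -expnS mulnC.
by rewrite leq_trunc_div /= ltn_ceil.
Qed.

End dyadic.

Section iid.
Context {disp : measure_display} {T : measurableType disp} {R : realType}
  (P : probability T R) (Z : nat -> {RV P >-> R}) (Ziid : iid Z).

Lemma iid_Ex (g : R -> R) i k : measurable_fun setT g -> intg P (fun w => g (Z i w)) ->
  intg P (fun w => g (Z k w)) /\ Ex P (fun w => g (Z k w)) = Ex P (fun w => g (Z i w)).
Proof.
move=> mg ig.
have D : forall A, measurable A -> distribution P (Z k) A = distribution P (Z i) A.
  by move=> A mA; apply: Ziid.2.
have mgE : measurable_fun setT (EFin \o g) by exact/measurable_EFinP.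
have ik : intg P (fun w => g (Z k w)).
  apply/integrableP; split.
    by apply/measurable_EFinP; apply: measurableT_comp.
  have mga : measurable_fun setT (fun x : R => `|(g x)%:E|%E) by exact: measurableT_comp.
  have := @ge0_integral_distribution _ _ _ _ _ P (Z k) _ mga (fun x => abse_ge0 _).
  rewrite /comp => <-.
  rewrite (@eq_measure_integral _ _ _ _ (distribution P (Z i))); last by move=> A mA _; exact: D.
  rewrite ge0_integral_distribution//.
  by have /integrableP[] := ig.
split => //; apply: EFin_inj; rewrite -!integral_Ex//.
rewrite -(@integral_distribution _ _ _ _ _ P (Z k) (EFin \o g))//.
rewrite (@eq_measure_integral _ _ _ _ (distribution P (Z i))); last by move=> A mA _; exact: D.
by rewrite integral_distribution.
Qed.

Lemma adapted_comp (J : set nat) i (g : R -> R) : J i -> measurable_fun setT g ->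
  adapted Z J (fun w => g (Z i w)).
Proof. by move=> Ji mg; apply: measurableT_comp => //; exact: adapted_X. Qed.

Lemma iid_Ex2 (f g : R -> R) i k : i != k ->
  measurable_fun setT f -> measurable_fun setT g ->
  intg P (fun w => f (Z i w)) -> intg P (fun w => g (Z k w)) ->
  intg P (fun w => f (Z i w) * g (Z k w)) /\
  Ex P (fun w => f (Z i w) * g (Z k w)) = Ex P (fun w => f (Z i w)) * Ex P (fun w => g (Z k w)).
Proof.
move=> ik mf mg; apply: (@Ex_indep _ _ _ P _ Z Ziid.1 [set i] [set k]).
- by apply/seteqP; split => // x [-> /eqP]; rewrite (negbTE ik).
- exact: adapted_comp.
- exact: adapted_comp.
Qed.

End iid.

Section orth.
Context {disp : measure_display} {T : measurableType disp} {R : realType}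
  (P : probability T R).

Lemma Ex_sqr_sum_orth (I : eqType) (s : seq I) (F : I -> T -> R) : uniq s ->
  (forall i, i \in s -> L2 P (F i)) ->
  (forall i k, i \in s -> k \in s -> i != k -> Ex P (fun w => F i w * F k w) = 0) ->
  Ex P (fun w => (\sum_(i <- s) F i w) ^+ 2) = \sum_(i <- s) Ex P (fun w => F i w ^+ 2).
Proof.
elim: s => [_ _ _|i s IH /= /andP[ins us] lF oF].
  by rewrite big_nil -[RHS](Ex_cst P 0); congr Ex; apply/funext => w; rewrite big_nil expr0n.
have lS : L2 P (fun w => \sum_(k <- s) F k w).
  rewrite (_ : (fun _ => _) = (fun w => \sum_(k <- s | k \in s) F k w)).
    by apply: L2_sum => k ks; apply: lF; rewrite inE ks orbT.
  by apply/funext => w; rewrite big_seq.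
have li : L2 P (F i) by apply: lF; rewrite mem_head.
have iS := L2M li lS.
rewrite big_cons -IH//; last 2 first.
  by move=> k ks; apply: lF; rewrite inE ks orbT.
  by move=> k l ks ls; apply: oF; rewrite inE ?ks ?ls orbT.
have -> : (fun w => (\sum_(k <- i :: s) F k w) ^+ 2) = (fun w => F i w ^+ 2 +
    (2 * (F i w * \sum_(k <- s) F k w) + (\sum_(k <- s) F k w) ^+ 2)).
  by apply/funext => w; rewrite big_cons; ring.
rewrite ExD; [|exact: li.2|apply: intgD; [exact: intgZ|exact: lS.2]].
rewrite ExD; [|exact: intgZ|exact: lS.2].
rewrite ExZ//.
suff -> : Ex P (fun w => F i w * \sum_(k <- s) F k w) = 0 by rewrite mulr0 add0r.
rewrite (_ : (fun _ => _) = (fun w => \sum_(k <- s) if k \in s then F i w * F k w else 0)); last first.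
  by apply/funext => w; rewrite big_distrr/= big_seq [RHS]big_seq; apply: eq_bigr => k ->.
rewrite (@Ex_sum _ _ _ P _ _ (fun k w => if k \in s then F i w * F k w else 0)); last first.
  move=> k; have [ks|_] := boolP (k \in s); last exact: intg_cst.
  by apply: L2M => //; apply: lF; rewrite inE ks orbT.
rewrite big_seq big1// => k ks; rewrite ks oF ?mem_head// ?inE ?ks ?orbT//.
by apply/eqP => ik; rewrite ik ks in ins.
Qed.

End orth.

Section slln_iid.
Context {disp : measure_display} {T : measurableType disp} {R : realType}
  (P : probability T R) (Z : nat -> {RV P >-> R}) (Ziid : iid Z).
Variable (h : R -> R).
Hypothesis (mh : measurable_fun setT h) (h0 : forall x, 0 <= h x)
  (ih : intg P (fun w => h (Z 0%N w))).

(** Truncation of [h] at the level [2 ^ j], and the indicator of the event that it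
    changes the value. *)
Let tr (j : nat) (x : R) : R := if 2 ^+ j < h x then 0 else h x.
Let ex (j : nat) (x : R) : R := if 2 ^+ j < h x then 1 else 0.

Let mtr j : measurable_fun setT (tr j).
Proof.
apply: measurable_fun_ifT => //; apply: measurable_fun_ltr => //.
Qed.

Let mex j : measurable_fun setT (ex j).
Proof.
apply: measurable_fun_ifT => //; apply: measurable_fun_ltr => //.
Qed.

Let tr_bd j x : `|tr j x| <= 2 ^+ j.
Proof.
rewrite /tr; case: ltP => [_|hx]; first by rewrite normr0 exprn_ge0.
by rewrite ger0_norm.
Qed.

Let ex_bd j x : `|ex j x| <= 1.
Proof. by rewrite /ex; case: ifP; rewrite ?normr0 ?normr1. Qed.

Let mu : R := Ex P (fun w => h (Z 0%N w)).
Let muj j : R := Ex P (fun w => tr j (Z 0%N w)).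

Let mZ (g : R -> R) k : measurable_fun setT g -> measurable_fun setT (fun w => g (Z k w)).
Proof. by move=> mg; apply: measurableT_comp. Qed.

Let pow2_cvg (x : R) : exists J : nat, forall j, (J <= j)%N -> x <= 2 ^+ j.
Proof.
exists (Num.bound `|x|) => j Jj; apply: (@le_trans _ _ (Num.bound `|x|)%:R).
  by rewrite (le_trans (ler_norm _))// ltW// archi_boundP.
rewrite -natrX ler_nat (leq_trans Jj)//.
by rewrite ltnW// ltn_expl.
Qed.

Let muj_cvg : muj j @[j --> \oo] --> mu.
Proof.
have [] := @Ex_dct _ _ _ P (fun j w => tr j (Z 0%N w)) (fun w => h (Z 0%N w)) (fun w => h (Z 0%N w)) => //.
- by move=> j; exact: mZ.
- exact: mZ.
- apply: nearW => w; apply: cvg_near_cst.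
  have [J HJ] := pow2_cvg (h (Z 0%N w)); exists J => // j /= /HJ; rewrite /tr.
  by case: ltP.
- move=> j w; rewrite /tr; case: ifP => _; last by rewrite ger0_norm.
  by rewrite normr0.
Qed.

(** Among the first [N j] variables, where [N j] is of the order of the truncation
    level [2 ^ j], eventually none is truncated, and the truncated means have
    summable variances; both series are bounded by a multiple of the first moment. *)
Let slln_dyadic (p : nat) :
  {ae P, forall w, (p.+1 * 2 ^ j)%:R^-1 * (\sum_(0 <= k < p.+1 * 2 ^ j) h (Z k w)) @[j --> \oo] --> mu}.
Proof.
pose N j := (p.+1 * 2 ^ j)%N.
have NE j : (N j)%:R = p.+1%:R * 2 ^+ j :> R by rewrite /N natrM natrX.
have N0 j : (0 : R) < (N j)%:R by rewrite NE mulr_gt0// pow2_gt0.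
pose D j k w := tr j (Z k w) - muj j.
have lT j k : L2 P (fun w => tr j (Z k w)) by apply: (@L2_bd _ _ _ _ _ (2 ^+ j)) => //; exact: mZ.
have lD j k : L2 P (D j k) by apply: L2B => //; exact: L2_cst.
have ED j k : Ex P (D j k) = 0.
  rewrite ExB ?Ex_cst; [|exact: L2_intg|exact: intg_cst].
  by rewrite (iid_Ex Ziid k (mtr j) (L2_intg (lT j 0%N))).2 subrr.
have VD j k : Ex P (fun w => D j k w ^+ 2) <= Ex P (fun w => tr j (Z 0%N w) ^+ 2).
  have mD : measurable_fun setT (fun x => (tr j x - muj j) ^+ 2).
    by apply: measurable_funX; apply: measurable_funB.
  rewrite (iid_Ex Ziid k mD (lD j 0%N).2).2.
  rewrite (_ : (fun _ => _) = (fun w => tr j (Z 0%N w) ^+ 2 + ((- (2 * muj j)) * tr j (Z 0%N w) + muj j ^+ 2))); last first.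
    by apply/funext => w; ring.
  have iT := L2_intg (lT j 0%N).
  rewrite ExD; [|exact: (lT j 0%N).2|apply: intgD; [exact: intgZ|exact: intg_cst]].
  rewrite ExD; [|exact: intgZ|exact: intg_cst].
  by rewrite ExZ// Ex_cst -/(muj j); have := sqr_ge0 (muj j); lra.
have oD j i k : i != k -> Ex P (fun w => D j i w * D j k w) = 0.
  move=> ik; have mD : measurable_fun setT (fun x => tr j x - muj j) by apply: measurable_funB.
  by rewrite (iid_Ex2 Ziid ik mD mD (L2_intg (lD j i)) (L2_intg (lD j k))).2 ED mul0r.
(* if [F j w < 1] no variable has been truncated, since each would contribute 1 *)
pose F j w := ((N j)%:R^-1 * \sum_(0 <= k < N j) D j k w) ^+ 2 + \sum_(0 <= k < N j) ex j (Z k w).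
have lS j : L2 P (fun w => (N j)%:R^-1 * \sum_(0 <= k < N j) D j k w).
  by apply: L2Z; apply: L2_sum => k _.
have iex j k : intg P (fun w => ex j (Z k w)) by apply: (@intg_bd _ _ _ _ _ 1) => //; exact: mZ.
have iE j : intg P (fun w => \sum_(0 <= k < N j) ex j (Z k w)).
  by apply: intg_sum => k _.
have iF j : intg P (F j) by apply: intgD => //; exact: (lS j).2.
have e0 j x : 0 <= ex j x by rewrite /ex; case: ifP.
have F0 j w : 0 <= F j w.
  by rewrite addr_ge0 ?sqr_ge0// sumr_ge0.
have EF j : Ex P (F j) <= (2 ^+ j)^-1 * Ex P (fun w => tr j (Z 0%N w) ^+ 2)
    + p.+1%:R * (2 ^+ j * Ex P (fun w => ex j (Z 0%N w))).
  rewrite ExD//; last exact: (lS j).2.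
  apply: lerD.
    under [X in Ex P X]funext do rewrite exprMn.
    rewrite ExZ; last by have [] := L2_sum (index_iota 0 (N j)) (fun k (_ : xpredT k) => lD j k).
    rewrite (Ex_sqr_sum_orth (F := D j)) ?iota_uniq//; last by move=> i k _ _; exact: oD.
    apply: (@le_trans _ _ ((N j)%:R^-1 ^+ 2 * \sum_(0 <= k < N j) Ex P (fun w => tr j (Z 0%N w) ^+ 2))).
      by apply: ler_wpM2l; [exact: sqr_ge0|apply: ler_sum].
    rewrite sumr_const_nat subn0 -[X in _ * X]mulr_natl expr2 -mulrA mulKf ?gt_eqF//.
    apply: ler_wpM2r; first by apply: Ex_ge0 => w; exact: sqr_ge0.
    rewrite lef_pV2 ?posrE ?pow2_gt0// NE ler_peMl ?ler1n// ltW// pow2_gt0//.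
  rewrite (@Ex_sum _ _ _ P _ _ (fun k w => ex j (Z k w)))//.
  rewrite (eq_bigr (fun=> Ex P (fun w => ex j (Z 0%N w)))); last first.
    by move=> k _; rewrite (iid_Ex Ziid k (mex j) (iex j 0%N)).2.
  by rewrite sumr_const_nat subn0 -[_ *+ N j]mulr_natl NE mulrA.
have SF J : \sum_(0 <= j < J) Ex P (F j) <= 2 * mu + p.+1%:R * (2 * mu).
  apply: (le_trans (ler_sum _ (fun j _ => EF j))).
  rewrite big_split /=; apply: lerD.
    rewrite -[X in _ <= X]ExZ//.
    rewrite [leLHS](_ : _ = Ex P (fun w => \sum_(0 <= j < J) (2 ^+ j)^-1 * tr j (Z 0%N w) ^+ 2)).
      apply: Ex_le; [|exact: intgZ|].
        by apply: intg_sum => j _; apply: intgZ; exact: (lT j 0%N).2.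
      by move=> w; exact: dyadic_trunc_sq_le.
    rewrite (@Ex_sum _ _ _ P _ _ (fun j w => (2 ^+ j)^-1 * tr j (Z 0%N w) ^+ 2)).
      by apply: eq_bigr => j _; rewrite ExZ//; exact: (lT j 0%N).2.
    by move=> j; apply: intgZ; exact: (lT j 0%N).2.
  rewrite -mulr_sumr; apply: ler_wpM2l => //.
  rewrite -[X in _ <= X]ExZ//.
  rewrite [leLHS](_ : _ = Ex P (fun w => \sum_(0 <= j < J) (2 ^+ j) * ex j (Z 0%N w))).
    apply: Ex_le; [|exact: intgZ|].
      by apply: intg_sum => j _; apply: intgZ.
    by move=> w; exact: dyadic_tail_le.
  rewrite (@Ex_sum _ _ _ P _ _ (fun j w => (2 ^+ j) * ex j (Z 0%N w))).
    by apply: eq_bigr => j _; rewrite ExZ.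
  by move=> j; apply: intgZ.
have := as_cvg0 iF F0 SF; apply: filterS => w Fw.
pose A j := (N j)%:R^-1 * \sum_(0 <= k < N j) D j k w.
have A0 : A j @[j --> \oo] --> 0.
  apply/cvgrPdist_le => e e0'.
  have e20 : 0 < e ^+ 2 by rewrite exprn_gt0.
  move/cvgrPdist_le : Fw => /(_ _ e20); apply: filterS => j /=.
  rewrite !sub0r !normrN ger0_norm// => Fe.
  rewrite -(@ler_pXn2r _ 2%N) ?nnegrE ?normr_ge0 ?(ltW e0')// real_normK ?num_real//.
  by apply: le_trans Fe; rewrite /F lerDl sumr_ge0.
have : A j + muj j @[j --> \oo] --> 0 + mu by apply: cvgD => //; exact: muj_cvg.
rewrite add0r; apply: cvg_trans; apply: near_eq_cvg.
have h2 : (0 : R) < 2^-1 by rewrite invr_gt0.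
move/cvgrPdist_le : Fw => /(_ _ h2); apply: filterS => j /=.
rewrite sub0r normrN ger0_norm// => Fe.
have exZ k : (k < N j)%N -> ex j (Z k w) = 0.
  move=> kN; apply/eqP/negPn/negP => ek.
  have : 1 <= F j w; last by move=> h1; lra.
  apply: (@le_trans _ _ (\sum_(0 <= k < N j) ex j (Z k w))); last by rewrite /F lerDr sqr_ge0.
  rewrite (big_rem k) /=; last by rewrite mem_index_iota.
  have -> : ex j (Z k w) = 1 by move: ek; rewrite /ex; case: ifP; rewrite ?eqxx.
  by rewrite lerDl sumr_ge0.
rewrite /A -/(N j).
have -> : \sum_(0 <= k < N j) D j k w = \sum_(0 <= k < N j) tr j (Z k w) - (N j)%:R * muj j.
  by rewrite sumrB sumr_const_nat subn0 mulr_natl.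
rewrite mulrBr mulKf ?gt_eqF// subrK.
congr (_ * _); apply: eq_big_nat => k /andP[_ kN].
have := exZ k kN; rewrite /ex /tr; case: ifP => // _ /eqP.
by rewrite oner_eq0.
Qed.

(** Partial sums of nonnegative terms are monotone, so convergence along the
    sequences [p * 2 ^ j], for each [p], extends to all indices by interpolation. *)
Lemma slln_iid :
  {ae P, forall w, n%:R^-1 * (\sum_(0 <= k < n) h (Z k w)) @[n --> \oo] --> mu}.
Proof.
have := ae_all slln_dyadic; apply: filterS => w Hw.
have mu0 : 0 <= mu by exact: Ex_ge0.
pose S n := \sum_(0 <= k < n) h (Z k w).
have Smon m n : (m <= n)%N -> S m <= S n.
  by move=> mn; rewrite /S [leRHS](big_cat_nat (n := m))//= lerDl sumr_ge0.
apply/cvgrPdist_le => /= e e0.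
(* the multipliers q <= p <= 2q resolve n up to a factor 1 + 1/q *)
have [q [q0 qe]] : exists q : nat, (0 < q)%N /\ (mu + 1) / q%:R <= e / 2.
  exists (Num.bound ((mu + 1) / (e / 2))).+1; split => //.
  rewrite ler_pdivrMr// mulrC -ler_pdivrMr ?divr_gt0//.
  rewrite ltW// (lt_trans (archi_boundP _)) ?ltr_nat//.
  by rewrite divr_ge0 ?addr_ge0// ltW// divr_gt0.
pose e' := Num.min 1 (e / 4).
have e'0 : 0 < e' by rewrite lt_min ltr01 divr_gt0.
have [J HJ] : exists J, forall p j, (p <= 2 * q)%N -> (J <= j)%N ->
    `|mu - (p.+1 * 2 ^ j)%:R^-1 * S (p.+1 * 2 ^ j)%N| <= e'.
  elim: (2 * q)%N => [|m [J HJ]].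
    have := Hw 0%N; move=> /cvgrPdist_le /(_ _ e'0) [J _ HJ]; exists J => p j.
    by rewrite leqn0 => /eqP -> /HJ.
  have := Hw m.+1; move=> /cvgrPdist_le /(_ _ e'0) [K _ HK]; exists (maxn J K) => p j.
  rewrite geq_max leq_eqVlt => /orP[/eqP ->|pm] /andP[Jj Kj]; first exact: HK.
  exact: HJ.
near=> n.
have qn : (q <= n)%N by near: n; exists q.
have [j [p [/andP[qp p2q] /andP[pn np] nq]]] := dyadic_locate q0 qn.
have Jj : (J <= j)%N.
  rewrite leqNgt; apply/negP => jJ.
  have : (n < q * 2 ^ J)%N.
    by apply: (leq_trans nq); rewrite leq_mul2l leq_exp2l// jJ orbT.
  by rewrite ltnNge => /negP; apply; near: n; exists (q * 2 ^ J)%N.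
case: p qp p2q pn np => [|p] qp p2q pn np; first by move: qp; rewrite leqn0 => /eqP q00; rewrite q00 in q0.
have B1 := HJ p j (ltnW (ltnW p2q)) Jj.
have B2 := HJ p.+1 j (ltnW p2q) Jj.
set x := (2 ^+ j : R); have x0 : 0 < x by exact: pow2_gt0.
have E1 : (p.+1 * 2 ^ j)%:R = p.+1%:R * x :> R by rewrite natrM natrX.
have E2 : (p.+2 * 2 ^ j)%:R = (p.+1%:R + 1) * x :> R by rewrite natrM natrX -natr1.
rewrite E1 in B1; rewrite E2 in B2.
have n1 : p.+1%:R * x <= n%:R by rewrite -E1 ler_nat.
have n2 : n%:R <= (p.+1%:R + 1) * x by rewrite -E2 ler_nat ltnW.
have S1 := Smon _ _ pn; have S2 := Smon _ _ (ltnW np).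
set a := S _ in B1 S1; set b := S _ in B2 S2.
have qp' : (q%:R : R) <= p.+1%:R by rewrite ler_nat.
set y := (p.+1%:R : R) in B1 B2 n1 n2 qp'.
have q0' : (1 : R) <= q%:R by rewrite ler1n.
have y1 : 1 <= y by apply: le_trans qp'.
move: B1 B2; rewrite !ler_norml => /andP[B1 B1'] /andP[B2 B2'].
have yx : 0 < y * x by nra.
have n0 : 0 < (n%:R : R) by apply: lt_le_trans n1.
have e1 : e' <= 1 by rewrite ge_min lexx.
have e4 : e' <= e / 4 by rewrite ge_min lexx orbT.
have Eb : b <= (mu + e') * ((y + 1) * x).
  have : ((y + 1) * x)^-1 * b <= mu + e' by lra.
  by rewrite mulrC ler_pdivrMr//; nra.
have Ea : (mu - e') * (y * x) <= a.
  have : mu - e' <= (y * x)^-1 * a by rewrite lerBlDr addrC -lerBlDr.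
  by rewrite mulrC ler_pdivlMr.
have Sn0 : 0 <= S n by apply: sumr_ge0.
have qe' : mu + 1 <= e / 2 * y.
  have : mu + 1 <= e / 2 * q%:R by rewrite -ler_pdivrMr//; lra.
  by nra.
rewrite -/(S n) mulrC.
have lo : - e + mu <= S n / n%:R.
  rewrite ler_pdivlMr//; apply: le_trans S1; apply: le_trans Ea.
  have [neg|pos] := leP (- e + mu) 0.
    have h1 : (- e + mu) * n%:R <= (- e + mu) * (y * x) by rewrite ler_wnM2l.
    have h2 : 0 <= (e - e') * (y * x) by apply: mulr_ge0; lra.
    by move: h1 h2; lra.
  have h1 : (- e + mu) * n%:R <= (- e + mu) * ((y + 1) * x) by rewrite ler_wpM2l// ltW.
  apply: (le_trans h1).
  rewrite !mulrA ler_pM2r//.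
  have h2 : e' * y <= e / 4 * y by rewrite ler_wpM2r//; lra.
  have h3 : 0 <= e * y by apply: mulr_ge0; lra.
  lra.
have hi : S n / n%:R <= e + mu.
  rewrite ler_pdivrMr//; apply: (le_trans S2); apply: (le_trans Eb).
  have h1 : (e + mu) * (y * x) <= (e + mu) * n%:R by rewrite ler_wpM2l//; lra.
  apply: le_trans h1.
  rewrite !mulrA ler_pM2r//.
  have h2 : e' * y <= e / 4 * y by rewrite ler_wpM2r//; lra.
  have h3 : 0 <= e * y by apply: mulr_ge0; lra.
  lra.
by move: lo hi; move: (S n / n%:R) => u lo hi; apply/andP; split; lra.
Unshelve. all: by end_near.
Qed.

End slln_iid.

(** * Trigonometric and exponential inequalities *)

Section trig.
Variable R : realType.
Implicit Types x y : R.

Lemma lipschitz_of_derive (f df : R -> R) : (forall x, is_derive x 1 f (df x)) ->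
  (forall x, `|df x| <= 1) -> forall x y, `|f x - f y| <= `|x - y|.
Proof.
move=> fd dfb.
have H x y : x <= y -> `|f y - f x| <= `|y - x|.
  move=> xy; have [|c _ ->] := @MVT_segment R f df x y xy (fun z _ => fd z).
    apply: continuous_subspaceT => z; apply: differentiable_continuous.
    by apply/derivable1_diffP; have [] := fd z.
  by rewrite normrM ler_piMl.
move=> x y; have [xy|/ltW yx] := leP x y; last exact: H.
by rewrite distrC [leRHS]distrC; exact: H.
Qed.

Lemma cos_lip x y : `|cos x - cos y| <= `|x - y|.
Proof.
apply: (@lipschitz_of_derive (@cos R) (fun z => - sin z)) => z.
by rewrite normrN sin_max.
Qed.

Lemma sin_lip x y : `|sin x - sin y| <= `|x - y|.
Proof.
apply: (@lipschitz_of_derive (@sin R) (@cos R)) => z.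
exact: cos_max.
Qed.

Lemma sin_le_norm x : `|sin x| <= `|x|.
Proof. by have := sin_lip x 0; rewrite sin0 !subr0. Qed.

Lemma one_sub_cos_le x : `|1 - cos x| <= x ^+ 2 / 2.
Proof.
have -> : 1 - cos x = 2 * sin (x / 2) ^+ 2.
  have -> : cos x = cos ((x / 2) *+ 2) by rewrite -mulr_natr -mulrA mulVf ?mulr1.
  rewrite cos_mulr2n sin2cos2; ring.
rewrite ger0_norm; last by rewrite mulr_ge0// sqr_ge0.
have : sin (x / 2) ^+ 2 <= (x / 2) ^+ 2.
  rewrite -[leLHS]real_normK ?num_real// -[leRHS]real_normK ?num_real//.
  by rewrite ler_pXn2r ?nnegrE// sin_le_norm.
by rewrite expr_div_n; lra.
Qed.

Lemma sub_sin_le x : `|x - sin x| <= `|x| ^+ 3.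
Proof.
have H y : 0 <= y -> `|y - sin y| <= y ^+ 3.
  move=> y0; pose f := (fun z : R => z - sin z).
  have fd z : is_derive z (1 : R) f (1 - cos z) by apply: is_deriveB.
  have [|c] := @MVT_segment R f (fun z => 1 - cos z) 0 y y0 (fun z _ => fd z).
    apply: continuous_subspaceT => z; apply: differentiable_continuous.
    by apply/derivable1_diffP; have [] := fd z.
  rewrite in_itv/= /f sin0 !subr0 => /andP[c0 cy] ->.
  rewrite normrM (ger0_norm y0) exprSr; apply: ler_wpM2r => //.
  apply: (le_trans (one_sub_cos_le _)).
  have : c ^+ 2 <= y ^+ 2 by rewrite ler_pXn2r ?nnegrE.
  have := sqr_ge0 y; lra.
have [x0|x0] := leP 0 x; first by rewrite (ger0_norm x0); exact: H.
have := H (- x); rewrite sinN -opprD normrN oppr_ge0 => /(_ (ltW x0)).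
by rewrite (ltr0_norm x0).
Qed.

Lemma cos_quadratic x : `|cos x - (1 - x ^+ 2 / 2)| <= `|x| ^+ 3.
Proof.
have -> : cos x - (1 - x ^+ 2 / 2) = 2 * ((x / 2 - sin (x / 2)) * (x / 2 + sin (x / 2))).
  have -> : cos x = cos ((x / 2) *+ 2) by rewrite -mulr_natr -mulrA mulVf ?mulr1.
  rewrite cos_mulr2n; have := sin2cos2 (x / 2); move: (sin _) (cos _) => s c; nra.
have [y ->] : exists y, x = 2 * y by exists (x / 2); field.
rewrite [2 * y]mulrC mulfK// mulrC.
rewrite !normrM (ger0_norm (ler0n R 2)) exprMn.
have h1 := sub_sin_le y.
have h2 : `|y - sin y| <= 2 * `|y|.
  by apply: (le_trans (ler_normB _ _)); have := sin_le_norm y; lra.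
have h3 : `|y + sin y| <= 2 * `|y|.
  by apply: (le_trans (ler_normD _ _)); have := sin_le_norm y; lra.
have [y1|y1] := leP `|y| 1.
  have h4 : `|y - sin y| * `|y + sin y| <= `|y| ^+ 3 * 2.
    by apply: ler_pM => //; lra.
  have := exprn_ge0 3 (normr_ge0 y); lra.
have h4 : `|y - sin y| * `|y + sin y| <= (2 * `|y|) * (2 * `|y|) by apply: ler_pM.
have : `|y| ^+ 2 <= `|y| ^+ 3 by rewrite ler_weXn2l// ltW.
have := sqr_ge0 `|y|; nra.
Qed.

Lemma cosD_taylor x y :
  `|cos (y + x) - (cos y - x * sin y - x ^+ 2 / 2 * cos y)| <= 2 * `|x| ^+ 3.
Proof.
have -> : cos (y + x) - (cos y - x * sin y - x ^+ 2 / 2 * cos y) =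
   cos y * (cos x - (1 - x ^+ 2 / 2)) + sin y * (x - sin x).
  rewrite cosD; ring.
apply: (le_trans (ler_normD _ _)); rewrite !normrM.
have h1 : `|cos y| * `|cos x - (1 - x ^+ 2 / 2)| <= 1 * `|x| ^+ 3.
  by apply: ler_pM => //; [exact: cos_max|exact: cos_quadratic].
have h2 : `|sin y| * `|x - sin x| <= 1 * `|x| ^+ 3.
  by apply: ler_pM => //; [exact: sin_max|exact: sub_sin_le].
lra.
Qed.

Lemma expRN_quadratic x : 0 <= x -> `|expR (- x) - (1 - x)| <= x ^+ 2.
Proof.
move=> x0; have h1 := expR_ge1Dx (- x); rewrite ger0_norm; last by lra.
rewrite expRN.
have : (expR x)^-1 <= (1 + x)^-1.
  by rewrite lef_pV2 ?posrE ?expR_gt0 ?expR_ge1Dx//; lra.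
have : (1 + x)^-1 <= 1 - x + x ^+ 2.
  rewrite -[leLHS]mul1r ler_pdivrMr; last by lra.
  have := exprn_ge0 3 x0; rewrite !exprS; nra.
lra.
Qed.

Lemma measurable_cos : measurable_fun setT (@cos R).
Proof. by apply: continuous_measurable_fun; exact: continuous_cos. Qed.

Lemma measurable_sin : measurable_fun setT (@sin R).
Proof. by apply: continuous_measurable_fun; exact: continuous_sin. Qed.

End trig.

(** Passes from truncated to full sums, the truncation error being uniform in [n]. *)
Lemma cvg_of_approx (R : realType) (x : nat -> R) (y : nat -> nat -> R) (L : nat -> R) (l : R)
  (del : nat -> R) :
  (forall i n, (0 < n)%N -> `|x n - y i n| <= del i) ->
  (forall i, y i n @[n --> \oo] --> L i) ->
  del i @[i --> \oo] --> 0 -> L i @[i --> \oo] --> l ->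
  x n @[n --> \oo] --> l.
Proof.
move=> xy yL d0 Ll; apply/cvgrPdist_le => /= e e0.
have e3 : 0 < e / 3 by rewrite divr_gt0.
move/cvgrPdist_le : d0 => /(_ _ e3) [I1 _ H1].
move/cvgrPdist_le : Ll => /(_ _ e3) [I2 _ H2].
pose i := maxn I1 I2.
have {}H1 : `|0 - del i| <= e / 3 by apply: H1; rewrite /= leq_maxl.
have {}H2 : `|l - L i| <= e / 3 by apply: H2; rewrite /= leq_maxr.
move/cvgrPdist_le : (yL i) => /(_ _ e3) H3.
near=> n.
have h3 : `|L i - y i n| <= e / 3 by near: n.
have h4 : `|x n - y i n| <= del i by apply: xy; near: n; exists 1%N.
have h1 : del i <= e / 3 by move: H1; rewrite sub0r normrN; apply: le_trans; exact: ler_norm.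
have -> : l - x n = (l - L i) + (L i - y i n) - (x n - y i n) by ring.
apply: (le_trans (ler_normB _ _)).
have := ler_normD (l - L i) (L i - y i n); lra.
Unshelve. all: by end_near.
Qed.

Lemma cvg_sumr (R : realType) (I : Type) (s : seq I) (F : I -> nat -> R) (L : I -> R) :
  (forall i, F i n @[n --> \oo] --> L i) ->
  \sum_(i <- s) F i n @[n --> \oo] --> \sum_(i <- s) L i.
Proof.
move=> FL; elim: s => [|i s IH].
  by under eq_fun do rewrite big_nil; rewrite big_nil; exact: cvg_cst.
by under eq_fun do rewrite big_cons; rewrite big_cons; exact: cvgD.
Qed.

Lemma cvg_prodr (R : realType) (I : Type) (s : seq I) (F : I -> nat -> R) (L : I -> R) :
  (forall i, F i n @[n --> \oo] --> L i) ->
  \prod_(i <- s) F i n @[n --> \oo] --> \prod_(i <- s) L i.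
Proof.
move=> FL; elim: s => [|i s IH].
  by under eq_fun do rewrite big_nil; rewrite big_nil; exact: cvg_cst.
by under eq_fun do rewrite big_cons; rewrite big_cons; exact: cvgM.
Qed.

Lemma vector_cvg (R : realType) n (x : nat -> 'cV[R]_n) (l : 'cV[R]_n) :
  (forall i, x m i 0 @[m --> \oo] --> l i 0) -> x m @[m --> \oo] --> l.
Proof.
move=> h; apply/cvg_ballP => e e0.
have : \forall m \near \oo, forall i, ball (l i 0) e (x m i 0).
  by apply: filter_forall => i; apply: cvg_ball (h i) _ e0.
apply: filterS => m hm; split => // i j; rewrite ord1; exact: hm.
Qed.

(** * A central limit theorem for bounded lagged products *)

Lemma cvg_invsqrt (R : realType) : ((Num.sqrt n%:R)^-1 : R) @[n --> \oo] --> (0 : R).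
Proof.
apply/cvgrPdist_le => e e0; near=> n.
have n0 : (0 < n)%N by near: n; exists 1%N.
have s0 : 0 < Num.sqrt (n%:R : R) by rewrite sqrtr_gt0 ltr0n.
rewrite sub0r normrN ger0_norm ?invr_ge0 ?(ltW s0)// invf_ple ?posrE//.
rewrite -(@ler_pXn2r _ 2%N) ?nnegrE ?invr_ge0 ?(ltW e0) ?(ltW s0)// sqr_sqrtr//.
apply: (@le_trans _ _ (Num.bound (e^-1 ^+ 2))%:R).
  by rewrite ltW// archi_boundP// sqr_ge0.
by rewrite ler_nat; near: n; exists (Num.bound (e^-1 ^+ 2)).
Unshelve. all: by end_near.
Qed.

Lemma sum_shift_le (R : realDomainType) (F : nat -> R) K n a m : (forall k, `|F k| <= K) ->
  `|\sum_(a <= k < n) F k - \sum_(a + m <= k < n) F k| <= m%:R * K.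
Proof.
move=> FK; have K0 : 0 <= K by apply: le_trans (FK 0%N).
elim: m => [|m IH]; first by rewrite addn0 subrr normr0 mul0r.
rewrite -natr1 mulrDl mul1r.
have [amn|amn] := ltnP (a + m)%N n.
  apply: le_trans (lerD IH (FK (a + m)%N)); apply: le_trans (ler_normD _ _).
  rewrite [\sum_(a + m <= k < n) _]big_ltn// -addnS le_eqVlt.
  by apply/orP; left; apply/eqP; congr Num.norm; ring.
rewrite [\sum_(a + m.+1 <= k < n) _]big_geq; last by rewrite addnS leqW.
by move: IH; rewrite [\sum_(a + m <= k < n) _]big_geq// => /le_trans; apply; rewrite lerDl.
Qed.

Section adapted_ops.
Context {disp : measure_display} {T : measurableType disp} {R : realType}
  (P : probability T R) (I : eqType) (Z : I -> {RV P >-> R}).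
Implicit Types (J : set I) (F G : T -> R).

Lemma adaptedD J F G : adapted Z J F -> adapted Z J G -> adapted Z J (fun w => F w + G w).
Proof. by move=> aF aG; exact: measurable_funD. Qed.

Lemma adaptedM J F G : adapted Z J F -> adapted Z J G -> adapted Z J (fun w => F w * G w).
Proof. by move=> aF aG; exact: measurable_funM. Qed.

Lemma adapted_cst J c : adapted Z J (fun=> c).
Proof. exact: measurable_cst. Qed.

Lemma adapted_fun J (g : R -> R) F : measurable_fun setT g -> adapted Z J F ->
  adapted Z J (fun w => g (F w)).
Proof. by move=> mg aF; apply: measurableT_comp. Qed.

Lemma adapted_sum J (K : eqType) (s : seq K) (F : K -> T -> R) :
  (forall i, i \in s -> adapted Z J (F i)) -> adapted Z J (fun w => \sum_(i <- s) F i w).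
Proof.
elim: s => [_|i s IH aF]; first by under eq_fun do rewrite big_nil; exact: adapted_cst.
under eq_fun do rewrite big_cons.
apply: adaptedD; first by apply: aF; rewrite mem_head.
by apply: IH => k ks; apply: aF; rewrite inE ks orbT.
Qed.

End adapted_ops.

(** The sums considered are those of [tau (Z k)] times a finite linear combination
    of the [tau (Z l)] with [k < l]; read from the last index to the first, they
    form a martingale. *)
Section clt_bounded.
Context {disp : measure_display} {T : measurableType disp} {R : realType}
  (P : probability T R) (Z : nat -> {RV P >-> R}) (Ziid : iid Z).
Variables (tau : R -> R) (K : R) (b : nat -> R) (m : nat).
Hypotheses (mtau : measurable_fun setT tau) (tauK : forall x, `|tau x| <= K)
  (tau0 : Ex P (fun w => tau (Z 0%N w)) = 0).

Let t2 : R := Ex P (fun w => tau (Z 0%N w) ^+ 2).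
Let B : R := \sum_(0 <= j < m) b j ^+ 2.
Let t k w := tau (Z k w).
Let W k w := \sum_(0 <= j < m) b j * t (k.+1 + j)%N w.
Let X k w := t k w * W k w.
Let KW : R := \sum_(0 <= j < m) `|b j| * K.
Let KX : R := K * KW.

Let K0 : 0 <= K. Proof. exact: le_trans (tauK 0). Qed.
Let KW0 : 0 <= KW. Proof. by apply: sumr_ge0 => j _; exact: mulr_ge0. Qed.
Let KX0 : 0 <= KX. Proof. exact: mulr_ge0. Qed.
Let t20 : 0 <= t2. Proof. by apply: Ex_ge0 => w; exact: sqr_ge0. Qed.
Let B0 : 0 <= B. Proof. by apply: sumr_ge0 => j _; exact: sqr_ge0. Qed.

Let WK k w : `|W k w| <= KW.
Proof.
apply: (le_trans (ler_norm_sum _ _ _)); apply: ler_sum => j _.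
by rewrite normrM ler_wpM2l// tauK.
Qed.

Let XK k w : `|X k w| <= KX.
Proof. by rewrite normrM; apply: ler_pM => //; exact: tauK. Qed.

Let ge_set i := [set l | (i <= l)%N].

Let at_ i k : (i <= k)%N -> adapted Z (ge_set i) (t k).
Proof. by move=> ik; apply: adapted_comp. Qed.

Let aW i k : (i <= k.+1)%N -> adapted Z (ge_set i) (W k).
Proof.
move=> ik; apply: adapted_sum => j _; apply: adaptedM; first exact: adapted_cst.
by apply: at_; rewrite (leq_trans ik)// leq_addr.
Qed.

Let aX i k : (i <= k)%N -> adapted Z (ge_set i) (X k).
Proof. by move=> ik; apply: adaptedM; [exact: at_|apply: aW; rewrite leqW]. Qed.

Let S n i w := \sum_(i <= k < n) X k w.

Let aS n i k : (i <= k)%N -> adapted Z (ge_set i) (S n k).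
Proof.
move=> ik; apply: adapted_sum => l; rewrite mem_index_iota => /andP[kl _].
by apply: aX; exact: leq_trans kl.
Qed.

Let mt k : measurable_fun setT (t k). Proof. exact: measurableT_comp. Qed.

Let E_t k : intg P (t k) /\ Ex P (t k) = 0.
Proof.
have it : intg P (t 0%N) by apply: (@intg_bd _ _ _ _ _ K) => [|w]; [exact: mt|exact: tauK].
have [ik ->] := iid_Ex Ziid k mtau it; split => //.
Qed.

Let E_t2 k : intg P (fun w => t k w ^+ 2) /\ Ex P (fun w => t k w ^+ 2) = t2.
Proof.
apply: (iid_Ex Ziid k (g := fun x => tau x ^+ 2)); first exact: measurable_funX.
by have [] : L2 P (t 0%N) by apply: (@L2_bd _ _ _ _ _ K) => [|w]; [exact: mt|exact: tauK].
Qed.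

Let disj i k : (i < k)%N -> [set i] `&` ge_set k = set0.
Proof. by move=> ik; apply/seteqP; split => // l [->]; rewrite /ge_set /= leqNgt ik. Qed.

Let E_W2 k : Ex P (fun w => W k w ^+ 2) = t2 * B.
Proof.
have lt j : L2 P (fun w => b j * t (k.+1 + j)%N w).
  by apply: L2Z; apply: (@L2_bd _ _ _ _ _ K) => [|w]; [exact: mt|exact: tauK].
rewrite (Ex_sqr_sum_orth (F := fun j w => b j * t (k.+1 + j)%N w)) ?iota_uniq//.
  rewrite /B mulr_sumr; apply: eq_bigr => j _.
  under [X in Ex P X]funext do rewrite exprMn.
  by rewrite ExZ ?(E_t2 _).2 1?mulrC//; exact: (E_t2 _).1.
move=> i j _ _ ij.
have ij' : (k.+1 + i)%N != (k.+1 + j)%N by rewrite eqn_add2l.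
rewrite (_ : (fun _ => _) = (fun w => (b i * b j) * (t (k.+1 + i)%N w * t (k.+1 + j)%N w))).
  have [i1 E1] := iid_Ex2 Ziid ij' mtau mtau (E_t _).1 (E_t _).1.
  have E0 : Ex P (fun w => t (k.+1 + i)%N w * t (k.+1 + j)%N w) =
    Ex P (t (k.+1 + i)%N) * Ex P (t (k.+1 + j)%N) := E1.
  by rewrite ExZ// E0 (E_t _).2 mul0r mulr0.
by apply/funext => w; ring.
Qed.

Let mS n i : measurable_fun setT (S n i).
Proof. exact: adapted_meas (aS n (leqnn i)). Qed.

Let mW k : measurable_fun setT (W k).
Proof. exact: adapted_meas (aW (leqnn k.+1)). Qed.

Let mX k : measurable_fun setT (X k).
Proof. exact: adapted_meas (aX (leqnn k)). Qed.

Let arg n h c i w : R := h * S n i w + c.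

Let marg n h c i : measurable_fun setT (arg n h c i).
Proof. by apply: measurable_funD => //; exact: measurable_funM. Qed.

Let mcos F : measurable_fun setT F -> measurable_fun setT (fun w : T => cos (F w : R)).
Proof. by move=> mF; apply: measurableT_comp => //; exact: measurable_cos. Qed.

Let msin F : measurable_fun setT F -> measurable_fun setT (fun w : T => sin (F w : R)).
Proof. by move=> mF; apply: measurableT_comp => //; exact: measurable_sin. Qed.

Let icos F : measurable_fun setT F -> intg P (fun w => cos (F w)).
Proof. by move=> mF; apply: (@intg_bd _ _ _ _ _ 1) => [|w]; [exact: mcos|exact: cos_max]. Qed.

Let q : R := t2 ^+ 2 * B.
Let C : R := 2 * KX ^+ 3 + t2 * ((KW ^+ 2 + t2 * B) * (m%:R * KX)).

(** One Lindeberg step: X_i is centred given the later variables, and its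
    conditional second moment t2 * W_i^2 is averaged against a cosine that is,
    up to an error of order h, a function of the variables from i+1+m on, of
    which W_i is independent. *)
Let clt_step n h c i : 0 <= h -> (i < n)%N ->
  `|Ex P (fun w => cos (arg n h c i w))
    - (1 - q * h ^+ 2 / 2) * Ex P (fun w => cos (arg n h c i.+1 w))| <= C * h ^+ 3.
Proof.
move=> h0 iltn.
pose y := arg n h c i.+1; pose y' := arg n h c (i.+1 + m)%N.
pose x w := h * X i w.
have my : measurable_fun setT y by exact: marg.
have my' : measurable_fun setT y' by exact: marg.
have mx : measurable_fun setT x by exact: measurable_funM.
have argE w : arg n h c i w = y w + x w.
  by rewrite /arg /y /x /arg /S big_ltn//; ring.
have xK w : `|x w| <= h * KX by rewrite normrM ger0_norm// ler_wpM2l.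
have iy := icos my; have iy' := icos my'.
have ixs : intg P (fun w => x w * sin (y w)).
  apply: (@intg_bd _ _ _ _ _ (h * KX * 1)); first by apply: measurable_funM => //; exact: msin.
  by move=> w; rewrite normrM; apply: ler_pM => //; exact: sin_max.
have iWc Y : measurable_fun setT Y -> intg P (fun w => W i w ^+ 2 * cos (Y w)).
  move=> mY; apply: (@intg_bd _ _ _ _ _ (KW ^+ 2 * 1)).
    by apply: measurable_funM; [exact: measurable_funX|exact: mcos].
  move=> w; rewrite normrM; apply: ler_pM => //; last exact: cos_max.
  by rewrite normrX ler_pXn2r ?nnegrE.
have ixc : intg P (fun w => x w ^+ 2 / 2 * cos (y w)).
  apply: (@intg_bd _ _ _ _ _ ((h * KX) ^+ 2 / 2 * 1)).
    apply: measurable_funM; last exact: mcos.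
    by apply: measurable_funM => //; exact: measurable_funX.
  move=> w; rewrite normrM; apply: ler_pM => //; last exact: cos_max.
  by rewrite normrM normrX (ger0_norm (x := 2^-1))// ler_wpM2r// ler_pXn2r ?nnegrE// mulr_ge0.
have A1 : `|Ex P (fun w => cos (arg n h c i w)) - (Ex P (fun w => cos (y w)) - Ex P (fun w => x w * sin (y w)) - Ex P (fun w => x w ^+ 2 / 2 * cos (y w)))| <= 2 * (h * KX) ^+ 3.
  rewrite -ExB// -ExB//; last exact: intgB.
  rewrite -ExB//; [|exact: icos|by apply: intgB => //; exact: intgB].
  apply: Ex_bd; first by apply: intgB; [exact: icos|by apply: intgB => //; exact: intgB].
  move=> w; rewrite argE; apply: (le_trans (cosD_taylor _ _)).
  by rewrite ler_wpM2l// ler_pXn2r ?nnegrE// mulr_ge0.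
have Exs : Ex P (fun w => x w * sin (y w)) = 0.
  have aG : adapted Z (ge_set i.+1) (fun w => h * (W i w * sin (y w))).
    apply: adaptedM; first exact: adapted_cst.
    apply: adaptedM; first exact: aW.
    apply: adapted_fun; first exact: measurable_sin.
    apply: adaptedD; last exact: adapted_cst.
    by apply: adaptedM; [exact: adapted_cst|exact: aS].
  have iG : intg P (fun w => h * (W i w * sin (y w))).
    apply: intgZ; apply: (@intg_bd _ _ _ _ _ (KW * 1)).
      by apply: measurable_funM => //; exact: msin.
    by move=> w; rewrite normrM; apply: ler_pM => //; exact: sin_max.
  have a1 : adapted Z [set i] (t i) by exact: adapted_comp.
  have [_] := Ex_indep Ziid.1 (disj (ltnSn i)) a1 aG (E_t i).1 iG.
  rewrite (E_t i).2 mul0r => <-; congr Ex; apply/funext => w; rewrite /x /X; ring.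
have Exc : Ex P (fun w => x w ^+ 2 / 2 * cos (y w)) = h ^+ 2 / 2 * (t2 * Ex P (fun w => W i w ^+ 2 * cos (y w))).
  have aG : adapted Z (ge_set i.+1) (fun w => W i w ^+ 2 * cos (y w)).
    apply: adaptedM.
      by rewrite (_ : (fun _ => _) = (fun w => W i w * W i w))//; apply: adaptedM; exact: aW.
    apply: adapted_fun; first exact: measurable_cos.
    apply: adaptedD; last exact: adapted_cst.
    by apply: adaptedM; [exact: adapted_cst|exact: aS].
  have a1 : adapted Z [set i] (fun w => t i w ^+ 2).
    by apply: (adapted_comp (g := fun x => tau x ^+ 2)) => //; exact: measurable_funX.
  have [i1 E1] := Ex_indep Ziid.1 (disj (ltnSn i)) a1 aG (E_t2 i).1 (iWc _ my).
  rewrite -(E_t2 i).2 -E1 -ExZ//; congr Ex; apply/funext => w; rewrite /x /X; ring.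
have yy' w : `|y w - y' w| <= h * (m%:R * KX).
  rewrite /y /y' /arg opprD addrACA subrr addr0 -mulrBr normrM ger0_norm// ler_wpM2l//.
  exact: sum_shift_le.
have A2 : `|Ex P (fun w => W i w ^+ 2 * cos (y w)) - Ex P (fun w => W i w ^+ 2 * cos (y' w))| <= KW ^+ 2 * (h * (m%:R * KX)).
  rewrite -ExB; [|exact: iWc|exact: iWc].
  apply: Ex_bd; first by apply: intgB; exact: iWc.
  move=> w; rewrite -mulrBr normrM; apply: ler_pM => //; last exact: le_trans (cos_lip _ _) (yy' w).
  by rewrite normrX ler_pXn2r ?nnegrE.
have A3 : `|Ex P (fun w => cos (y' w)) - Ex P (fun w => cos (y w))| <= h * (m%:R * KX).
  rewrite -ExB//; apply: Ex_bd; first exact: intgB.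
  by move=> w; rewrite distrC; apply: le_trans (cos_lip _ _) (yy' w).
have EW : Ex P (fun w => W i w ^+ 2 * cos (y' w)) = t2 * B * Ex P (fun w => cos (y' w)).
  pose J := [set l | (i < l <= i + m)%N].
  have aF : adapted Z J (fun w => W i w ^+ 2).
    suff aF' : adapted Z J (W i) by rewrite (_ : (fun _ => _) = (fun w => W i w * W i w))//; exact: adaptedM.
    apply: adapted_sum => j; rewrite mem_index_iota => /andP[_ jm].
    apply: adaptedM; first exact: adapted_cst.
    by apply: adapted_comp => //; rewrite /J /=; lia.
  have aG : adapted Z (ge_set (i.+1 + m)) (fun w => cos (y' w)).
    apply: adapted_fun; first exact: measurable_cos.
    apply: adaptedD; last exact: adapted_cst.
    by apply: adaptedM; [exact: adapted_cst|exact: aS].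
  have dJ : J `&` ge_set (i.+1 + m) = set0.
    by apply/seteqP; split => // l []; rewrite /J /ge_set /=; lia.
  have iF : intg P (fun w => W i w ^+ 2).
    by have [] : L2 P (W i) by apply: (@L2_bd _ _ _ _ _ KW).
  by rewrite (Ex_indep Ziid.1 dJ aF aG iF iy').2 E_W2.
rewrite Exs subr0 Exc in A1; rewrite EW in A2.
move: A1 A2 A3; rewrite -/y.
move: (Ex P (fun w => cos (arg n h c i w))) (Ex P (fun w => cos (y w))) => e1 e2.
move: (Ex P (fun w => W i w ^+ 2 * cos (y w))) (Ex P (fun w => cos (y' w))) => g e2' A1 A2 A3.
have A4 : `|g - t2 * B * e2| <= (KW ^+ 2 + t2 * B) * (h * (m%:R * KX)).
  have -> : g - t2 * B * e2 = (g - t2 * B * e2') + t2 * B * (e2' - e2) by ring.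
  apply: (le_trans (ler_normD _ _)); rewrite [leRHS]mulrDl; apply: lerD => //.
  by rewrite normrM ger0_norm ?mulr_ge0// ler_wpM2l// mulr_ge0.
have -> : e1 - (1 - q * h ^+ 2 / 2) * e2 = (e1 - (e2 - h ^+ 2 / 2 * (t2 * g))) - h ^+ 2 / 2 * t2 * (g - t2 * B * e2).
  by rewrite /q; field.
apply: (le_trans (ler_normB _ _)).
have h20 : 0 <= h ^+ 2 / 2 * t2 by rewrite mulr_ge0// mulr_ge0// exprn_ge0.
have A5 : `|h ^+ 2 / 2 * t2 * (g - t2 * B * e2)| <= h ^+ 2 / 2 * t2 * ((KW ^+ 2 + t2 * B) * (h * (m%:R * KX))).
  by rewrite normrM (ger0_norm h20) ler_wpM2l.
apply: (le_trans (lerD A1 A5)).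
have -> : C * h ^+ 3 = 2 * (h * KX) ^+ 3 + 2 * (h ^+ 2 / 2 * t2 * ((KW ^+ 2 + t2 * B) * (h * (m%:R * KX)))).
  by rewrite /C; field.
rewrite lerD2l; apply: ler_peMl; last by rewrite ler1n.
by rewrite mulr_ge0// mulr_ge0 ?addr_ge0 ?sqr_ge0 ?mulr_ge0.
Qed.

(** Iterating [clt_step] over [n] summands at the scale [h = 1 / sqrt n] gives
    [n] factors close to [expR (- q * h ^+ 2 / 2)], with a total error
    of order [n * h ^+ 3 = h]. *)
Lemma clt_bounded c :
  Ex P (fun w => cos ((Num.sqrt n%:R)^-1 * (\sum_(0 <= k < n) tau (Z k w) *
          \sum_(0 <= j < m) b j * tau (Z (k.+1 + j)%N w)) + c)) @[n --> \oo] -->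
  expR (- (t2 ^+ 2 * B) / 2) * cos c.
Proof.
pose D : R := C + q ^+ 2 / 4.
have C0 : 0 <= C.
  by rewrite addr_ge0 ?mulr_ge0 ?addr_ge0 ?exprn_ge0 ?mulr_ge0.
have q0 : 0 <= q by rewrite mulr_ge0// sqr_ge0.
suff H n : (0 < n)%N -> `|Ex P (fun w => cos (arg n (Num.sqrt n%:R)^-1 c 0 w)) - expR (- (t2 ^+ 2 * B) / 2) * cos c| <= D * (Num.sqrt n%:R)^-1.
  apply: (@squeeze_cvgr _ _ _ _ (fun n : nat => expR (- (t2 ^+ 2 * B) / 2) * cos c - D * (Num.sqrt n%:R)^-1)
    (fun n : nat => expR (- (t2 ^+ 2 * B) / 2) * cos c + D * (Num.sqrt n%:R)^-1)).
  - near=> n; have : (0 < n)%N by near: n; exists 1%N.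
    by move=> /H; rewrite ler_distl.
  - rewrite -[X in _ --> X]subr0 -[X in _ - X](mulr0 D).
    by apply: cvgB; [exact: cvg_cst|apply: cvgMr; exact: cvg_invsqrt].
  - rewrite -[X in _ --> X]addr0 -[X in _ + X](mulr0 D).
    by apply: cvgD; [exact: cvg_cst|apply: cvgMr; exact: cvg_invsqrt].
move=> n0; set h := (Num.sqrt n%:R)^-1.
have h0 : 0 <= h by rewrite invr_ge0 sqrtr_ge0.
have h2 : h ^+ 2 = n%:R^-1 by rewrite exprVn sqr_sqrtr.
have h1 : h <= 1.
  rewrite -(@ler_pXn2r _ 2%N) ?nnegrE// h2 expr1n invf_le1 ?ler1n// ltr0n//.
pose r := expR (- (q * h ^+ 2 / 2)).
pose e i := Ex P (fun w => cos (arg n h c i w)).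
have step i : (i < n)%N -> `|e i - r * e i.+1| <= D * h ^+ 3.
  move=> ilt; have := clt_step c h0 ilt; rewrite -/(e i) -/(e i.+1) => st.
  have -> : e i - r * e i.+1 = (e i - (1 - q * h ^+ 2 / 2) * e i.+1) - (r - (1 - q * h ^+ 2 / 2)) * e i.+1 by ring.
  apply: (le_trans (ler_normB _ _)); rewrite /D [leRHS]mulrDl; apply: lerD => //.
  have e1 : `|e i.+1| <= 1 by apply: Ex_bd => [|w]; [exact: icos|exact: cos_max].
  have r1 : `|r - (1 - q * h ^+ 2 / 2)| <= (q * h ^+ 2 / 2) ^+ 2.
    by apply: expRN_quadratic; rewrite !mulr_ge0// exprn_ge0.
  rewrite normrM -[leRHS]mulr1; apply: ler_pM => //; apply: (le_trans r1).
  have -> : (q * h ^+ 2 / 2) ^+ 2 = q ^+ 2 / 4 * h ^+ 3 * h by field.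
  by apply: ler_piMr => //; rewrite mulr_ge0 ?exprn_ge0// divr_ge0// sqr_ge0.
have r0 : 0 <= r by exact: expR_ge0.
have r1 : r <= 1 by rewrite expR_le1 oppr_le0 !mulr_ge0// exprn_ge0.
have all i : (i <= n)%N -> `|e 0%N - r ^+ i * e i| <= i%:R * (D * h ^+ 3).
  elim: i => [|i IH] ilt; first by rewrite mul1r subrr normr0 mul0r.
  have -> : e 0%N - r ^+ i.+1 * e i.+1 = (e 0%N - r ^+ i * e i) + r ^+ i * (e i - r * e i.+1).
    by rewrite exprSr; ring.
  apply: (le_trans (ler_normD _ _)); rewrite -natr1 mulrDl mul1r; apply: lerD.
    by apply: IH; exact: ltnW.
  rewrite normrM -[leRHS]mul1r; apply: ler_pM => //; last exact: step.
  by rewrite ger0_norm ?exprn_ge0// exprn_ile1.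
have := all n (leqnn n).
have -> : e n = cos c.
  rewrite /e -[RHS](Ex_cst P (cos c)); congr Ex; apply/funext => w.
  by rewrite /arg /S big_geq// mulr0 add0r.
have -> : r ^+ n = expR (- (t2 ^+ 2 * B) / 2).
  rewrite -expRM_natl h2; congr expR; rewrite /q; field.
  by rewrite pnatr_eq0 -lt0n.
have -> : n%:R * (D * h ^+ 3) = D * h.
  by rewrite exprSr h2; field; rewrite pnatr_eq0 -lt0n.
by [].
Unshelve. all: by end_near.
Qed.

End clt_bounded.

(** * Limit theorems for linear processes in the future *)

Section pairs.
Context {disp : measure_display} {T : measurableType disp} {R : realType}
  (P : probability T R) (Z : nat -> {RV P >-> R}) (Ziid : iid Z).
Variables (f g : R -> R).
Hypotheses (mf : measurable_fun setT f) (mg : measurable_fun setT g)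
  (lf : L2 P (fun w => f (Z 0%N w))) (lg : L2 P (fun w => g (Z 0%N w)))
  (f0 : Ex P (fun w => f (Z 0%N w)) = 0) (g0 : Ex P (fun w => g (Z 0%N w)) = 0).

Let F (p : nat * nat) w := f (Z p.1 w) * g (Z (p.1.+1 + p.2)%N w).

Let iid_L2 (h : R -> R) k : measurable_fun setT h -> L2 P (fun w => h (Z 0%N w)) ->
  L2 P (fun w => h (Z k w)) /\ Ex P (fun w => h (Z k w) ^+ 2) = Ex P (fun w => h (Z 0%N w) ^+ 2).
Proof.
move=> mh [_ ih]; have mh2 : measurable_fun setT (fun x => h x ^+ 2) by exact: measurable_funX.
have [ik E] := iid_Ex Ziid k mh2 ih; split => //; split => //.
exact: measurableT_comp.
Qed.

Let F_L2 p : L2 P (F p) /\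
  Ex P (fun w => F p w ^+ 2) = Ex P (fun w => f (Z 0%N w) ^+ 2) * Ex P (fun w => g (Z 0%N w) ^+ 2).
Proof.
have [[mf1 if1] Ef] := iid_L2 p.1 mf lf; have [[mg1 ig1] Eg] := iid_L2 (p.1.+1 + p.2)%N mg lg.
have ne : p.1 != (p.1.+1 + p.2)%N by rewrite neq_ltn addSn ltnS leq_addr.
have [i1 E1] := iid_Ex2 Ziid ne (measurable_funX 2 mf) (measurable_funX 2 mg) if1 ig1.
have E : (fun w => F p w ^+ 2) = (fun w => f (Z p.1 w) ^+ 2 * g (Z (p.1.+1 + p.2)%N w) ^+ 2).
  by apply/funext => w; rewrite /F exprMn.
split; last by rewrite E -Ef -Eg.
by split; [exact: measurable_funM | rewrite E].
Qed.

Let F_orth_lt p q : (p.1 < q.1)%N -> Ex P (fun w => F p w * F q w) = 0.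
Proof.
move=> pq; pose J := [set l | (p.1 < l)%N].
have aG : adapted Z J (fun w => g (Z (p.1.+1 + p.2)%N w) * F q w).
  have aF : adapted Z J (F q).
    by apply: adaptedM; apply: adapted_comp => //; rewrite /J /=; lia.
  by apply: adaptedM => //; apply: adapted_comp => //; rewrite /J /=; lia.
have iG : intg P (fun w => g (Z (p.1.+1 + p.2)%N w) * F q w).
  by apply: L2M; [exact: (iid_L2 _ mg lg).1 | exact: (F_L2 q).1].
have a1 : adapted Z [set p.1] (fun w => f (Z p.1 w)) by exact: adapted_comp.
have [i1 E1] := iid_Ex Ziid p.1 mf (L2_intg lf).
have dJ : [set p.1] `&` J = set0 by apply/seteqP; split => // l [->]; rewrite /J /= ltnn.
have [_] := Ex_indep Ziid.1 dJ a1 aG i1 iG.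
rewrite E1 f0 mul0r => <-; congr Ex; apply/funext => w; rewrite /F; ring.
Qed.

Let F_orth p q : p != q -> Ex P (fun w => F p w * F q w) = 0.
Proof.
case: p q => [p1 p2] [q1 q2]; rewrite xpair_eqE negb_and.
have [pq|qp|<- /= ne] := ltngtP p1 q1; first by move=> _; exact: F_orth_lt.
  move=> _; rewrite -[RHS](@F_orth_lt (q1, q2) (p1, p2))//.
  by congr Ex; apply/funext => w; rewrite mulrC.
have ne' : (p1.+1 + p2)%N != (p1.+1 + q2)%N by rewrite eqn_add2l.
have [ig1 Eg1] := iid_Ex Ziid (p1.+1 + p2)%N mg (L2_intg lg).
have [ig2 Eg2] := iid_Ex Ziid (p1.+1 + q2)%N mg (L2_intg lg).
have [igg Egg] := iid_Ex2 Ziid ne' mg mg ig1 ig2.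
pose J := [set l | (p1 < l)%N].
have dJ : [set p1] `&` J = set0 by apply/seteqP; split => // l [->]; rewrite /J /= ltnn.
have aG : adapted Z J (fun w => g (Z (p1.+1 + p2)%N w) * g (Z (p1.+1 + q2)%N w)).
  by apply: adaptedM; apply: adapted_comp => //; rewrite /J /=; lia.
have a1 : adapted Z [set p1] (fun w => f (Z p1 w) ^+ 2).
  by apply: (adapted_comp (g := fun x => f x ^+ 2)) => //; exact: measurable_funX.
have [_] := Ex_indep Ziid.1 dJ a1 aG (iid_L2 p1 mf lf).1.2 igg.
rewrite Egg Eg1 g0 mul0r mulr0 => <-; congr Ex; apply/funext => w; rewrite /F /=; ring.
Qed.

(** Distinct products [f (Z k) * g (Z l)] with [k < l] are orthogonal: either the
    smaller of the first indices occurs nowhere else, or the first indices agree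
    and the second ones differ, and a factor that occurs once is centred. *)
Lemma Ex_sqr_pairs (b : nat -> R) a n m N :
  L2 P (fun w => \sum_(a <= k < a + n) f (Z k w) * \sum_(m <= j < N) b j * g (Z (k.+1 + j)%N w)) /\
  Ex P (fun w => (\sum_(a <= k < a + n) f (Z k w) * \sum_(m <= j < N) b j * g (Z (k.+1 + j)%N w)) ^+ 2)
  = n%:R * (\sum_(m <= j < N) b j ^+ 2) *
    (Ex P (fun w => f (Z 0%N w) ^+ 2) * Ex P (fun w => g (Z 0%N w) ^+ 2)).
Proof.
pose s := [seq (k, j) | k <- index_iota a (a + n), j <- index_iota m N].
have E : (fun w => \sum_(a <= k < a + n) f (Z k w) * \sum_(m <= j < N) b j * g (Z (k.+1 + j)%N w)) =
   (fun w => \sum_(p <- s) b p.2 * F p w).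
  apply/funext => w; rewrite big_allpairs; apply: eq_bigr => k _.
  by rewrite mulr_sumr; apply: eq_bigr => j _; rewrite /F /=; ring.
have lF p : L2 P (fun w => b p.2 * F p w) by apply: L2Z; exact: (F_L2 p).1.
have Es : (fun w => (\sum_(a <= k < a + n) f (Z k w) * \sum_(m <= j < N) b j * g (Z (k.+1 + j)%N w)) ^+ 2) =
   (fun w => (\sum_(p <- s) b p.2 * F p w) ^+ 2).
  by apply/funext => w; have /(congr1 (fun h => h w)) /= -> := E.
rewrite E Es; split; first exact: L2_sum.
rewrite (Ex_sqr_sum_orth (F := fun p w => b p.2 * F p w))//; last 2 first.
- by apply: allpairs_uniq; rewrite ?iota_uniq// => -[? ?] [? ?].
- move=> p q _ _ pq.
  rewrite (_ : (fun _ => _) = (fun w => (b p.2 * b q.2) * (F p w * F q w))).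
    by rewrite ExZ ?F_orth ?mulr0//; apply: L2M; exact: (F_L2 _).1.
  by apply/funext => w; ring.
rewrite big_allpairs /=.
rewrite (eq_bigr (fun _ : nat => (\sum_(m <= j < N) b j ^+ 2) *
    (Ex P (fun w => f (Z 0%N w) ^+ 2) * Ex P (fun w => g (Z 0%N w) ^+ 2)))).
  by rewrite sumr_const_nat addKn -[LHS]mulr_natl mulrA.
move=> k _; rewrite mulr_suml; apply: eq_bigr => j _.
rewrite -(F_L2 (k, j)).2 -ExZ; last exact: (F_L2 _).1.2.
by congr Ex; apply/funext => w; rewrite exprMn.
Qed.

End pairs.

Section linear_process.
Context {disp : measure_display} {T : measurableType disp} {R : realType}
  (P : probability T R) (Z : nat -> {RV P >-> R}) (Ziid : iid Z).
Hypotheses (lZ : L2 P (Z 0%N)) (Z0 : Ex P (Z 0%N) = 0).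
Let s2 : R := Ex P (fun w => Z 0%N w ^+ 2).

Let s20 : 0 <= s2. Proof. by apply: Ex_ge0 => w; exact: sqr_ge0. Qed.

Let mid : measurable_fun setT (fun x : R => x). Proof. exact: measurable_id. Qed.

Let lZk k : L2 P (Z k).
Proof.
split => //; have [] := iid_Ex Ziid k (g := fun x => x ^+ 2) _ lZ.2 => //.
Qed.

Let E_Z k : Ex P (Z k) = 0.
Proof. by have [_ ->] := iid_Ex Ziid k mid (L2_intg lZ). Qed.

Let E_Z2 k : Ex P (fun w => Z k w ^+ 2) = s2.
Proof. by have [] := iid_Ex Ziid k (g := fun x => x ^+ 2) (measurable_funX 2 mid) lZ.2. Qed.

Let Ex_sqr_lin (b : nat -> R) i m N :
  L2 P (fun w => \sum_(m <= j < N) b j * Z (i + j)%N w) /\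
  Ex P (fun w => (\sum_(m <= j < N) b j * Z (i + j)%N w) ^+ 2) = s2 * \sum_(m <= j < N) b j ^+ 2.
Proof.
have lF j : L2 P (fun w => b j * Z (i + j)%N w) by exact: L2Z.
split; first exact: L2_sum.
rewrite (Ex_sqr_sum_orth (F := fun j w => b j * Z (i + j)%N w)) ?iota_uniq//.
  rewrite mulr_sumr; apply: eq_bigr => j _.
  under [X in Ex P X]funext do rewrite exprMn.
  by rewrite ExZ ?E_Z2 1?mulrC//; exact: (lZk _).2.
move=> j k _ _ jk; have ne : (i + j)%N != (i + k)%N by rewrite eqn_add2l.
have [i1 E1] := iid_Ex2 Ziid ne mid mid (L2_intg (lZk _)) (L2_intg (lZk _)).
rewrite (_ : (fun _ => _) = (fun w => (b j * b k) * (Z (i + j)%N w * Z (i + k)%N w))).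
  by rewrite ExZ// E1 E_Z mul0r mulr0.
by apply/funext => w; ring.
Qed.

Section clt_finite.
Variables (b : nat -> R) (m : nat).
Let B : R := \sum_(0 <= j < m) b j ^+ 2.
Let B0 : 0 <= B. Proof. by apply: sumr_ge0 => j _; exact: sqr_ge0. Qed.

Let clip (M : nat) (x : R) : R := if M%:R < `|x| then 0 else x.
Let eM M : R := Ex P (fun w => clip M (Z 0%N w)).
Let tau M x := clip M x - eM M.
Let del M x := x - tau M x.
Let aZ : R := Ex P (fun w => `|Z 0%N w|).

Let mclip M : measurable_fun setT (clip M).
Proof.
apply: measurable_fun_ifT => //; apply: measurable_fun_ltr => //.
Qed.

Let clip_le M x : `|clip M x| <= `|x|.
Proof. by rewrite /clip; case: ifP => _; rewrite ?normr0. Qed.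

Let clip_leM M x : `|clip M x| <= M%:R.
Proof. by rewrite /clip; case: ltP => // _; rewrite normr0. Qed.

Let mtau M : measurable_fun setT (tau M). Proof. exact: measurable_funB. Qed.
Let mdel M : measurable_fun setT (del M). Proof. exact: measurable_funB. Qed.

Let mZ (h : R -> R) k : measurable_fun setT h -> measurable_fun setT (fun w => h (Z k w)).
Proof. by move=> mh; apply: measurableT_comp. Qed.

Let iclip M : intg P (fun w => clip M (Z 0%N w)).
Proof. by apply: (@intg_bd _ _ _ _ _ M%:R) => [|w]; [exact: mZ|exact: clip_leM]. Qed.

Let iaZ : intg P (fun w => `|Z 0%N w|).
Proof. by apply: intg_abs; exact: L2_intg. Qed.

Let eM_le M : `|eM M| <= aZ.
Proof.
apply: (le_trans (Ex_abs (iclip M))); by apply: Ex_le => //; exact: intg_abs.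
Qed.

Let clip_cvg x : clip M x @[M --> \oo] --> x.
Proof.
apply: cvg_near_cst; near=> M; rewrite /clip ltNge.
have -> // : `|x| <= M%:R.
apply: (@le_trans _ _ (Num.bound `|x|)%:R); first by rewrite ltW// archi_boundP.
by rewrite ler_nat; near: M; exists (Num.bound `|x|).
Unshelve. all: by end_near.
Qed.

Let eM_cvg : eM M @[M --> \oo] --> 0.
Proof.
rewrite -Z0; have [] := @Ex_dct _ _ _ P (fun M w => clip M (Z 0%N w)) (Z 0%N) (fun w => `|Z 0%N w|) => //.
- by move=> M; exact: mZ.
- by apply: nearW => w; exact: clip_cvg.
Qed.

Let tau_cvg x : tau M x @[M --> \oo] --> x.
Proof. by rewrite -[X in _ --> X]subr0; apply: cvgB; [exact: clip_cvg|exact: eM_cvg]. Qed.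

Let dom : intg P (fun w => (2 * `|Z 0%N w| + aZ) ^+ 2).
Proof.
suff [] : L2 P (fun w => 2 * `|Z 0%N w| + aZ) by [].
apply: L2D; last exact: L2_cst.
apply: L2Z; split; first exact: measurableT_comp.
by under eq_fun do rewrite real_normK ?num_real//; exact: lZ.2.
Qed.

Let tau_le M x : `|tau M x| <= 2 * `|x| + aZ.
Proof.
apply: (le_trans (ler_normB _ _)); have := clip_le M x; have := eM_le M.
have := normr_ge0 x; lra.
Qed.

Let del_le M x : `|del M x| <= 2 * `|x| + aZ.
Proof.
rewrite /del /tau opprB addrA.
apply: (le_trans (ler_normB _ _)); have := clip_le M x; have := eM_le M.
have := ler_normD x (eM M); lra.
Qed.

Let sq_le (x y : R) : `|x| <= y -> `|x ^+ 2| <= y ^+ 2.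
Proof. by move=> xy; rewrite normrX ler_pXn2r ?nnegrE// (le_trans _ xy). Qed.

Let t2_cvg : Ex P (fun w => tau M (Z 0%N w) ^+ 2) @[M --> \oo] --> s2.
Proof.
have [] := @Ex_dct _ _ _ P (fun M w => tau M (Z 0%N w) ^+ 2) (fun w => Z 0%N w ^+ 2) _ _ _ dom => //.
- by move=> M; apply: measurable_funX; exact: mZ.
- exact: measurable_funX.
- by apply: nearW => w; rewrite expr2; apply: cvgM; exact: tau_cvg.
- by move=> M w; apply: sq_le; exact: tau_le.
Qed.

Let d2_cvg : Ex P (fun w => del M (Z 0%N w) ^+ 2) @[M --> \oo] --> 0.
Proof.
have [] := @Ex_dct _ _ _ P (fun M w => del M (Z 0%N w) ^+ 2) (fun=> 0) _ _ _ dom => //.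
- by move=> M; apply: measurable_funX; exact: mZ.
- apply: nearW => w; under eq_fun do rewrite expr2.
  have dc : del M (Z 0%N w) @[M --> \oo] --> 0.
    by rewrite -(subrr (Z 0%N w)); apply: cvgB; [exact: cvg_cst|exact: tau_cvg].
  by rewrite -(mulr0 (0 : R)); exact: cvgM.
- by move=> M w; apply: sq_le; exact: del_le.
- by move=> _; rewrite Ex_cst.
Qed.

(** Truncating the innovations at the level [M] changes the sum by other sums of
    orthogonal pairs, so that by [Ex_sqr_pairs] the normalised difference is small
    in L2 uniformly in [n] when [M] is large. *)
Lemma clt_finite c :
  Ex P (fun w => cos ((Num.sqrt n%:R)^-1 * (\sum_(0 <= k < n) Z k w *
          \sum_(0 <= j < m) b j * Z (k.+1 + j)%N w) + c)) @[n --> \oo] -->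
  expR (- (s2 ^+ 2 * B) / 2) * cos c.
Proof.
pose S (f g : R -> R) n w := \sum_(0 <= k < n) f (Z k w) * \sum_(0 <= j < m) b j * g (Z (k.+1 + j)%N w).
pose t2 M := Ex P (fun w => tau M (Z 0%N w) ^+ 2).
pose d2 M := Ex P (fun w => del M (Z 0%N w) ^+ 2).
(* [v M] bounds the second moment of the normalised error of truncation at [M] *)
pose v M := 2 * (B * (d2 M * s2)) + 2 * (B * (t2 M * d2 M)).
have ltau M : L2 P (fun w => tau M (Z 0%N w)).
  apply: (@L2_bd _ _ _ _ _ (M%:R + `|eM M|)); first exact: mZ.
  by move=> w; apply: (le_trans (ler_normB _ _)); rewrite lerD2r clip_leM.
have ldel M : L2 P (fun w => del M (Z 0%N w)) by apply: L2B.
have Etau M : Ex P (fun w => tau M (Z 0%N w)) = 0.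
  by rewrite ExB ?Ex_cst ?subrr//; exact: intg_cst.
have Edel M : Ex P (fun w => del M (Z 0%N w)) = 0.
  by rewrite ExB ?Etau ?Z0 ?subrr//; exact: L2_intg.
have mcosS f g n : measurable_fun setT f -> measurable_fun setT g ->
    measurable_fun setT (fun w => (Num.sqrt n%:R)^-1 * S f g n w + c).
  move=> mf mg; apply: measurable_funD => //; apply: measurable_funM => //.
  apply: measurable_sum => k; apply: measurable_funM; first exact: mZ.
  by apply: measurable_sum => j; apply: measurable_funM => //; exact: mZ.
have icos F : measurable_fun setT F -> intg P (fun w => cos (F w : R)).
  move=> mF; apply: (@intg_bd _ _ _ _ _ 1) => [|w]; last exact: cos_max.
  by apply: measurableT_comp => //; exact: measurable_cos.
apply: (cvg_of_approx (y := fun M n => Ex P (fun w => cos ((Num.sqrt n%:R)^-1 * S (tau M) (tau M) n w + c)))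
   (L := fun M => expR (- (t2 M ^+ 2 * B) / 2) * cos c) (del := fun M => Num.sqrt (v M))).
- move=> M n n0.
  have [l1 E1] := Ex_sqr_pairs Ziid (mdel M) mid (ldel M) lZ (Edel M) Z0 b 0 n 0 m.
  have [l2 E2] := Ex_sqr_pairs Ziid (mtau M) (mdel M) (ltau M) (ldel M) (Etau M) (Edel M) b 0 n 0 m.
  have i0 := icos _ (mcosS _ _ n mid mid).
  have iM := icos _ (mcosS _ _ n (mtau M) (mtau M)).
  rewrite /= -[X in `|X - _|]/(Ex P (fun w => cos ((Num.sqrt n%:R)^-1 * S id id n w + c))) -ExB//.
  set h := (Num.sqrt n%:R)^-1 in i0 iM *.
  have h0 : 0 <= h by rewrite invr_ge0 sqrtr_ge0.
  pose D w := S (del M) id n w + S (tau M) (del M) n w.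
  have SD w : S id id n w - S (tau M) (tau M) n w = D w.
    rewrite /D /S -!big_split /= -sumrB; apply: eq_bigr => k _.
    have -> : \sum_(0 <= j < m) b j * del M (Z (k.+1 + j)%N w) =
      \sum_(0 <= j < m) b j * Z (k.+1 + j)%N w - \sum_(0 <= j < m) b j * tau M (Z (k.+1 + j)%N w).
      by rewrite -sumrB; apply: eq_bigr => j _; rewrite /del mulrBr.
    by rewrite /del /=; ring.
  have lD : L2 P D by apply: L2D.
  have ED : Ex P (fun w => D w ^+ 2) <= n%:R * v M.
    have le2 w : D w ^+ 2 <= 2 * S (del M) id n w ^+ 2 + 2 * S (tau M) (del M) n w ^+ 2.
      by rewrite /D; have := sqr_ge0 (S (del M) id n w - S (tau M) (del M) n w); nra.
    have i1 : intg P (fun w => 2 * S (del M) id n w ^+ 2) by apply: intgZ; exact: l1.2.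
    have i2 : intg P (fun w => 2 * S (tau M) (del M) n w ^+ 2) by apply: intgZ; exact: l2.2.
    apply: (le_trans (Ex_le lD.2 (intgD i1 i2) le2)).
    have j1 : intg P (fun w => S (del M) id n w ^+ 2) := l1.2.
    have j2 : intg P (fun w => S (tau M) (del M) n w ^+ 2) := l2.2.
    rewrite ExD// (ExZ _ j1) (ExZ _ j2).
    rewrite /S E1 E2 /v -/B -/s2 -/(t2 M) -/(d2 M); lra.
  have i3 : intg P (fun w => h * `|D w|) by apply: intgZ; apply: intg_abs; exact: L2_intg.
  apply: (le_trans (Ex_abs (intgB i0 iM))).
  apply: (@le_trans _ _ (Ex P (fun w => h * `|D w|))).
    apply: Ex_le => //; first by apply: intg_abs; exact: intgB.
    move=> w; apply: (le_trans (cos_lip _ _)).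
    by rewrite opprD addrACA subrr addr0 -mulrBr normrM ger0_norm// SD.
  rewrite ExZ; last by apply: intg_abs; exact: L2_intg.
  have v0 : 0 <= v M.
    by rewrite addr_ge0// !mulr_ge0//; apply: Ex_ge0 => w; exact: sqr_ge0.
  rewrite -(@ler_pXn2r _ 2%N) ?nnegrE ?sqrtr_ge0 ?mulr_ge0 ?Ex_ge0// sqr_sqrtr// exprMn.
  have -> : h ^+ 2 = n%:R^-1 by rewrite exprVn sqr_sqrtr.
  rewrite mulrC ler_pdivrMr ?ltr0n// mulrC.
  exact: le_trans (Ex_sqr_le lD) ED.
- move=> M.
  apply: (@clt_bounded _ _ _ P Z Ziid (tau M) (M%:R + `|eM M|)) => //.
  by move=> x; apply: (le_trans (ler_normB _ _)); rewrite lerD2r clip_leM.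
- rewrite -(sqrtr0 R).
  apply: (cvg_comp v (fun x : R => Num.sqrt x)); last exact: sqrt_continuous.
  have -> : (0 : R) = 2 * (B * (0 * s2)) + 2 * (B * (s2 * 0)) by ring.
  by apply: cvgD; do 2 apply: cvgMr => //; apply: cvgM => //; exact: cvg_cst.
- apply: cvgMl.
  apply: (cvg_comp (fun M => - (t2 M ^+ 2 * B) / 2) (fun x : R => expR x)); last exact: continuous_expR.
  apply: cvgMl; apply: cvgN; apply: cvgMl.
  rewrite expr2; under eq_fun do rewrite expr2.
  exact: cvgM.
Qed.

End clt_finite.

(** Here [u i] is the almost sure sum of the series of the [b j * Z (i + j)]. *)
Section infinite.
Variables (b r : nat -> R) (B : R) (u : nat -> T -> R).
Hypotheses (br : forall m N, \sum_(m <= j < N) b j ^+ 2 <= r m)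
  (r_cvg : r m @[m --> \oo] --> 0)
  (b_cvg : \sum_(0 <= j < N) b j ^+ 2 @[N --> \oo] --> B)
  (mu : forall i, measurable_fun setT (u i))
  (u_cvg : forall i, {ae P, forall w, \sum_(0 <= j < N) b j * Z (i + j)%N w @[N --> \oo] --> u i w}).

Let V m i w := \sum_(0 <= j < m) b j * Z (i + j)%N w.

Let tail_cvg m i : {ae P, forall w, \sum_(m <= j < m + N) b j * Z (i + j)%N w @[N --> \oo] --> u i w - V m i w}.
Proof.
apply: filterS (u_cvg i) => w uw.
have E : (fun N => \sum_(m <= j < m + N) b j * Z (i + j)%N w) =
   (fun N => \sum_(0 <= j < N + m) b j * Z (i + j)%N w - V m i w).
  apply/funext => N; rewrite /V addnC (big_cat_nat (n := m) (m := 0%N))//=; last exact: leq_addl.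
  by rewrite addrAC subrr add0r.
rewrite E; apply: cvgB; last exact: cvg_cst.
by rewrite (cvg_shiftn m (fun N => \sum_(0 <= j < N) b j * Z (i + j)%N w)).
Qed.

Let mV m i : measurable_fun setT (V m i).
Proof. by have [[]] := Ex_sqr_lin b i 0 m. Qed.

Let r_ge0 m : 0 <= r m.
Proof. by apply: le_trans (br m m); rewrite big_geq. Qed.

(** By Fatou's lemma the tail of the series is bounded in L2 by the tail of the
    squared coefficients. *)
Lemma lin_approx m i : L2 P (fun w => u i w - V m i w) /\
  Ex P (fun w => (u i w - V m i w) ^+ 2) <= s2 * r m.
Proof.
have md : measurable_fun setT (fun w => u i w - V m i w) by exact: measurable_funB.
have [] := @Ex_fatou _ _ _ P (fun N w => (\sum_(m <= j < m + N) b j * Z (i + j)%N w) ^+ 2)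
  (fun w => (u i w - V m i w) ^+ 2) (s2 * r m).
- by move=> N; have [[]] := Ex_sqr_lin b i m (m + N).
- by move=> N w; exact: sqr_ge0.
- exact: measurable_funX.
- by move=> w; exact: sqr_ge0.
- apply: filterS (tail_cvg m i) => w cw; rewrite expr2; under eq_fun do rewrite expr2.
  exact: cvgM.
- by move=> N; rewrite (Ex_sqr_lin b i m (m + N)).2 ler_wpM2l.
by move=> iu Eu; split.
Qed.

Lemma lin_L2 i : L2 P (u i).
Proof.
have [h _] := lin_approx 0 i; rewrite (_ : u i = (fun w => u i w - V 0 i w))//.
by apply/funext => w; rewrite /V big_geq// subr0.
Qed.

(** Almost sure convergence of the partial sums gives an inequality only; their
    convergence in L2, which is [lin_approx], gives the equality. *)
Lemma lin_second_moment i : Ex P (fun w => u i w ^+ 2) = s2 * B.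
Proof.
have cV : Ex P (fun w => V N i w ^+ 2) @[N --> \oo] --> s2 * B.
  under eq_fun do rewrite (Ex_sqr_lin b i 0 _).2.
  exact: cvgMr.
suff cu : Ex P (fun w => V N i w ^+ 2) @[N --> \oo] --> Ex P (fun w => u i w ^+ 2).
  exact: (cvg_unique _ cu cV).
have lu := lin_L2 i.
set A := Ex P (fun w => u i w ^+ 2).
have A0 : 0 <= A by apply: Ex_ge0 => w; exact: sqr_ge0.
apply/cvgrPdist_le => /= e e0.
(* weighting by [de], the absolute value of [x ^+ 2 - v ^+ 2] is at most [de * x ^+ 2 + (de^-1 + 1) * (x - v) ^+ 2] *)
pose de := e / (2 * (A + 1)).
have de0 : 0 < de by rewrite divr_gt0//; lra.
have deA : de * A <= e / 2.
  have -> : e / 2 = de * (A + 1) by rewrite /de; field; lra.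
  by rewrite ler_wpM2l ?(ltW de0)//; lra.
pose c := (de^-1 + 1) * s2.
have c0 : 0 <= c by rewrite mulr_ge0// addr_ge0// invr_ge0 ltW.
have : c * r m @[m --> \oo] --> 0 by rewrite -(mulr0 c); exact: cvgMr.
have e20 : 0 < e / 2 by rewrite divr_gt0.
move/cvgrPdist_le => /(_ _ e20); apply: filterS => N /=.
rewrite sub0r normrN (ger0_norm (mulr_ge0 c0 (r_ge0 N))) => cr.
have [lD ED] := lin_approx N i.
have iV : intg P (fun w => V N i w ^+ 2) by have [[]] := Ex_sqr_lin b i 0 N.
have i1 := intgZ de lu.2; have i2 := intgZ (de^-1 + 1) lD.2.
rewrite -ExB//; last exact: lu.2.
apply: (le_trans (Ex_abs (intgB lu.2 iV))).
apply: (@le_trans _ _ (Ex P (fun w => de * u i w ^+ 2 + (de^-1 + 1) * (u i w - V N i w) ^+ 2))).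
  apply: Ex_le; [by apply: intg_abs; apply: intgB => //; exact: lu.2|exact: intgD|move=> w].
  move: (u i w) (V N i w) => x v; rewrite ler_norml; apply/andP.
  have dd : de * de^-1 = 1 by rewrite divff ?gt_eqF.
  have dv0 : 0 < de^-1 by rewrite invr_gt0.
  have h1 : 0 <= de^-1 * (de * x - (x - v)) ^+ 2 by rewrite mulr_ge0 ?sqr_ge0// ltW.
  have h2 : 0 <= de^-1 * (de * x + (x - v)) ^+ 2 by rewrite mulr_ge0 ?sqr_ge0// ltW.
  have E1 : de^-1 * (de * x - (x - v)) ^+ 2 = de * x ^+ 2 - 2 * x * (x - v) + de^-1 * (x - v) ^+ 2.
    by field; rewrite gt_eqF.
  have E2 : de^-1 * (de * x + (x - v)) ^+ 2 = de * x ^+ 2 + 2 * x * (x - v) + de^-1 * (x - v) ^+ 2.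
    by field; rewrite gt_eqF.
  have h3 := sqr_ge0 (x - v).
  rewrite E1 in h1; rewrite E2 in h2.
  by split; lra.
rewrite ExD// (ExZ _ lu.2) (ExZ _ lD.2) -/A.
have : (de^-1 + 1) * Ex P (fun w => (u i w - V N i w) ^+ 2) <= c * r N.
  by rewrite /c -mulrA ler_wpM2l// addr_ge0// invr_ge0 ltW.
lra.
Qed.

(** The orthogonality of [Ex_sqr_pairs] survives the passage to an infinite tail
    by Fatou's lemma. *)
Lemma lin_tail m a n :
  L2 P (fun w => \sum_(a <= k < a + n) Z k w * (u k.+1 w - V m k.+1 w)) /\
  Ex P (fun w => (\sum_(a <= k < a + n) Z k w * (u k.+1 w - V m k.+1 w)) ^+ 2) <= s2 ^+ 2 * r m * n%:R.
Proof.
pose F N w := \sum_(a <= k < a + n) Z k w * \sum_(m <= j < m + N) b j * Z (k.+1 + j)%N w.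
have md : measurable_fun setT (fun w => \sum_(a <= k < a + n) Z k w * (u k.+1 w - V m k.+1 w)).
  by apply: measurable_sum => k; apply: measurable_funM => //; exact: measurable_funB.
have PF N := Ex_sqr_pairs Ziid mid mid lZ lZ Z0 Z0 b a n m (m + N).
have [] := @Ex_fatou _ _ _ P (fun N w => F N w ^+ 2)
  (fun w => (\sum_(a <= k < a + n) Z k w * (u k.+1 w - V m k.+1 w)) ^+ 2) (s2 ^+ 2 * r m * n%:R).
- by move=> N; have [[]] := PF N.
- by move=> N w; exact: sqr_ge0.
- exact: measurable_funX.
- by move=> w; exact: sqr_ge0.
- have := ae_all (tail_cvg m); apply: filterS => w cw.
  have cF : F N w @[N --> \oo] --> \sum_(a <= k < a + n) Z k w * (u k.+1 w - V m k.+1 w).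
    by apply: cvg_sumr => k; apply: cvgMr; exact: cw.
  rewrite expr2; under eq_fun do rewrite expr2.
  exact: cvgM.
- move=> N; have [_ ->] := PF N; rewrite -/s2 -expr2.
  have -> : s2 ^+ 2 * r m * n%:R = n%:R * r m * s2 ^+ 2 by ring.
  by rewrite ler_wpM2r ?sqr_ge0// ler_wpM2l.
by move=> iu Eu; split.
Qed.

Lemma lin_tail0 a n :
  L2 P (fun w => \sum_(a <= k < a + n) Z k w * u k.+1 w) /\
  Ex P (fun w => (\sum_(a <= k < a + n) Z k w * u k.+1 w) ^+ 2) <= s2 ^+ 2 * r 0%N * n%:R.
Proof.
have := lin_tail 0 a n.
have E w : \sum_(a <= k < a + n) Z k w * (u k.+1 w - V 0 k.+1 w) = \sum_(a <= k < a + n) Z k w * u k.+1 w.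
  by apply: eq_bigr => k _; rewrite /V big_geq// subr0.
by under [X in L2 P X]eq_fun do rewrite E; under [X in Ex P X]eq_fun do rewrite E.
Qed.

Lemma lin_slln :
  {ae P, forall w, n%:R^-1 * (\sum_(0 <= k < n) Z k w * u k.+1 w) @[n --> \oo] --> 0}.
Proof.
apply: (slln_orthogonal (C := s2 ^+ 2 * r 0%N)).
- by rewrite mulr_ge0// sqr_ge0.
- move=> k; have [h _] := lin_tail0 k 1.
  rewrite (_ : (fun _ => _) = (fun w => \sum_(k <= l < k + 1) Z l w * u l.+1 w))//.
  by apply/funext => w; rewrite addn1 big_nat1.
- by move=> a n; exact: (lin_tail0 a n).2.
Qed.

Lemma lin_clt c :
  Ex P (fun w => cos ((Num.sqrt n%:R)^-1 * (\sum_(0 <= k < n) Z k w * u k.+1 w) + c)) @[n --> \oo] -->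
  expR (- (s2 ^+ 2 * B) / 2) * cos c.
Proof.
have icos F : measurable_fun setT F -> intg P (fun w => cos (F w : R)).
  move=> mF; apply: (@intg_bd _ _ _ _ _ 1) => [|w]; last exact: cos_max.
  by apply: measurableT_comp => //; exact: measurable_cos.
apply: (cvg_of_approx (y := fun m n => Ex P (fun w => cos ((Num.sqrt n%:R)^-1 *
     (\sum_(0 <= k < n) Z k w * V m k.+1 w) + c)))
   (L := fun m => expR (- (s2 ^+ 2 * \sum_(0 <= j < m) b j ^+ 2) / 2) * cos c)
   (del := fun m => Num.sqrt (s2 ^+ 2 * r m))).
- move=> m n n0; have [lD ED] := lin_tail m 0 n; rewrite add0n in lD ED.
  set h := (Num.sqrt n%:R)^-1.
  have h0 : 0 <= h by rewrite invr_ge0 sqrtr_ge0.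
  have mS (v : nat -> T -> R) : (forall i, measurable_fun setT (v i)) ->
      measurable_fun setT (fun w => h * (\sum_(0 <= k < n) Z k w * v k.+1 w) + c).
    move=> mv; apply: measurable_funD => //; apply: measurable_funM => //.
    by apply: measurable_sum => k; exact: measurable_funM.
  have i0 := icos _ (mS _ mu); have iM := icos _ (mS _ (mV m)).
  rewrite -ExB//.
  set D := (fun w => _ : R) in lD ED.
  have i3 : intg P (fun w => h * `|D w|) by apply: intgZ; apply: intg_abs; exact: L2_intg.
  apply: (le_trans (Ex_abs (intgB i0 iM))).
  apply: (@le_trans _ _ (Ex P (fun w => h * `|D w|))).
    apply: Ex_le => //; first by apply: intg_abs; exact: intgB.
    move=> w; apply: (le_trans (cos_lip _ _)).
    rewrite opprD addrACA subrr addr0 -mulrBr normrM ger0_norm// -sumrB.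
    by rewrite [X in h * `|X|](_ : _ = D w)//; apply: eq_bigr => k _; rewrite mulrBr.
  rewrite ExZ; last by apply: intg_abs; exact: L2_intg.
  rewrite -(@ler_pXn2r _ 2%N) ?nnegrE ?sqrtr_ge0 ?mulr_ge0 ?Ex_ge0// sqr_sqrtr ?mulr_ge0 ?sqr_ge0// exprMn.
  have -> : h ^+ 2 = n%:R^-1 by rewrite exprVn sqr_sqrtr.
  rewrite mulrC ler_pdivrMr ?ltr0n//.
  exact: le_trans (Ex_sqr_le lD) ED.
- by move=> m; exact: clt_finite.
- rewrite -(sqrtr0 R).
  apply: (cvg_comp (fun m => s2 ^+ 2 * r m) (fun x : R => Num.sqrt x)); last exact: sqrt_continuous.
  by rewrite -(mulr0 (s2 ^+ 2)); exact: cvgMr.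
- apply: cvgMl.
  apply: (cvg_comp (fun m => - (s2 ^+ 2 * \sum_(0 <= j < m) b j ^+ 2) / 2) (fun x : R => expR x)); last exact: continuous_expR.
  by apply: cvgMl; apply: cvgN; exact: cvgMr.
Qed.

End infinite.

End linear_process.

(** * Trigonometric approximation and the continuity theorem *)

Section bernstein.
Variable R : realType.

(** Binomial weights, defined by Pascal's recursion so that every property
    needed below is a direct induction. *)
Fixpoint bw (m : nat) (s : R) (k : nat) : R :=
  if m is m'.+1 then (1 - s) * bw m' s k + s * (if k is k'.+1 then bw m' s k' else 0)
  else (k == 0%N)%:R.

Lemma bw_ge0 m s k : 0 <= s <= 1 -> 0 <= bw m s k.
Proof.
move=> /andP[s0 s1]; elim: m k => [|m IH] k /=; first exact: ler0n.
by rewrite addr_ge0// mulr_ge0 ?subr_ge0//; case: k.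
Qed.

Lemma bw_big m s k : (m < k)%N -> bw m s k = 0.
Proof.
elim: m k => [|m IH] [|k] //= mk; rewrite !IH ?mulr0 ?addr0//.
exact: ltnW.
Qed.

(** One more trial moves the argument from [k] to [k.+1] with probability [s]. *)
Lemma bw_step m s (h : nat -> R) :
  \sum_(k < m.+2) bw m.+1 s k * h k =
  (1 - s) * \sum_(k < m.+1) bw m s k * h k + s * \sum_(k < m.+1) bw m s k * h k.+1.
Proof.
have -> : \sum_(k < m.+2) bw m.+1 s k * h k = \sum_(k < m.+2) (1 - s) * (bw m s k * h k)
    + \sum_(k < m.+2) s * ((if val k is k'.+1 then bw m s k' else 0) * h k).
  by rewrite -big_split /=; apply: eq_bigr => k _; ring.
congr (_ + _).
  by rewrite big_ord_recr /= bw_big// mul0r mulr0 addr0 mulr_sumr.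
by rewrite big_ord_recl /= mul0r mulr0 add0r mulr_sumr; apply: eq_bigr.
Qed.

Lemma bw_sum1 m s : \sum_(k < m.+1) bw m s k = 1.
Proof.
suff : \sum_(k < m.+1) bw m s k * 1 = 1 by under eq_bigr do rewrite mulr1.
elim: m => [|m IH]; first by rewrite big_ord1 mulr1.
by rewrite (bw_step _ _ (fun=> 1)) IH; ring.
Qed.

Lemma bw_var m s : \sum_(k < m.+1) bw m s k * (k%:R - m%:R * s) ^+ 2 = m%:R * (s * (1 - s)).
Proof.
have mean n : \sum_(k < n.+1) bw n s k * (k%:R - n%:R * s) = 0.
  elim: n => [|n IH]; first by rewrite big_ord1 /=; ring.
  rewrite (bw_step _ _ (fun k => k%:R - n.+1%:R * s)).
  have E c : \sum_(k < n.+1) bw n s k * ((k%:R - n%:R * s) + c) = c.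
    under eq_bigr do rewrite mulrDr.
    by rewrite big_split /= IH add0r -mulr_suml bw_sum1 mul1r.
  have E1 : \sum_(k < n.+1) bw n s k * (k%:R - n.+1%:R * s) = - s.
    by rewrite -(E (- s)); apply: eq_bigr => k _; rewrite -[n.+1%:R]natr1; congr (_ * _); ring.
  have E2 : \sum_(k < n.+1) bw n s k * (k.+1%:R - n.+1%:R * s) = 1 - s.
    rewrite -(E (1 - s)); apply: eq_bigr => k _.
    by rewrite -[k.+1%:R]natr1 -[n.+1%:R]natr1; congr (_ * _); ring.
  by rewrite E1 E2; ring.
elim: m => [|m IH]; first by rewrite big_ord1 /=; ring.
rewrite (bw_step _ _ (fun k => (k%:R - m.+1%:R * s) ^+ 2)).
have E c : \sum_(k < m.+1) bw m s k * ((k%:R - m%:R * s) + c) ^+ 2 = m%:R * (s * (1 - s)) + c ^+ 2.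
  rewrite (eq_bigr (fun k : 'I_m.+1 => bw m s k * (k%:R - m%:R * s) ^+ 2 +
     ((2 * c) * (bw m s k * (k%:R - m%:R * s)) + c ^+ 2 * bw m s k))); last by move=> k _; ring.
  by rewrite !big_split /= IH -!mulr_sumr mean bw_sum1; ring.
have E1 : \sum_(k < m.+1) bw m s k * (k%:R - m.+1%:R * s) ^+ 2 = m%:R * (s * (1 - s)) + (- s) ^+ 2.
  by rewrite -(E (- s)); apply: eq_bigr => k _; rewrite -[m.+1%:R]natr1; congr (_ * _ ^+ 2); ring.
have E2 : \sum_(k < m.+1) bw m s k * (k.+1%:R - m.+1%:R * s) ^+ 2 = m%:R * (s * (1 - s)) + (1 - s) ^+ 2.
  rewrite -(E (1 - s)); apply: eq_bigr => k _.
  by rewrite -[k.+1%:R]natr1 -[m.+1%:R]natr1; congr (_ * _ ^+ 2); ring.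
by rewrite E1 E2 -natr1; ring.
Qed.

(** The difference of the sines is [2 * sin ((u - v) / 2) * cos ((u + v) / 2)], and
    the cosine is bounded away from zero because [u] stays in a smaller interval
    than [v]. *)
Lemma sin_sep (d : R) : 0 < d <= 1 -> exists2 eta : R, 0 < eta &
  forall u v : R, `|u| <= 1 / 2 -> `|v| <= pi / 2 -> `|sin u - sin v| < eta -> `|u - v| < d.
Proof.
move=> /andP[d0 d1].
have p1 := pihalf_ge1 R; have p2 := pihalf_lt2 R.
pose a := (1 / 2 + pi / 2) / 2 : R.
have a0 : 0 < cos a by apply: cos_gt0_pihalf; rewrite /a; apply/andP; split; lra.
have sd : 0 < sin (d / 2) by apply: sin_gt0_pihalf; apply/andP; split; lra.
exists (2 * sin (d / 2) * cos a); first by rewrite !mulr_gt0.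
have cosm x : `|x| <= a -> cos a <= cos x.
  move=> xa; rewrite -(cos_norm x).
  have := @ltr_cos R `|x| a; rewrite !in_itv /= => H.
  have pa : a <= pi by rewrite /a; lra.
  have a00 : 0 <= a by rewrite /a; lra.
  move: xa; rewrite le_eqVlt => /orP[/eqP ->//|xa].
  apply: ltW; rewrite H //.
  - by rewrite normr_ge0 /= (le_trans (ltW xa)).
  - by rewrite a00.
have sinm x : d / 2 <= x -> x <= a -> sin (d / 2) <= sin x.
  move=> dx xa.
  have := @ltr_sin R (d / 2) x; rewrite !in_itv /= => H.
  have pa : a <= pi / 2 by rewrite /a; lra.
  move: dx; rewrite le_eqVlt => /orP[/eqP ->//|dx].
  by apply: ltW; rewrite H //; apply/andP; split; lra.
have key u v : `|u| <= 1 / 2 -> `|v| <= pi / 2 -> d <= `|u - v| ->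
    2 * sin (d / 2) * cos a <= `|sin u - sin v|.
  move=> u1 v1 duv.
  have -> : sin u - sin v = 2 * (sin ((u - v) / 2) * cos ((u + v) / 2)).
    have {1}-> : u = (u + v) / 2 + (u - v) / 2 by field.
    have {3}-> : v = (u + v) / 2 - (u - v) / 2 by field.
    by rewrite sinD sinB; ring.
  rewrite !normrM (ger0_norm (ler0n R 2)) -mulrA ler_wpM2l//.
  have c1 : cos a <= `|cos ((u + v) / 2)|.
    apply: le_trans (ler_norm _); apply: cosm.
    rewrite normrM (ger0_norm (x := 2^-1))// /a.
    by have := ler_normD u v; lra.
  have s1 : sin (d / 2) <= `|sin ((u - v) / 2)|.
    have -> : `|sin ((u - v) / 2)| = `|sin (`|u - v| / 2)|.
      have [uv|uv] := leP 0 (u - v); first by rewrite (ger0_norm uv).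
      by rewrite (ltr0_norm uv) mulNr sinN normrN.
    apply: le_trans (ler_norm _); apply: sinm; first by lra.
    by rewrite /a; have := ler_normB u v; lra.
  by apply: ler_pM => //; exact: ltW.
move=> u v u1 v1; apply: contraTT; rewrite -!leNgt; exact: key.
Qed.

End bernstein.

Section vectors.
Variables (R : realType) (D : nat).

Definition dotp (t x : 'cV[R]_D) : R := \sum_(i < D) t i 0 * x i 0.

Lemma dotpDl s t x : dotp (s + t) x = dotp s x + dotp t x.
Proof. by rewrite /dotp -big_split; apply: eq_bigr => i _; rewrite mxE mulrDl. Qed.

Lemma dotpNl t x : dotp (- t) x = - dotp t x.
Proof. by rewrite /dotp -sumrN; apply: eq_bigr => i _; rewrite mxE mulNr. Qed.

Lemma dotp0l x : dotp 0 x = 0.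
Proof. by rewrite /dotp big1// => i _; rewrite mxE mul0r. Qed.

Lemma dotp_delta c i x : dotp (c *: delta_mx i 0) x = c * x i 0.
Proof.
rewrite /dotp (bigD1 i)//= !mxE !eqxx mulr1 big1 ?addr0// => j ji.
by rewrite !mxE (negbTE ji) mulr0 mul0r.
Qed.

Lemma dotp_deltal i x : dotp (delta_mx i 0) x = x i 0.
Proof. by rewrite -[delta_mx i 0]scale1r dotp_delta mul1r. Qed.

Lemma dotpE t x : dotp t x = (t^T *m x) 0 0.
Proof. by rewrite mxE; apply: eq_bigr => i _; rewrite mxE. Qed.

Lemma dotp_mull t x (M : 'M[R]_D) : dotp t (M *m x) = dotp (M^T *m t) x.
Proof. by rewrite !dotpE trmx_mul trmxK mulmxA. Qed.

Lemma uniformly_continuous_cube (f : 'cV[R]_D -> R) (L e : R) : continuous f -> 0 < e ->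
  exists2 d : R, 0 < d & forall x y : 'cV[R]_D, (forall i, `|x i 0| <= L) ->
    (forall i, `|x i 0 - y i 0| < d) -> `|f x - f y| <= e.
Proof.
move=> cf e0.
pose K := [set v : 'rV[R]_D | forall i, v ord0 i \in `[(- L), L]].
have cK : compact K.
  apply: (@rV_compact _  _ (fun=> `[(- L), L]%classic)).
  by move=> _; apply: segment_compact.
have := (compact_near_coveringP K).1 cK R (0^'+)
  (fun d x => forall y : 'rV[R]_D, (forall i, `|x 0 i - y 0 i| < d) -> `|f x^T - f y^T| <= e) _.
move=> H.
have [|d /= d0 Hd] := H _.
  move=> x Kx; have e20 : 0 < e / 2 by rewrite divr_gt0.
  have /cvgrPdist_le /(_ _ e20) /nbhs_ballP [r /= r0 Hr] := cf x^T.
  have near (y : 'rV[R]_D) : (forall i, `|x 0 i - y 0 i| < r) -> `|f x^T - f y^T| <= e / 2.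
    move=> xy; apply: Hr; split => // i j; rewrite !mxE ord1; exact: xy.
  have r20 : 0 < r / 2 by rewrite divr_gt0.
  exists (ball x (r / 2), [set d | 0 < d < r / 2]) => /=.
    split; first exact: nbhsx_ballx.
    by near=> d; apply/andP; split; near: d; [exact: nbhs_right_gt|exact: nbhs_right_lt].
  move=> [x' d] /= [[_ xx'] /andP[d0 dr]] y x'y.
  have h1 : `|f x^T - f x'^T| <= e / 2.
    by apply: near => i; apply: (lt_trans (xx' 0 i)); rewrite ltr_pdivrMr// mulr2n mulrDr mulr1 ltrDl.
  have h2 : `|f x^T - f y^T| <= e / 2.
    apply: near => i; have -> : x 0 i - y 0 i = (x 0 i - x' 0 i) + (x' 0 i - y 0 i) by ring.
    apply: (le_lt_trans (ler_normD _ _)).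
    have := xx' 0 i; rewrite /ball /= => h3; have := x'y i => h4.
    have -> : r = r / 2 + r / 2 by field.
    by apply: ltrD => //; exact: lt_trans dr.
  have -> : f x'^T - f y^T = (f x^T - f y^T) - (f x^T - f x'^T) by ring.
  by apply: (le_trans (ler_normB _ _)); lra.
exists (d / 2); first by rewrite divr_gt0.
move=> x y xL xy; have := Hd (d / 2); rewrite /ball_ /= sub0r normrN gtr0_norm ?divr_gt0//.
have dd : d / 2 < d by rewrite ltr_pdivrMr// mulr2n mulrDr mulr1 ltrDl.
move=> /(_ dd isT x^T) /=.
rewrite -[x in f x - _]trmxK -[y in _ - f y]trmxK; apply.
  by move=> i; rewrite mxE in_itv /= -ler_norml.
by move=> i; rewrite !mxE.
Unshelve. all: by end_near.
Qed.

Definition trigpoly (p : 'cV[R]_D -> R) : Prop :=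
  exists s : seq (R * 'cV[R]_D * R), forall x,
    p x = \sum_(q <- s) q.1.1 * cos (dotp q.1.2 x + q.2).

Lemma trigpoly_cst c : trigpoly (fun=> c).
Proof.
by exists [:: (c, 0, 0)] => x; rewrite big_seq1 /= dotp0l addr0 cos0 mulr1.
Qed.

Lemma trigpolyD p q : trigpoly p -> trigpoly q -> trigpoly (fun x => p x + q x).
Proof. by move=> [s ps] [t qt]; exists (s ++ t) => x; rewrite big_cat ps qt. Qed.

Lemma trigpolyM p q : trigpoly p -> trigpoly q -> trigpoly (fun x => p x * q x).
Proof.
move=> [s ps] [t qt].
pose f (a b : R * 'cV[R]_D * R) := [:: (a.1.1 * b.1.1 / 2, a.1.2 + b.1.2, a.2 + b.2);
  (a.1.1 * b.1.1 / 2, a.1.2 - b.1.2, a.2 - b.2)].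
exists (flatten [seq f c.1 c.2 | c <- [seq (a, b) | a <- s, b <- t]]) => x.
rewrite ps qt big_flatten /= big_map big_allpairs mulr_suml; apply: eq_bigr => a _.
rewrite mulr_sumr; apply: eq_bigr => b _.
rewrite /f !big_cons big_nil /= !dotpDl dotpNl addr0.
set A := dotp _ _; set B := dotp _ _.
have -> : A + B + (a.2 + b.2) = (A + a.2) + (B + b.2) by ring.
have -> : A - B + (a.2 - b.2) = (A + a.2) - (B + b.2) by ring.
by move: (A + a.2) (B + b.2) => u v; rewrite cosD cosB; field.
Qed.

Lemma trigpoly_sum (I : Type) (s : seq I) (p : I -> 'cV[R]_D -> R) :
  (forall i, trigpoly (p i)) -> trigpoly (fun x => \sum_(i <- s) p i x).
Proof.
move=> tp; elim: s => [|i s IH].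
  by under eq_fun do rewrite big_nil; exact: trigpoly_cst.
by under eq_fun do rewrite big_cons; exact: trigpolyD.
Qed.

Lemma trigpoly_prod (I : Type) (s : seq I) (p : I -> 'cV[R]_D -> R) :
  (forall i, trigpoly (p i)) -> trigpoly (fun x => \prod_(i <- s) p i x).
Proof.
move=> tp; elim: s => [|i s IH].
  by under eq_fun do rewrite big_nil; exact: trigpoly_cst.
by under eq_fun do rewrite big_cons; exact: trigpolyM.
Qed.

Lemma trigpoly_sin om i : trigpoly (fun x => sin (om * x i 0)).
Proof.
exists [:: (1, om *: delta_mx i 0, - (pi / 2))] => x.
by rewrite big_seq1 /= mul1r dotp_delta cosBpihalf.
Qed.

Lemma trigpoly_bw p m k : trigpoly p -> trigpoly (fun x => bw m (p x) k).
Proof.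
move=> tp; have tN : trigpoly (fun x => 1 - p x).
  apply: trigpolyD; first exact: trigpoly_cst.
  have := trigpolyM (trigpoly_cst (-1)) tp; congr trigpoly.
  by apply/funext => x; rewrite mulN1r.
elim: m k => [|m IH] k /=; first exact: trigpoly_cst.
apply: trigpolyD; first exact: trigpolyM.
by apply: trigpolyM => //; case: k => [|k]; [exact: trigpoly_cst|exact: IH].
Qed.

(** Bernstein approximation in the variables (1 + sin (x_i / 2L)) / 2: the
    sine is injective on the cube, and it keeps the weights a probability on
    the whole space, so the approximation stays bounded off the cube. *)
Lemma trig_approx (f : 'cV[R]_D -> R) M L e : continuous f ->
  (forall x, `|f x| <= M) -> 0 < L -> 0 < e ->
  exists p, [/\ trigpoly p, forall x, `|p x| <= M &
    forall x : 'cV[R]_D, (forall i, `|x i 0| <= L) -> `|p x - f x| <= e].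
Proof.
move=> cf fM L0 e0; have M0 : 0 <= M by apply: le_trans (fM 0).
pose om := (2 * L)^-1.
have om0 : 0 < om by rewrite invr_gt0 mulr_gt0.
have e20 : 0 < e / 2 by rewrite divr_gt0.
have [d0 d00 Hd0] := uniformly_continuous_cube L cf e20.
pose d := Num.min (om * d0) 1.
have dP : 0 < d <= 1 by rewrite lt_min mulr_gt0// ltr01 ge_min lexx orbT.
have [eta eta0 Heta] := sin_sep dP.
pose S (x : 'cV[R]_D) i : R := (1 + sin (om * x i 0)) / 2.
have S01 x i : 0 <= S x i <= 1.
  by rewrite /S; have := sin_le1 (om * x i 0); have := sin_geN1 (om * x i 0); lra.
(* each variance is at most 1/(4m), so this m makes the tail term small *)
pose A := 2 * M * D%:R * (4 / eta ^+ 2).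
have A0 : 0 <= A by rewrite !mulr_ge0// invr_ge0 sqr_ge0.
pose m := (Num.bound (A / (e / 2))).+1.
have mR0 : 0 < (m%:R : R) by rewrite ltr0n.
have mA : A / m%:R <= e / 2.
  rewrite ler_pdivrMr// mulrC -ler_pdivrMr//.
  by rewrite ltW// (lt_trans (archi_boundP _)) ?ltr_nat// divr_ge0// ltW.
(* [y k] is the grid point whose transformed coordinates are [k i / m] *)
pose y (k : {ffun 'I_D -> 'I_m.+1}) : 'cV[R]_D := \col_i (asin (2 * ((k i)%:R / m%:R) - 1) / om).
pose w x (k : {ffun 'I_D -> 'I_m.+1}) := \prod_(i < D) bw m (S x i) (k i).
have w0 x k : 0 <= w x k by apply: prodr_ge0 => i _; exact: bw_ge0.
have w1 x : \sum_k w x k = 1.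
  by rewrite /w -(bigA_distr_bigA (fun i (k : 'I_m.+1) => bw m (S x i) k)) big1// => i _; exact: bw_sum1.
have range (k : 'I_m.+1) : -1 <= 2 * ((k%:R : R) / m%:R) - 1 <= 1.
  have h1 : 0 <= (k%:R : R) / m%:R by rewrite divr_ge0.
  have h2 : (k%:R : R) / m%:R <= 1 by rewrite ler_pdivrMr// mul1r ler_nat -ltnS.
  by apply/andP; split; lra.
have sin_y k i : sin (om * y k i 0) = 2 * ((k i)%:R / m%:R) - 1.
  rewrite /y mxE mulrC divfK ?gt_eqF// asinK// in_itv /=; exact: range.
have y_le k i : `|om * y k i 0| <= pi / 2.
  rewrite /y mxE mulrC divfK ?gt_eqF// ler_norml.
  by rewrite asin_geNpi2 ?range// asin_lepi2 ?range.
exists (fun x => \sum_k f (y k) * w x k); split.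
- apply: trigpoly_sum => k; apply: trigpolyM; first exact: trigpoly_cst.
  apply: trigpoly_prod => i; apply: trigpoly_bw.
  rewrite /S; under eq_fun do rewrite mulrC.
  apply: trigpolyM; first exact: trigpoly_cst.
  by apply: trigpolyD; [exact: trigpoly_cst|exact: trigpoly_sin].
- move=> x; apply: (le_trans (ler_norm_sum _ _ _)).
  rewrite -[leRHS]mulr1 -(w1 x) mulr_sumr; apply: ler_sum => k _.
  by rewrite normrM (ger0_norm (w0 x k)) ler_wpM2r.
move=> x xL.
have key k : `|f (y k) - f x| <= e / 2 + 2 * M * \sum_i (4 / eta ^+ 2) * ((k i)%:R / m%:R - S x i) ^+ 2.
  have [/forallP H|] := boolP [forall i, `|sin (om * x i 0) - sin (om * y k i 0)| < eta].
    apply: (@le_trans _ _ (e / 2)); last first.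
      by rewrite lerDl mulr_ge0// ?mulr_ge0// sumr_ge0// => i _; rewrite mulr_ge0 ?sqr_ge0// divr_ge0// sqr_ge0.
    rewrite distrC; apply: Hd0 => // i.
    have : `|om * x i 0 - om * y k i 0| < d.
      apply: Heta => //.
      rewrite normrM (gtr0_norm om0) mulrC /om ler_pdivrMr ?mulr_gt0//.
      by have := xL i; lra.
    rewrite -mulrBr normrM (gtr0_norm om0) lt_min => /andP[+ _].
    by rewrite ltr_pM2l.
  move=> /forallPn /= [j]; move: j => i; rewrite -leNgt sin_y => Hi.
  apply: (@le_trans _ _ (2 * M)).
    by apply: (le_trans (ler_normB _ _)); have := fM (y k); have := fM x; lra.
  apply: (@le_trans _ _ (2 * M * \sum_i0 4 / eta ^+ 2 * ((k i0)%:R / m%:R - S x i0) ^+ 2)); last first.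
    by rewrite lerDr ltW.
  rewrite -[leLHS]mulr1 ler_wpM2l ?mulr_ge0// (bigD1 i)//=.
  apply: (@le_trans _ _ (4 / eta ^+ 2 * ((k i)%:R / m%:R - S x i) ^+ 2)); last first.
    by rewrite lerDl sumr_ge0// => j _; rewrite mulr_ge0 ?sqr_ge0// divr_ge0// sqr_ge0.
  have -> : 4 / eta ^+ 2 * ((k i)%:R / m%:R - S x i) ^+ 2 =
     `|sin (om * x i 0) - (2 * ((k i)%:R / m%:R) - 1)| ^+ 2 / eta ^+ 2.
    rewrite real_normK ?num_real// /S; field.
    by rewrite pnatr_eq0 gt_eqF.
  by rewrite ler_pdivlMr ?exprn_gt0// mul1r ler_pXn2r ?nnegrE// ltW.
have -> : \sum_k f (y k) * w x k - f x = \sum_k (f (y k) - f x) * w x k.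
  under [RHS]eq_bigr do rewrite mulrBl.
  by rewrite sumrB -mulr_sumr w1 mulr1.
apply: (le_trans (ler_norm_sum _ _ _)).
apply: (@le_trans _ _ (\sum_(k : {ffun 'I_D -> 'I_m.+1}) (e / 2 + 2 * M * \sum_i (4 / eta ^+ 2) * ((k i)%:R / m%:R - S x i) ^+ 2) * w x k)).
  by apply: ler_sum => k _; rewrite normrM (ger0_norm (w0 x k)) ler_wpM2r// key.
under eq_bigr do rewrite mulrDl.
rewrite big_split /= -mulr_sumr w1 mulr1.
suff H : \sum_(k : {ffun 'I_D -> 'I_m.+1}) 2 * M * (\sum_i (4 / eta ^+ 2) * ((k i)%:R / m%:R - S x i) ^+ 2) * w x k <= A / m%:R.
  by move: H mA; lra.
have varle i : \sum_(k : {ffun 'I_D -> 'I_m.+1}) ((k i)%:R / m%:R - S x i) ^+ 2 * w x k <= m%:R^-1.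
  pose h j (k : 'I_m.+1) := (if j == i then (k%:R / m%:R - S x i) ^+ 2 else 1) * bw m (S x j) k.
  have -> : \sum_(k : {ffun 'I_D -> 'I_m.+1}) ((k i)%:R / m%:R - S x i) ^+ 2 * w x k = \sum_(k : {ffun 'I_D -> 'I_m.+1}) \prod_(j < D) h j (k j).
    apply: eq_bigr => k _; rewrite /h big_split /= -/(w x k); congr (_ * _).
    by rewrite (bigD1 i)//= eqxx big1 ?mulr1// => j /negbTE ->.
  rewrite -(bigA_distr_bigA h) (bigD1 i)//= [X in _ * X]big1 ?mulr1; last first.
    by move=> j /negbTE ji; rewrite -[RHS](bw_sum1 m (S x j)); apply: eq_bigr => k _; rewrite /h ji mul1r.
  have -> : \sum_j h i j = (m%:R ^+ 2)^-1 * \sum_(k < m.+1) bw m (S x i) k * (k%:R - m%:R * S x i) ^+ 2.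
    rewrite mulr_sumr; apply: eq_bigr => k _; rewrite /h eqxx; field.
    by rewrite pnatr_eq0.
  rewrite bw_var; have /andP[S0 S1] := S01 x i.
  have -> : (m%:R ^+ 2)^-1 * (m%:R * (S x i * (1 - S x i))) = m%:R^-1 * (S x i * (1 - S x i)).
    by field; rewrite pnatr_eq0.
  rewrite -[leRHS]mulr1 ler_wpM2l ?invr_ge0//; nra.
rewrite (eq_bigr (fun k : {ffun 'I_D -> 'I_m.+1} => \sum_(i < D) 2 * M * (4 / eta ^+ 2) * (((k i)%:R / m%:R - S x i) ^+ 2 * w x k))); last first.
  by move=> k _; rewrite mulr_sumr mulr_suml; apply: eq_bigr => i _; rewrite !mulrA.
rewrite exchange_big /=.
apply: (@le_trans _ _ (\sum_(i < D) 2 * M * (4 / eta ^+ 2) * m%:R^-1)).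
  apply: ler_sum => i _; rewrite -mulr_sumr ler_wpM2l// !mulr_ge0//.
  by rewrite invr_ge0 sqr_ge0.
rewrite sumr_const card_ord -[leLHS]mulr_natl /A; lra.
Qed.

End vectors.

Section levy.
Variables (R : realType) (D : nat).

(** Its expectation measures convergence in probability; taken at [x / K] it
    dominates the indicator of [K <= `|x|], so that it also expresses tightness. *)
Definition capped (x : R) : R := Num.min 1 `|x|.

Lemma capped_ge0 x : 0 <= capped x.
Proof. by rewrite le_min ler01 normr_ge0. Qed.

Lemma capped_le1 x : capped x <= 1.
Proof. by rewrite ge_min lexx. Qed.

Lemma capped_le_norm x : capped x <= `|x|.
Proof. by rewrite ge_min lexx orbT. Qed.

Lemma measurable_capped : measurable_fun setT capped.
Proof. by apply: measurable_minr => //; exact: measurableT_comp. Qed.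

Lemma capped_mono x y : `|x| <= `|y| -> capped x <= capped y.
Proof. by move=> xy; rewrite le_min capped_le1 /= (le_trans (capped_le_norm x)). Qed.

Section measurability.
Context {disp : measure_display} {T : measurableType disp} (P : probability T R).

Lemma measurable_dotp (X : T -> 'cV[R]_D) t :
  (forall i, measurable_fun setT (fun w => X w i 0)) -> measurable_fun setT (fun w => dotp t (X w)).
Proof. by move=> mX; apply: measurable_sum => i; exact: measurable_funM. Qed.

Lemma measurable_trigpoly (X : T -> 'cV[R]_D) p :
  (forall i, measurable_fun setT (fun w => X w i 0)) -> trigpoly p ->
  measurable_fun setT (fun w => p (X w)).
Proof.
move=> mX [s ps]; under eq_fun do rewrite ps.
apply: measurable_sum => q; apply: measurable_funM => //.
apply: measurableT_comp; first exact: measurable_cos.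
by apply: measurable_funD => //; exact: measurable_dotp.
Qed.

(** A continuous function of the coordinates is a pointwise limit of
    trigonometric polynomials, which are measurable by inspection. *)
Lemma measurable_continuous (X : T -> 'cV[R]_D) (f : 'cV[R]_D -> R) M :
  (forall i, measurable_fun setT (fun w => X w i 0)) -> continuous f ->
  (forall x, `|f x| <= M) -> measurable_fun setT (fun w => f (X w)).
Proof.
move=> mX cf fM.
have /choice [p Hp] : forall n : nat, exists p, [/\ trigpoly p, forall x, `|p x| <= M &
    forall x : 'cV[R]_D, (forall i, `|x i 0| <= n.+1%:R) -> `|p x - f x| <= n.+1%:R^-1].
  by move=> n; apply: trig_approx => //; rewrite invr_gt0.
apply: (@measurable_fun_cvg _ _ _ _ (fun n w => p n (X w))).
  by move=> n; apply: measurable_trigpoly => //; have [] := Hp n.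
move=> w _; apply/cvgrPdist_le => e e0.
pose B := \sum_i `|X w i 0| : R.
have B0 : 0 <= B by apply: sumr_ge0.
near=> n.
have nb : B <= n.+1%:R.
  apply: (@le_trans _ _ (Num.bound B)%:R); first by rewrite ltW// archi_boundP.
  by rewrite ler_nat leqW//; near: n; exists (Num.bound B).
rewrite distrC; apply: (@le_trans _ _ n.+1%:R^-1).
  have [_ _] := Hp n; apply => i; apply: le_trans nb.
  by rewrite /B (bigD1 i)//= lerDl sumr_ge0.
rewrite invf_ple ?posrE//.
apply: (@le_trans _ _ (Num.bound e^-1)%:R); first by rewrite ltW// archi_boundP// invr_ge0 ltW.
by rewrite ler_nat leqW//; near: n; exists (Num.bound e^-1).
Unshelve. all: by end_near.
Qed.

Lemma intg_continuous (X : T -> 'cV[R]_D) (f : 'cV[R]_D -> R) M :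
  (forall i, measurable_fun setT (fun w => X w i 0)) -> continuous f ->
  (forall x, `|f x| <= M) -> intg P (fun w => f (X w)).
Proof.
by move=> mX cf fM; apply: (@intg_bd _ _ _ _ _ M) => //; exact: measurable_continuous fM.
Qed.

Lemma intg_capped (F : T -> R) : measurable_fun setT F -> intg P (fun w => capped (F w)).
Proof.
move=> mF; apply: (@intg_bd _ _ _ _ _ 1) => [|w].
  by apply: measurableT_comp => //; exact: measurable_capped.
by rewrite ger0_norm ?capped_ge0// capped_le1.
Qed.

Lemma Ex_trigpoly (X : T -> 'cV[R]_D) s :
  (forall i, measurable_fun setT (fun w => X w i 0)) ->
  intg P (fun w => \sum_(q <- s) q.1.1 * cos (dotp q.1.2 (X w) + q.2)) /\
  Ex P (fun w => \sum_(q <- s) q.1.1 * cos (dotp q.1.2 (X w) + q.2)) =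
  \sum_(q <- s) q.1.1 * Ex P (fun w => cos (dotp q.1.2 (X w) + q.2)) :> R.
Proof.
move=> mX.
have ic (q : R * 'cV[R]_D * R) : intg P (fun w => cos (dotp q.1.2 (X w) + q.2)).
  apply: (@intg_bd _ _ _ _ _ 1) => [|w]; last exact: cos_max.
  apply: measurableT_comp; first exact: measurable_cos.
  by apply: measurable_funD => //; exact: measurable_dotp.
split; first by apply: intg_sum => q _; exact: intgZ.
rewrite (@Ex_sum _ _ _ P _ s (fun q w => q.1.1 * cos (dotp q.1.2 (X w) + q.2))).
  by apply: eq_bigr => q _; rewrite ExZ.
by move=> q; exact: intgZ.
Qed.

(** Off the cube the error is at most [2 * M], and some capped coordinate equals 1. *)
Lemma Ex_approx_cube (X : T -> 'cV[R]_D) (f p : 'cV[R]_D -> R) M L e : 0 < L -> 0 <= e ->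
  (forall i, measurable_fun setT (fun w => X w i 0)) ->
  intg P (fun w => f (X w)) -> intg P (fun w => p (X w)) ->
  (forall x, `|f x| <= M) -> (forall x, `|p x| <= M) ->
  (forall x : 'cV[R]_D, (forall i, `|x i 0| <= L) -> `|p x - f x| <= e) ->
  `|Ex P (fun w => p (X w)) - Ex P (fun w => f (X w))| <=
    e + 2 * M * \sum_i Ex P (fun w => capped (X w i 0 / L)).
Proof.
move=> L0 e0 mX iF ip fM pM pf; have M0 : 0 <= M by apply: le_trans (fM 0).
have ic i : intg P (fun w => capped (X w i 0 / L)).
  by apply: intg_capped; exact: measurable_funM.
rewrite -ExB//; apply: (le_trans (Ex_abs (intgB ip iF))).
rewrite -(@Ex_sum _ _ _ P _ _ (fun i w => capped (X w i 0 / L)))// -[X in _ <= X + _](Ex_cst P e) -ExZ; last by apply: intg_sum.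
rewrite -ExD; [|exact: intg_cst|by apply: intgZ; apply: intg_sum].
apply: Ex_le; first by apply: intg_abs; exact: intgB.
  by apply: intgD; [exact: intg_cst|apply: intgZ; apply: intg_sum].
move=> w; have [/forallP H|] := boolP [forall i, `|X w i 0| <= L].
  by apply: (le_trans (pf _ H)); rewrite lerDl !mulr_ge0// sumr_ge0// => i _; exact: capped_ge0.
move=> /forallPn /= [j]; move: j => i; rewrite -ltNge => Hi.
apply: (@le_trans _ _ (2 * M)).
  by apply: (le_trans (ler_normB _ _)); have := fM (X w); have := pM (X w); lra.
apply: (@le_trans _ _ (2 * M * \sum_i0 capped (X w i0 0 / L))); last by rewrite lerDr.
rewrite -[leLHS]mulr1 ler_wpM2l ?mulr_ge0// (bigD1 i)//=.
have -> : capped (X w i 0 / L) = 1.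
  rewrite /capped normrM (gtr0_norm (x := L^-1)) ?invr_gt0//; apply/min_idPl.
  by rewrite ler_pdivlMr// mul1r ltW.
by rewrite lerDl sumr_ge0// => j _; exact: capped_ge0.
Qed.

Lemma tight1 (F : T -> R) e : measurable_fun setT F -> 0 < e ->
  exists2 K : R, 0 < K & Ex P (fun w => capped (F w / K)) <= e.
Proof.
move=> mF e0.
have [] := @Ex_dct _ _ _ P (fun n w => capped (F w / n.+1%:R)) (fun=> 0) (fun=> 1).
- by move=> n; apply: intg_meas; apply: intg_capped; exact: measurable_funM.
- by [].
- exact: intg_cst.
- apply: nearW => w; apply/cvgrPdist_le => d d0; near=> n.
  rewrite sub0r normrN ger0_norm ?capped_ge0//; apply: (le_trans (capped_le_norm _)).
  rewrite normrM (gtr0_norm (x := n.+1%:R^-1))// ler_pdivrMr// mulrC -ler_pdivrMr//.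
  apply: (@le_trans _ _ (Num.bound (`|F w| / d))%:R); first by rewrite ltW// archi_boundP// divr_ge0// ltW.
  by rewrite ler_nat leqW//; near: n; exists (Num.bound (`|F w| / d)).
- by move=> n w; rewrite ger0_norm ?capped_ge0// capped_le1.
move=> _; rewrite Ex_cst => /cvgrPdist_le /(_ _ e0) [N _ HN].
exists N.+1%:R => //; have := HN N (leqnn N); rewrite /= sub0r normrN; apply: le_trans; exact: ler_norm.
Unshelve. all: by end_near.
Qed.

End measurability.

(** Levy's continuity theorem with tightness assumed: bounded continuous
    functions are approximated by bounded trigonometric polynomials on a cube
    carrying almost all the mass. *)
Lemma levy_cvg (disp : measure_display) (T : measurableType disp) (P : probability T R)
  (X : nat -> T -> 'cV[R]_D)
  (disp' : measure_display) (T' : measurableType disp') (P' : probability T' R)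
  (X' : T' -> 'cV[R]_D) :
  (forall n i, measurable_fun setT (fun w => X n w i 0)) ->
  (forall i, measurable_fun setT (fun w => X' w i 0)) ->
  (forall i e, 0 < e -> exists2 K : R, 0 < K &
     \forall n \near \oo, Ex P (fun w => capped (X n w i 0 / K)) <= e) ->
  (forall t c, Ex P (fun w => cos (dotp t (X n w) + c)) @[n --> \oo] -->
     Ex P' (fun w => cos (dotp t (X' w) + c))) ->
  cvg_in_distribution P X P' X'.
Proof.
move=> mX mX' tX cX f cf [M fM].
have M0 : 0 <= M by apply: le_trans (fM 0).
have iX n : intg P (fun w => f (X n w)) by exact: intg_continuous.
have iX' : intg P' (fun w => f (X' w)) by exact: intg_continuous.
have -> : (fun k => 'E_P[f \o X k])%E = EFin \o (fun k => Ex P (fun w => f (X k w))).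
  by apply/funext => k /=; rewrite -ExE.
have -> : ('E_P'[f \o X'] = (Ex P' (fun w => f (X' w)))%:E)%E by rewrite -ExE.
apply: cvg_EFin; first exact: nearW.
apply/cvgrPdist_le => e e0.
pose e1 := e / (8 * (M + 1) * (D%:R + 1)).
have D0 : 0 <= (D%:R : R) by [].
have e10 : 0 < e1 by rewrite divr_gt0// !mulr_gt0//; lra.
have e1E : 2 * M * (D%:R * e1) <= e / 4.
  have -> : e / 4 = 2 * (M + 1) * ((D%:R + 1) * e1) by rewrite /e1; field; apply/andP; split; lra.
  have h1 : D%:R * e1 <= (D%:R + 1) * e1 by rewrite ler_wpM2r ?ltW//; lra.
  have h2 : 0 <= D%:R * e1 by rewrite mulr_ge0// ltW.
  by apply: ler_pM => //; [rewrite mulr_ge0 | lra].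
have /choice [K HK] : forall i, exists K : R, 0 < K /\ ((\forall n \near \oo, Ex P (fun w => capped (X n w i 0 / K)) <= e1) /\ Ex P' (fun w => capped (X' w i 0 / K)) <= e1).
  move=> i; have [K1 K10 H1] := tX i e1 e10; have [K2 K20 H2] := tight1 P' (mX' i) e10.
  exists (K1 + K2); split; first by lra.
  have mono (x k : R) : 0 < k -> k <= K1 + K2 -> capped (x / (K1 + K2)) <= capped (x / k).
    move=> k0 kK; apply: capped_mono; rewrite !normrM ler_wpM2l//.
    have K0 : 0 < K1 + K2 by lra.
    by rewrite !gtr0_norm ?invr_gt0// lef_pV2 ?posrE.
  split.
    apply: filterS H1 => n; apply: le_trans; apply: Ex_le.
    - by apply: intg_capped; exact: measurable_funM.
    - by apply: intg_capped; exact: measurable_funM.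
    - by move=> w; apply: mono => //; lra.
  apply: le_trans H2; apply: Ex_le.
  - by apply: intg_capped; exact: measurable_funM.
  - by apply: intg_capped; exact: measurable_funM.
  - by move=> w; apply: mono => //; lra.
pose L := 1 + \sum_i K i.
have K0 i : 0 < K i by have [] := HK i.
have KL i : K i <= L.
  rewrite /L (bigD1 i)//= addrCA lerDl addr_ge0// sumr_ge0// => j _; exact: ltW.
have L0 : 0 < L by rewrite ltr_wpDr// sumr_ge0// => j _; exact: ltW.
have e40 : 0 < e / 8 by rewrite divr_gt0.
have [p [[s ps] pM pf]] := trig_approx cf fM L0 e40.
have pE : p = (fun x => \sum_(q <- s) q.1.1 * cos (dotp q.1.2 x + q.2)) by apply/funext.
have ip n := Ex_trigpoly P s (mX n); have ip' := Ex_trigpoly P' s mX'.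
have ipX n : intg P (fun w => p (X n w)) by rewrite pE; exact: (ip n).1.
have ipX' : intg P' (fun w => p (X' w)) by rewrite pE; exact: ip'.1.
have cp : Ex P (fun w => p (X n w)) @[n --> \oo] --> Ex P' (fun w => p (X' w)).
  rewrite pE ip'.2; under eq_fun do rewrite (ip _).2.
  by apply: cvg_sumr => q; apply: cvgMr; exact: cX.
have capL (d0 : measure_display) (T0 : measurableType d0) (P0 : probability T0 R) (F : T0 -> R) i :
    measurable_fun setT F -> Ex P0 (fun w => capped (F w / K i)) <= e1 -> Ex P0 (fun w => capped (F w / L)) <= e1.
  move=> mF; apply: le_trans; apply: Ex_le; try (by apply: intg_capped; exact: measurable_funM).
  move=> w; apply: capped_mono; rewrite !normrM ler_wpM2l//.
  by rewrite !gtr0_norm ?invr_gt0// lef_pV2 ?posrE.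
have sumL (d0 : measure_display) (T0 : measurableType d0) (P0 : probability T0 R) (F : T0 -> 'cV[R]_D) :
    (forall i, Ex P0 (fun w => capped (F w i 0 / L)) <= e1) ->
    2 * M * \sum_i Ex P0 (fun w => capped (F w i 0 / L)) <= e / 4.
  move=> H; apply: le_trans e1E; rewrite ler_wpM2l ?mulr_ge0//.
  apply: (le_trans (ler_sum _ (fun i _ => H i))).
  by rewrite sumr_const card_ord -[leLHS]mulr_natl.
have B' : `|Ex P' (fun w => p (X' w)) - Ex P' (fun w => f (X' w))| <= e / 8 + e / 4.
  apply: (le_trans (Ex_approx_cube L0 (ltW e40) mX' iX' ipX' fM pM pf)); rewrite lerD2l.
  by apply: sumL => i; apply: capL => //; exact: (HK i).2.2.
have all_near : \forall n \near \oo, forall i, Ex P (fun w => capped (X n w i 0 / K i)) <= e1.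
  by apply: filter_forall => i; exact: (HK i).2.1.
move/cvgrPdist_le : cp => /(_ _ e40) cp.
near=> n.
have hK : forall i, Ex P (fun w => capped (X n w i 0 / K i)) <= e1 by near: n.
have B : `|Ex P (fun w => p (X n w)) - Ex P (fun w => f (X n w))| <= e / 8 + e / 4.
  apply: (le_trans (Ex_approx_cube L0 (ltW e40) (mX n) (iX n) (ipX n) fM pM pf)); rewrite lerD2l.
  by apply: sumL => i; apply: (capL _ _ _ _ i) => //; exact: hK.
have C : `|Ex P' (fun w => p (X' w)) - Ex P (fun w => p (X n w))| <= e / 8 by near: n.
rewrite /=; move: B B' C; rewrite !ler_norml => /andP[? ?] /andP[? ?] /andP[? ?].
by apply/andP; split; lra.
Unshelve. all: by end_near.
Qed.

End levy.

(** * The Gaussian cosine transform *)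

Section gaussian.
Variable R : realType.
Notation mu := (@lebesgue_measure R).
Notation ph := (normal_pdf (0 : R) 1).
Implicit Types (x v c : R) (g : R -> R).

Lemma normal01E x : ph x = normal_peak 1 * expR (- (x ^+ 2 / 2)).
Proof.
rewrite normal_pdfE ?oner_eq0// /normal_fun subr0 expr1n; congr (_ * expR _).
by rewrite mulNr.
Qed.

Lemma is_derive_normal01 x : is_derive x 1 ph (- x * ph x).
Proof.
have -> : ph = fun y => normal_peak 1 * expR (- (y ^+ 2 / 2)).
  by apply/funext => y; exact: normal01E.
apply: is_derive_eq.
by rewrite /GRing.scale /=; field.
Qed.

Lemma integrable_normal01 : mu.-integrable setT (EFin \o ph).
Proof. exact: integrable_normal_pdf. Qed.

Lemma integrable_mul_normal01 g : measurable_fun setT g -> (forall x, `|g x| <= 1) ->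
  mu.-integrable setT (EFin \o (fun x => g x * ph x)).
Proof.
move=> mg g1; apply: le_integrable integrable_normal01 => //.
  by apply/measurable_EFinP/measurable_funM => //; exact: measurable_normal_pdf.
move=> x _ /=; rewrite lee_fin normrM ler_piMl//.
Qed.

(** The polynomial factor is absorbed by a wider Gaussian density, whose
    integrability is known. *)
Lemma norm_mul_normal01_le : exists C, forall x, `|x| * ph x <= C * normal_pdf 0 2 x.
Proof.
exists (2 * normal_peak 1 / normal_peak 2) => x.
have p2 : normal_peak (2 : R) != 0 by rewrite gt_eqF// normal_peak_gt0// pnatr_eq0.
have -> : normal_pdf 0 2 x = normal_peak 2 * expR (- (x ^+ 2 / 8)).
  rewrite normal_pdfE ?pnatr_eq0// /normal_fun subr0; congr (_ * expR _).
  by rewrite mulNr -mulr_natr -natrX -natrM.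
rewrite [leRHS]mulrA divfK// normal01E mulrCA (mulrC 2) -[leRHS]mulrA.
rewrite ler_wpM2l ?normal_peak_ge0//.
have -> : - (x ^+ 2 / 2) = - (x ^+ 2 / 8) + - (3 * x ^+ 2 / 8) by field.
rewrite expRD mulrCA [leRHS]mulrC ler_wpM2l ?expR_ge0// expRN ler_pdivrMr ?expR_gt0//.
have := expR_ge1Dx (3 * x ^+ 2 / 8).
have : `|x| ^+ 2 = x ^+ 2 by rewrite real_normK ?num_real.
have := normr_ge0 x; move: (expR _) (`|x|) => E a a0 ax h.
nra.
Qed.

Lemma integrable_norm_normal01 : mu.-integrable setT (EFin \o (fun x => `|x| * ph x)).
Proof.
have [C hC] := norm_mul_normal01_le.
have := @integrableZl _ _ R mu _ measurableT C _ (integrable_normal_pdf 0 2).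
apply: le_integrable => //.
  apply/measurable_EFinP/measurable_funM; last exact: measurable_normal_pdf.
  by apply: continuous_measurable_fun; exact: norm_continuous.
move=> x _ /=; rewrite lee_fin ger0_norm ?mulr_ge0 ?normal_pdf_ge0//.
exact: le_trans (hC x) (ler_norm _).
Qed.

Lemma measurable_affine v c : measurable_fun setT (fun x : R => v * x + c).
Proof. by apply: measurable_funD => //; exact: measurable_funM. Qed.

Lemma measurable_sin_affine v c : measurable_fun setT (fun x : R => sin (v * x + c)).
Proof. by apply: measurableT_comp; [exact: measurable_sin|exact: measurable_affine]. Qed.

Lemma measurable_cos_affine v c : measurable_fun setT (fun x : R => cos (v * x + c)).
Proof. by apply: measurableT_comp; [exact: measurable_cos|exact: measurable_affine]. Qed.

Let f v c x := v * (cos (v * x + c) * ph x) - x * sin (v * x + c) * ph x.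

Lemma integrable_stein v c : mu.-integrable setT (EFin \o (fun x => x * sin (v * x + c) * ph x)).
Proof.
apply: le_integrable integrable_norm_normal01 => //.
  apply/measurable_EFinP/measurable_funM; last exact: measurable_normal_pdf.
  by apply: measurable_funM => //; exact: measurable_sin_affine.
move=> x _ /=; rewrite lee_fin !normrM normr_id ler_wpM2r// ler_piMr// sin_max//.
Qed.

Let integrable_f v c : mu.-integrable setT (EFin \o f v c).
Proof.
have ic : mu.-integrable setT (EFin \o (fun x => v * (cos (v * x + c) * ph x))).
  apply: (@integrableZl _ _ R mu _ measurableT v (EFin \o (fun x => cos (v * x + c) * ph x))).
  apply: integrable_mul_normal01; first exact: measurable_cos_affine.
  by move=> x; exact: cos_max.
have := integrableB measurableT ic (integrable_stein v c).
by apply: eq_integrable.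
Qed.

Let is_derive_f v c x : is_derive x 1 (fun y => sin (v * y + c) * ph y) (f v c x).
Proof.
have := is_derive_normal01 x => h.
apply: is_derive_eq.
by rewrite /f /GRing.scale /=; ring.
Qed.

Let continuous_f v c : continuous (f v c).
Proof.
move=> x; apply: differentiable_continuous; apply/derivable1_diffP.
have := is_derive_normal01 x => h.
by apply: ex_derive.
Qed.

Let itv_f v c (n : nat) : \int[mu]_(x in `[- n.+1%:R, n.+1%:R]) f v c x =
  sin (v * n.+1%:R + c) * ph n.+1%:R - sin (v * - n.+1%:R + c) * ph (- n.+1%:R).
Proof.
rewrite /Rintegral (@continuous_FTC2 _ _ (fun y => sin (v * y + c) * ph y)) //.
- by rewrite -subr_gt0 opprK -natrD ltr0n.
- exact: continuous_subspaceT.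
- have cF : continuous (fun y => sin (v * y + c) * ph y).
    move=> x; apply: differentiable_continuous; apply/derivable1_diffP.
    by apply: ex_derive.
  split.
  + by move=> x _; exact: ex_derive.
  + apply: cvg_at_right_filter; exact: cF.
  + apply: cvg_at_left_filter; exact: cF.
- by move=> x _; rewrite derive1E; apply: derive_val.
Qed.

Lemma normal01_le_inv n : ph n.+1%:R <= normal_peak 1 * 2 * (n.+1%:R)^-1.
Proof.
rewrite normal01E -mulrA ler_wpM2l ?normal_peak_ge0//.
rewrite expRN -[X in _ <= X]invrK lef_pV2 ?posrE ?expR_gt0// ?invr_gt0 ?mulr_gt0 ?invr_gt0//.
apply: le_trans (expR_ge1Dx _); rewrite invfM invrK.
have : 1 <= n.+1%:R :> R by rewrite ler1n.
by move: n.+1%:R => a a1; nra.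
Qed.

(** Integration by parts over [-n, n] with n to infinity (Stein's identity). *)
Lemma stein_normal01 v c :
  \int[mu]_x (x * sin (v * x + c) * ph x) = v * \int[mu]_x (cos (v * x + c) * ph x).
Proof.
have icos : mu.-integrable setT (EFin \o (fun x => cos (v * x + c) * ph x)).
  apply: integrable_mul_normal01; first exact: measurable_cos_affine.
  by move=> x; exact: cos_max.
suff : \int[mu]_x f v c x = 0.
  rewrite /f RintegralB//; last exact: integrable_stein.
    by rewrite RintegralZl// => /eqP; rewrite subr_eq0 => /eqP ->.
  exact: (@integrableZl _ _ R mu _ measurableT v (EFin \o (fun x => cos (v * x + c) * ph x))).
have mf : measurable_fun setT (f v c).
  by have /integrableP[/measurable_EFinP] := integrable_f v c.
pose fn (n : nat) := f v c \_ (`[- n.+1%:R, n.+1%:R] : set R).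
have mfn n : measurable_fun setT (EFin \o fn n).
  apply/measurable_EFinP/measurable_restrict => //.
  exact: measurable_funS mf.
have fnf : {ae mu, forall x, [set: R] x -> (EFin \o fn n) x @[n --> \oo] --> (EFin \o f v c) x}.
  apply: aeW => x _.
  apply: cvg_near_cst; near=> n; congr EFin; rewrite /fn patchT// inE /= in_itv /=.
  rewrite -ler_norml (@le_trans _ _ n%:R) ?ler_nat//.
  by near: n; exact: nbhs_infty_ger.
have fnb : {ae mu, forall x n, [set: R] x -> (`|(EFin \o fn n) x| <= (EFin \o (fun x => `|f v c x|)%R) x)%E}.
  apply: aeW => x n _; rewrite /= lee_fin /fn /patch; case: ifP => // _.
  by rewrite normr0.
have [_ _ H0] := dominated_convergence (mu := mu) measurableT mfn
  (proj2 (measurable_EFinP _ _) mf) fnf (integrable_norm (integrable_f v c)) fnb.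
have H : fine (\int[mu]_x (EFin \o fn n) x)%E @[n --> \oo] --> fine (\int[mu]_x (EFin \o f v c) x)%E.
  by apply: fine_cvg; rewrite fineK//; apply: integrable_fin_num => //; exact: integrable_f.
rewrite /Rintegral -(cvg_lim (@norm_hausdorff _ _) H); apply/cvg_lim => //.
apply/cvgr0Pnorm_le => e e0.
have cC : (normal_peak 1 * 4) * harmonic n @[n --> \oo] --> (normal_peak 1 * 4) * (0 : R).
  by apply: cvgMr; exact: cvg_harmonic.
rewrite mulr0 in cC; move/cvgr0Pnorm_le/(_ _ e0) : cC; apply: filterS => n hn.
have -> : fine (\int[mu]_x (EFin \o fn n) x)%E = \int[mu]_(x in `[- n.+1%:R, n.+1%:R]) f v c x.
  by rewrite Rintegral_mkcond.
rewrite itv_f (le_trans (ler_normB _ _))// (le_trans _ hn)//.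
have pN : ph (- n.+1%:R) = ph n.+1%:R by rewrite !normal01E sqrrN.
have b y : `|sin y * ph n.+1%:R| <= normal_peak 1 * 2 * (n.+1%:R)^-1.
  rewrite normrM (le_trans _ (normal01_le_inv n))// (ger0_norm (normal_pdf_ge0 _ _ _)).
  by rewrite ler_piMl ?normal_pdf_ge0// sin_max.
rewrite pN (le_trans (lerD (b _) (b _)))// /harmonic ger0_norm ?mulr_ge0 ?normal_peak_ge0//.
  by rewrite /= le_eqVlt; apply/orP; left; apply/eqP; field.
by rewrite /= invr_ge0.
Unshelve. all: end_near. Qed.

(** Differentiation under the integral produces the integral of
    [- x * sin (v * x + c)], which Stein's identity turns back into the cosine. *)
Lemma is_derive_normal_cf c v :
  is_derive v 1 (fun v => \int[mu]_x (cos (v * x + c) * ph x))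
    (- v * \int[mu]_x (cos (v * x + c) * ph x)).
Proof.
pose g v x := cos (v * x + c) * ph x.
have dg (w x : R) : is_derive w 1 (g ^~ x) (- (x * sin (w * x + c) * ph x)).
  by apply: is_derive_eq; rewrite /GRing.scale /=; ring.
have Iv : v \in `]v - 1, v + 1[.
  by rewrite in_itv /= ltrBlDr ltrDl ltr01.
have ig w : mu.-integrable setT (EFin \o g w).
  apply: integrable_mul_normal01; first exact: measurable_cos_affine.
  by move=> x; exact: cos_max.
have bd w x : `|partial1of2 g w x| <= `|x| * ph x.
  rewrite partial1of2E derive_val normrN !normrM.
  rewrite (ger0_norm (normal_pdf_ge0 _ _ _)) ler_wpM2r ?normal_pdf_ge0// ler_piMr// sin_max//.
have ig0 x : 0 <= `|x| * ph x by rewrite mulr_ge0 ?normal_pdf_ge0.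
have e : \int[mu]_x (partial1of2 g) v x = - v * \int[mu]_x g v x.
  rewrite mulNr -stein_normal01 -mulN1r -RintegralZl//; last exact: integrable_stein.
  by apply: eq_Rintegral => x _; rewrite partial1of2E derive_val mulN1r.
rewrite -e; apply: DeriveDef.
  exact: (@derivable_under_integral _ _ _ mu g setT measurableT v _ _ Iv
   (fun w _ => ig w) (fun w x _ _ => @ex_derive _ _ _ _ _ _ _ (dg w x)) _ ig0 integrable_norm_normal01
   (fun w x _ _ => bd w x)).
rewrite -derive1E.
exact: (@differentiation_under_integral _ _ _ mu g setT measurableT v _ _ Iv
   (fun w _ => ig w) (fun w x _ _ => @ex_derive _ _ _ _ _ _ _ (dg w x)) _ ig0 integrable_norm_normal01
   (fun w x _ _ => bd w x)).
Qed.

(** By [is_derive_normal_cf] the product with [expR (v ^+ 2 / 2)] has derivative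
    zero in [v], and at [v = 0] the integral is [cos c]. *)
Lemma normal_cf v c : \int[mu]_x (cos (v * x + c) * ph x) = expR (- (v ^+ 2 / 2)) * cos c.
Proof.
pose F v := \int[mu]_x (cos (v * x + c) * ph x).
have H (w : R) : is_derive w 1 (fun w => expR (w ^+ 2 / 2) * F w) 0.
  have h := is_derive_normal_cf c w; apply: is_derive_eq.
  by rewrite /GRing.scale /= /F; field.
have := is_derive_0_is_cst v 0 H.
rewrite expr0n /= mul0r expR0 mul1r expRN => e.
apply: (mulfI (lt0r_neq0 (expR_gt0 (v ^+ 2 / 2)))); rewrite e mulrA mulfV ?gt_eqF ?expR_gt0// mul1r /F.
under eq_Rintegral do rewrite mul0r add0r.
rewrite RintegralZl//; last exact: integrable_normal01.
by rewrite /Rintegral integral_normal_pdf mulr1.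
Qed.

(** The density of the Gaussian law is its Radon-Nikodym derivative. *)
Lemma integral_normal01 g : measurable_fun setT g -> (forall x, `|g x| <= 1) ->
  (\int[normal_prob 0 1]_x (g x)%:E = \int[mu]_x (g x * ph x)%:E)%E.
Proof.
move=> mg g1.
have ig : (normal_prob 0 1).-integrable setT (EFin \o g).
  apply: measurable_bounded_integrable => //.
    by rewrite (le_lt_trans (probability_le1 _ _)) ?ltry.
  by exists 1; split => // K K1 w _ /=; rewrite (le_trans (g1 w)) ?ltW.
rewrite -(Radon_Nikodym_change_of_variables (normal_prob_dominates 0 1))//=.
under [RHS]eq_integral do rewrite EFinM.
apply: ae_eq_integral => //.
- apply: emeasurable_funM => //; first exact/measurable_EFinP.
  apply: (measurable_int mu).
  by apply: Radon_Nikodym_integrable; exact: normal_prob_dominates.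
- apply: emeasurable_funM => //=; first exact/measurable_EFinP.
  by apply/measurable_EFinP; exact: measurable_normal_pdf.
- apply: ae_eqe_mul2l => /=.
  rewrite Radon_NikodymE//=; first exact: normal_prob_dominates.
  move=> abmu.
  case: cid => /= h [h1 h2 h3].
  apply: integral_ae_eq => //=.
  + by apply/measurable_EFinP; exact: measurable_normal_pdf.
  + by move=> E E01 mE; rewrite -h3.
Qed.

End gaussian.

Section gaussian_vector.
Context {disp : measure_display} {T : measurableType disp} {R : realType}
  (P : probability T R).

Lemma Ex_cos_normal (X : {RV P >-> R}) v c :
  (forall A : set R, measurable A -> distribution P X A = normal_prob 0 1 A) ->
  Ex P (fun w => cos (v * X w + c)) = expR (- (v ^+ 2 / 2)) * cos c.
Proof.
move=> hX; rewrite -normal_cf.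
have mg : measurable_fun setT (fun x : R => cos (v * x + c)) by exact: measurable_cos_affine.
have g1 (x : R) : `|cos (v * x + c)| <= 1 by exact: cos_max.
have ig : intg P (fun w => cos (v * X w + c)).
  by apply: (@intg_bd _ _ _ _ _ 1) => // ; apply: (measurableT_comp mg).
apply: EFin_inj; rewrite -integral_Ex//.
(* the law of [X] is taken on the same copy of the Borel sets as [normal_prob] *)
have mX : measurable_fun setT (X : T -> measurableTypeR R) by exact: measurable_funP X.
pose X' : {RV P >-> measurableTypeR R} := HB.pack (X : T -> measurableTypeR R)
  (isMeasurableFun.Build _ _ _ _ (X : T -> measurableTypeR R) mX).
transitivity (\int[distribution P X']_y (cos (v * y + c))%:E)%E.
  by rewrite integral_distribution//; exact/measurable_EFinP.
transitivity (\int[normal_prob 0 1]_y (cos (v * y + c))%:E)%E.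
  by apply: eq_measure_integral => A mA _; exact: hX.
rewrite integral_normal01// /Rintegral fineK//.
by apply: integrable_fin_num => //; apply: integrable_mul_normal01.
Qed.

(** By the addition formula and independence, one coordinate at a time: the
    expectation of its sine vanishes, being the transform at phase [- pi / 2]. *)
Lemma Ex_cos_normal_vector n (N : 'I_n -> {RV P >-> R}) (v : 'I_n -> R) c :
  std_normal_vector N ->
  Ex P (fun w => cos (\sum_i v i * N i w + c)) = expR (- ((\sum_i v i ^+ 2) / 2)) * cos c.
Proof.
move=> [indN lawN].
suff H (s : seq 'I_n) : uniq s -> forall c,
    Ex P (fun w => cos (\sum_(i <- s) v i * N i w + c)) = expR (- ((\sum_(i <- s) v i ^+ 2) / 2)) * cos c.
  by apply: H; exact: index_enum_uniq.
elim: s => [_ {}c|i s IH /= /andP[si us] {}c].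
  under [in LHS]eq_fun do rewrite big_nil add0r.
  by rewrite Ex_cst big_nil mul0r oppr0 expR0 mul1r.
(* the coordinates in [s] are independent of the coordinate [i] *)
pose S w := \sum_(k <- s) v k * N k w.
have aS : adapted N [set k | k \in s] S.
  apply: adapted_sum => k ks; apply: adaptedM; [exact: adapted_cst|exact: adapted_X].
have disj : [set i] `&` [set k | k \in s] = set0.
  by apply/seteqP; split => // x [->] /=; rewrite (negbTE si).
have tri (f : R -> R) F J : measurable_fun setT f -> (forall x, `|f x| <= 1) -> adapted N J F ->
    adapted N J (fun w => f (F w)) /\ intg P (fun w => f (F w)).
  move=> mf f1 aF; have af := adapted_fun mf aF; split => //.
  by apply: (@intg_bd _ _ _ _ _ 1) => //; exact: adapted_meas af.
have aN : adapted N [set i] (fun w => v i * N i w).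
  by apply: adaptedM; [exact: adapted_cst|exact: adapted_X].
have Ei := Ex_cos_normal (v i) _ (lawN i).
have [ac ic] := tri _ _ _ (@measurable_cos R) (@cos_max R) aN.
have [as_ is_] := tri _ _ _ (@measurable_sin R) (@sin_max R) aN.
have mA (h : R -> R) : measurable_fun setT h -> measurable_fun setT (fun x : R => h (x + c)).
  by move=> mh; apply: measurableT_comp mh _; exact: measurable_funD.
have [aC iC] := tri (fun x : R => cos (x + c)) _ _ (mA _ (@measurable_cos R)) (fun x => cos_max (x + c)) aS.
have [aD iD] := tri (fun x : R => sin (x + c)) _ _ (mA _ (@measurable_sin R)) (fun x => sin_max (x + c)) aS.
have [i1 e1] := Ex_indep indN disj ac aC ic iC.
have [i2 e2] := Ex_indep indN disj as_ aD is_ iD.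
have -> : (fun w => cos (\sum_(k <- i :: s) v k * N k w + c)) =
    (fun w => cos (v i * N i w) * cos (S w + c) - sin (v i * N i w) * sin (S w + c)).
  by apply/funext => w; rewrite big_cons -addrA cosD.
have es : Ex P (fun w => sin (v i * N i w)) = 0.
  rewrite (_ : (fun w => _) = (fun w => cos (v i * N i w + - (pi / 2)))).
    by rewrite Ei cosN cos_pihalf mulr0.
  by apply/funext => w; rewrite cosBpihalf.
have ec : Ex P (fun w => cos (v i * N i w)) = expR (- (v i ^+ 2 / 2)).
  by rewrite -[RHS]mulr1 -[X in _ * X](@cos0 R) -Ei; congr Ex; apply/funext => w; rewrite addr0.
rewrite ExB// e1 e2 es mul0r subr0 ec IH// big_cons mulrA -expRD; congr (expR _ * _).
by ring.
Qed.

End gaussian_vector.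

(** * Geometric decay of the powers of the inverse companion matrix *)

Section decay.
Variable R : realType.
Implicit Types (a b : nat -> R).

Definition geometric_decay a : Prop :=
  exists C r, [/\ 0 <= r, r < 1 & forall k, a k <= C * r ^+ k].

Lemma decay_le a b : (forall k, a k <= b k) -> geometric_decay b -> geometric_decay a.
Proof.
move=> ab [C [r [r0 r1 h]]]; exists C, r; split => // k; exact: le_trans (ab k) (h k).
Qed.

(** Convolving two geometric sequences of ratio less than 1 gives one of any
    larger ratio. *)
Lemma decay_recursion m a b : 0 <= m < 1 -> (forall k, 0 <= a k) ->
  (forall k, a k.+1 <= m * a k + b k) -> geometric_decay b -> geometric_decay a.
Proof.
move=> /andP[m0 m1] a0 ab [C0 [r [r0 r1 h]]].
pose C := `|C0|.
have {}h k : b k <= C * r ^+ k.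
  by rewrite (le_trans (h k))// ler_wpM2r ?exprn_ge0// ler_norm.
have C_0 : 0 <= C by exact: normr_ge0.
(* any rate strictly between max(m, r) and 1 works *)
pose q := (2 - (1 - m) * (1 - r)) / 2.
have qm : m < q by rewrite /q; nra.
have qr : r <= q by rewrite /q; nra.
have q1 : q < 1 by rewrite /q; nra.
have q0 : 0 <= q by exact: le_trans r0 qr.
pose D := a 0%N + C / (q - m).
have qm0 : 0 < q - m by rewrite subr_gt0.
have D0 : a 0%N <= D by rewrite lerDl divr_ge0// ltW.
exists D, q; split => // k; elim: k => [|k IH]; first by rewrite expr0 mulr1.
rewrite (le_trans (ab k))// exprS.
have h2 : b k <= C * q ^+ k by rewrite (le_trans (h k))// ler_wpM2l// lerXn2r ?nnegrE.
have h3' : m * a k <= m * (D * q ^+ k) by rewrite ler_wpM2l.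
rewrite (le_trans (lerD h3' h2))// 2!mulrA -mulrDl ler_wpM2r ?exprn_ge0//.
have : C <= (q - m) * D.
  by rewrite mulrDr [X in _ + X]mulrC divfK ?gt_eqF// lerDr mulr_ge0// ltW.
by rewrite mulrBl lerBrDl [D * q]mulrC.
Qed.

Lemma decay0 : geometric_decay (fun=> 0).
Proof. by exists 0, 0; split => // k; rewrite mul0r. Qed.

End decay.

Section matrix_decay.
Variables (R : realType) (d : nat).
Import ComplexField.Normc.
Local Notation toC := (real_complex R).
Implicit Types (A X : 'M[R[i]]_d.+1).

Lemma normc_ge0 (z : R[i]) : 0 <= normc z.
Proof. by case: z => a b; exact: sqrtr_ge0. Qed.

Lemma normc_triangle (x y : R[i]) : normc (x + y) <= normc x + normc y.
Proof. exact: (le_normcD (x : Rcomplex R) y). Qed.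

(** Linear factors are removed one at a time: the entries [a k] of [A ^+ k *m X]
    satisfy [a k.+1 = z * a k + b k], where [b k] is an entry of
    [A ^+ k *m ((A - z) *m X)], which is annihilated by one factor less. *)
Lemma mulmx_decay A X (s : seq R[i]) : (forall z, z \in s -> normc z < 1) ->
  horner_mx A (\prod_(z <- s) ('X - z%:P)) *m X = 0 ->
  forall i j, geometric_decay (fun k => normc ((A ^+ k *m X) i j)).
Proof.
elim: s X => [|z s IH] X sz.
  rewrite big_nil rmorph1 mul1mx => -> i j; apply: decay_le (decay0 R) => k.
  by rewrite mulmx0 mxE normc0.
rewrite big_cons mulrC rmorphM /= -mulmxA => /IH {}IH i j.
have zs1 : forall z, z \in s -> normc z < 1 by move=> y ys; apply: sz; rewrite inE ys orbT.
apply: (@decay_recursion _ (normc z) _ _ _ _ _ (IH zs1 i j)).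
- by rewrite normc_ge0 sz// mem_head.
- by move=> k; exact: normc_ge0.
- move=> k; rewrite -normcM (le_trans _ (normc_triangle _ _))// le_eqVlt; apply/orP; left.
  apply/eqP; congr normc.
  rewrite rmorphB /= horner_mx_X horner_mx_C mulmxBl mulmxBr mul_scalar_mx -scalemxAr.
  rewrite mulmxA -[A ^+ k *m A]/(A ^+ k * A) -exprSr.
  by rewrite [X in _ = _ + X]mxE [X in _ = _ + (_ + X)]mxE [X in _ = _ + (_ - X)]mxE addrC subrK.
Qed.

(** By the Cayley-Hamilton theorem the product of the linear factors of the
    characteristic polynomial annihilates the identity matrix. *)
Lemma expmx_decay (A : 'M[R]_d.+1) :
  (forall z : R[i], eigenvalue (map_mx toC A) z -> `|z| < 1) ->
  forall i j, geometric_decay (fun k => `|(A ^+ k) i j|).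
Proof.
move=> evA i j; pose AC := map_mx toC A.
have [s hs] := closed_field_poly_normal (char_poly AC).
have lc1 : lead_coef (char_poly AC) = 1 by apply/eqP; have := char_poly_monic AC; rewrite monicE.
rewrite lc1 scale1r in hs.
have := @mulmx_decay AC 1%:M s _ _ i j.
have zs z : z \in s -> normc z < 1.
  move=> zs; rewrite -ltcR; apply: evA; rewrite eigenvalue_root_char -/AC hs.
  by rewrite root_prod_XsubC.
move=> /(_ zs); rewrite -hs Cayley_Hamilton mul0mx => /(_ erefl).
apply: decay_le => k; rewrite mulmx1 /AC -(rmorphXn (map_mx toC)) mxE /=.
by rewrite expr0n /= addr0 sqrtr_sqr.
Qed.

Lemma decay_uniform (I : finType) (a : I -> nat -> R) :
  (forall i, geometric_decay (a i)) -> exists C r, [/\ 0 < C, 0 < r, r < 1 & forall i k, a i k <= C * r ^+ k].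
Proof.
move=> /choice [C /choice [r h]].
exists (1 + \sum_i `|C i|), (\big[Num.max/2^-1]_i r i); split.
- by rewrite ltr_pwDl// sumr_ge0.
- by apply: lt_le_trans (bigmax_ge_id _ _ _ _); rewrite invr_gt0.
- apply: bigmax_lt => [|i _]; first by rewrite invf_lt1// ltr1n.
  by have [] := h i.
- move=> i k; have [r0 r1 hk] := h i; rewrite (le_trans (hk k))//.
  have Ci : C i <= 1 + \sum_i `|C i|.
    rewrite (le_trans (ler_norm _))// (bigD1 i)//= addrCA lerDl addr_ge0// sumr_ge0//.
  rewrite (@le_trans _ _ ((1 + \sum_i `|C i|) * r i ^+ k))//.
    by rewrite ler_wpM2r ?exprn_ge0.
  rewrite ler_wpM2l ?addr_ge0 ?sumr_ge0// lerXn2r ?nnegrE//.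
    by rewrite (le_trans r0)// le_bigmax.
  exact: le_bigmax.
Qed.

End matrix_decay.

Section companion_inverse.
Variables (R : realType) (d : nat) (theta : 'cV[R]_d.+1).
Hypothesis theta_pe : theta \in @Theta_pe R d.
Local Notation B := (companion theta).
Local Notation toC := (real_complex R).

Lemma companion_unit : B \in unitmx.
Proof.
rewrite -row_free_unit -kermx_eq0; apply/negPn/negP => k0.
have : eigenvalue (map_mx toC B) 0.
  rewrite /eigenvalue /eigenspace raddf0 subr0 -map_kermx.
  by rewrite map_mx_eq0.
by move/(set_mem theta_pe _); rewrite normr0 ltr10.
Qed.

Lemma theta_last_neq0 : theta ord_max 0 != 0.
Proof.
apply/eqP => t0; have := companion_unit; rewrite unitmxE unitfE => /eqP; apply.
rewrite -det_tr; apply/eqP/det0P; exists (delta_mx 0 ord_max).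
  by apply/eqP => /rowP /(_ ord_max); rewrite !mxE !eqxx => /eqP; rewrite oner_eq0.
apply/rowP => i; rewrite -rowE !mxE; case: ifP => // _.
by rewrite (gtn_eqF (ltn_ord i)).
Qed.

(** The eigenvalues of the inverse are the inverses of the eigenvalues, hence
    inside the unit disc. *)
Lemma inv_companion_decay : exists C r, [/\ 0 < C, 0 < r, r < 1 &
  forall k i j, `|(invmx B ^+ k) i j| <= C * r ^+ k].
Proof.
have ev (z : R[i]) : eigenvalue (map_mx toC (invmx B)) z -> `|z| < 1.
  move=> /eigenvalueP[v vz v0].
  have zv : z *: (v *m map_mx toC B) = v.
    by rewrite scalemxAl -vz -mulmxA -map_mxM mulVmx ?companion_unit// map_mx1 mulmx1.
  have z0 : z != 0 by apply: contraNneq v0 => z0; rewrite -zv z0 scale0r.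
  have : eigenvalue (map_mx toC B) z^-1.
    apply/eigenvalueP; exists v => //.
    by rewrite -[in RHS]zv scalerA mulVf// scale1r.
  move/(set_mem theta_pe _); rewrite normfV invf_gt1//.
  by rewrite normr_gt0.
have [C [r [C0 r0 r1 h]]] := @decay_uniform R _ (fun (p : 'I_d.+1 * 'I_d.+1) k => `|(invmx B ^+ k) p.1 p.2|)
  (fun p => expmx_decay ev p.1 p.2).
by exists C, r; split => // k i j; exact: (h (i, j) k).
Qed.

End companion_inverse.

(** * Square roots of positive definite matrices *)

Section square_root.
Variables (R : realType) (d : nat).
Local Notation toC := (real_complex R).
Implicit Types (G S : 'M[R]_d.+1).

Lemma quad_sym_norm n (v : 'rV[R]_n) : v != 0 -> 0 < (v *m v^T) 0 0.
Proof.
move=> v0; rewrite mxE lt_neqAle sumr_ge0 => [|i _]; last by rewrite mxE -expr2 sqr_ge0.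
rewrite andbT eq_sym psumr_neq0 => [|i _]; last by rewrite mxE -expr2 sqr_ge0.
move: v0 => /rV0Pn[i vi]; apply/hasP; exists i; first by rewrite mem_index_enum.
by rewrite /= mxE -expr2 exprn_even_gt0.
Qed.

Lemma posdef_eigenvalue_gt0 G a : posdef G -> eigenvalue G a -> 0 < a.
Proof.
move=> [Gs Gp] /eigenvalueP[v vG v0].
have vT0 : v^T != 0 by apply: contraNneq v0 => /(congr1 trmx); rewrite trmxK trmx0 => ->.
have := Gp _ vT0; rewrite trmxK vG -scalemxAl mxE pmulr_lgt0//.
exact: quad_sym_norm.
Qed.

Lemma interpolation (s : seq R) (f : R -> R) : exists p : {poly R}, forall x, x \in s -> p.[x] = f x.
Proof.
elim: s => [|y s [p hp]]; first by exists 0.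
have [ys|ys] := boolP (y \in s).
  by exists p => x; rewrite inE => /predU1P[->|]; exact: hp.
pose q := \prod_(z <- s) ('X - z%:P).
have q0 : q.[y] != 0 by rewrite -/(root q y) root_prod_XsubC.
exists (p + ((f y - p.[y]) / q.[y]) *: q) => x; rewrite inE !hornerE.
have [->|_] /= := eqVneq x y; first by move=> _; rewrite divfK// addrC subrK.
move=> xs; have : root q x by rewrite root_prod_XsubC.
by move/rootP => ->; rewrite mulr0 addr0 hp.
Qed.

Lemma horner_mx_intertwine (K : fieldType) (A D P : 'M[K]_d.+1) p :
  P *m A = D *m P -> P *m horner_mx A p = horner_mx D p *m P.
Proof.
move=> PA; elim/poly_ind: p => [|p c IH]; first by rewrite !rmorph0 mulmx0 mul0mx.
rewrite !rmorphD !rmorphM /= !horner_mx_X !horner_mx_C mulmxDr mulmxDl scalar_mxC.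
by congr (_ + _); rewrite -!mulmxE mulmxA IH -!mulmxA PA.
Qed.

Lemma eigenvalue_real G l : eigenvalue (map_mx toC G) (toC l) = eigenvalue G l.
Proof. by rewrite !eigenvalue_root_char -map_char_poly fmorph_root. Qed.

(** Over the complex numbers [G] is unitarily diagonalisable with real
    eigenvalues, so a polynomial vanishing at all of them vanishes at [G]. *)
Lemma posdef_calculus G (p : {poly R}) : posdef G ->
  (forall a, eigenvalue G a -> p.[a] = 0) -> horner_mx G p = 0.
Proof.
move=> Gp pa; pose GC := map_mx toC G.
have Gs i j : G j i = G i j by rewrite -[in LHS]Gp.1 mxE.
have Gh : GC \is hermsymmx.
  apply/is_hermitianmxP; rewrite expr0 scale1r /GC.
  have cr (x : R) : (toC x)^* = toC x.
    by apply: conj_Creal; apply/complex_realP; exists x.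
  by apply/matrixP => i j; rewrite !mxE cr Gs.
have /hermitian_normalmx /orthomx_spectralP GE := Gh.
set P := spectralmx GC in GE; set sp := spectral_diag GC in GE.
have Pu : P \in unitmx by exact: spectral_unit.
have PG : P *m GC = diag_mx sp *m P by rewrite GE !mulmxA mulmxV// mul1mx.
have spR j : exists2 l, sp 0 j = toC l & eigenvalue G l.
  have /mxOverP/(_ 0 j)/Creal_ReP := hermitian_spectral_diag_real Gh.
  have /complex_realP[l spl] : sp 0 j \is Num.real by have /mxOverP := hermitian_spectral_diag_real Gh.
  move=> _; exists l => //; rewrite -eigenvalue_real -spl; apply/eigenvalueP; exists (row j P).
    by rewrite -row_mul PG row_mul row_diag_mx -scalemxAl -rowE.
  apply/eqP => r0; have : row j P *m invmx P = 0 by rewrite r0 mul0mx.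
  rewrite -row_mul mulmxV// => /rowP/(_ j); rewrite !mxE eqxx => /eqP.
  by rewrite oner_eq0.
have : map_mx toC (horner_mx G p) = 0.
  rewrite map_horner_mx -/GC -[LHS]mul1mx -(mulVmx Pu) -mulmxA (horner_mx_intertwine _ PG).
  rewrite horner_mx_diag; have -> : diag_mx (map_mx (horner (map_poly toC p)) sp) = 0.
    apply/matrixP => i j; rewrite !mxE; have [l -> el] := spR i.
    by rewrite horner_map /= pa// raddf0 mul0rn.
  by rewrite mul0mx mulmx0.
by move/eqP; rewrite map_mx_eq0 => /eqP.
Qed.

(** A polynomial in [G] that takes at every eigenvalue the value of the fourth
    root is symmetric; its square is the root sought, and is positive because it
    is the square of a symmetric regular matrix. *)
Lemma sqrtmx_exists G : posdef G -> exists S, posdef S /\ S *m S = G.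
Proof.
move=> Gp.
have [s hs] := closed_field_poly_normal (map_poly toC (char_poly G)).
have ms : forall a, eigenvalue G a -> a \in [seq complex.Re z | z <- s].
  move=> a; rewrite eigenvalue_root_char -(fmorph_root toC) hs rootZ; last first.
    rewrite lead_coef_eq0 map_poly_eq0 -lead_coef_eq0.
    by have /eqP -> : lead_coef (char_poly G) == 1 := char_poly_monic G; rewrite oner_eq0.
  by rewrite root_prod_XsubC => /(map_f (@complex.Re R)).
(* a polynomial taking the value of the fourth root at each eigenvalue *)
have [q hq] := interpolation [seq complex.Re z | z <- s] (fun a => Num.sqrt (Num.sqrt a)).
pose Q := horner_mx G q.
have Q4 : Q *m Q *m (Q *m Q) = G.
  have : horner_mx G (q * q * (q * q) - 'X) = 0.
    apply: posdef_calculus => // a ea; rewrite hornerD hornerN !hornerM hornerX hq ?ms//.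
    have a0 := posdef_eigenvalue_gt0 Gp ea.
    by rewrite -!expr2 sqr_sqrtr ?sqrtr_ge0// sqr_sqrtr ?(ltW a0)// subrr.
  by rewrite rmorphB !rmorphM /= horner_mx_X => /eqP; rewrite subr_eq0 => /eqP.
have Qs : Q^T = Q.
  rewrite /Q; elim/poly_ind: (q) => [|p c IH]; first by rewrite rmorph0 trmx0.
  rewrite rmorphD rmorphM /= horner_mx_X horner_mx_C linearD /= tr_scalar_mx; congr (_ + _).
  rewrite -mulmxE trmx_mul IH Gp.1; apply/comm_mx_horner; exact: comm_mx_refl.
exists (Q *m Q); split => //; split; first by rewrite trmx_mul Qs.
move=> x x0; have -> : x^T *m (Q *m Q) *m x = (Q *m x)^T *m (Q *m x)^T^T.
  by rewrite trmxK trmx_mul Qs !mulmxA.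
apply: quad_sym_norm; apply: contraTneq (Gp.2 x x0) => /(congr1 trmx); rewrite trmxK trmx0 => Qx.
by rewrite -Q4 -!mulmxA Qx !mulmx0 mxE ltxx.
Qed.

Lemma sqrtmxP G : posdef G -> posdef (sqrtmx G) /\ sqrtmx G *m sqrtmx G = G.
Proof.
by move=> /sqrtmx_exists[S hS]; rewrite /sqrtmx; case: xgetP => [_ -> //|/(_ S)].
Qed.

Lemma posdef_unit G : posdef G -> G \in unitmx.
Proof.
move=> Gp; rewrite -unitmx_tr Gp.1 -row_free_unit -kermx_eq0; apply/negPn/negP => k0.
have : eigenvalue G 0 by rewrite /eigenvalue /eigenspace raddf0 subr0.
by move/(posdef_eigenvalue_gt0 Gp); rewrite ltxx.
Qed.

End square_root.

Lemma sym_quad_eq (R : realType) n (M N : 'M[R]_n) : M^T = M -> N^T = N ->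
  (forall t : 'cV[R]_n, (t^T *m M *m t) 0 0 = (t^T *m N *m t) 0 0) -> M = N.
Proof.
move=> Ms Ns MN.
have entry (K : 'M[R]_n) i j : ((delta_mx i 0 : 'cV[R]_n)^T *m K *m (delta_mx j 0 : 'cV[R]_n)) 0 0 = K i j.
  by rewrite trmx_delta -rowE -colE !mxE.
have ad (K L : 'M[R]_1) : (K + L) 0 0 = K 0 0 + L 0 0 by rewrite mxE.
have polar (K : 'M[R]_n) i j : K^T = K -> K i j =
   ((((delta_mx i 0 + delta_mx j 0 : 'cV[R]_n))^T *m K *m (delta_mx i 0 + delta_mx j 0 : 'cV[R]_n)) 0 0
    - ((delta_mx i 0 : 'cV[R]_n)^T *m K *m (delta_mx i 0 : 'cV[R]_n)) 0 0
    - ((delta_mx j 0 : 'cV[R]_n)^T *m K *m (delta_mx j 0 : 'cV[R]_n)) 0 0) / 2.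
  move=> Ks; rewrite [(_ + _)^T]linearD /= mulmxDl mulmxDl !mulmxDr !ad !entry.
  have -> : K j i = K i j by rewrite -[in LHS]Ks mxE.
  by field.
by apply/matrixP => i j; rewrite (polar M)// (polar N)// !MN.
Qed.

(** * Coefficients of the state in the future innovations *)

Section geometric.
Variable R : realType.

Lemma geometric_tail (q : R) m N : 0 <= q < 1 -> \sum_(m <= j < N) q ^+ j <= q ^+ m / (1 - q).
Proof.
move=> /andP[q0 q1]; have q1' : 0 < 1 - q by rewrite subr_gt0.
have h n : (1 - q) * \sum_(m <= j < m + n) q ^+ j <= q ^+ m - q ^+ (m + n).
  elim: n => [|n IH]; first by rewrite addn0 big_geq// mulr0 subrr.
  rewrite addnS big_nat_recr ?leq_addr//= mulrDr (le_trans (lerD IH (lexx _)))// exprS.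
  by rewrite le_eqVlt; apply/orP; left; apply/eqP; ring.
rewrite ler_pdivlMr// mulrC; have [mN|Nm] := leqP m N; last first.
  by rewrite big_geq ?mulr0 ?exprn_ge0// ltnW.
rewrite -(subnKC mN) (le_trans (h _))// lerBlDr lerDl exprn_ge0//.
Qed.

Lemma arith_geometric_sum (q : R) N : 0 <= q < 1 ->
  \sum_(0 <= j < N) j.+2%:R * q ^+ j <= 2 / (1 - q) ^+ 2.
Proof.
move=> /andP[q0 q1]; have q1' : 0 < 1 - q by rewrite subr_gt0.
have h : (1 - q) ^+ 2 * \sum_(0 <= j < N) j.+1%:R * q ^+ j = 1 - N.+1%:R * q ^+ N + N%:R * q ^+ N.+1.
  elim: N => [|N IH]; first by rewrite big_geq// mulr0 expr0 !mulr1 subrr mul0r addr0.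
  by rewrite big_nat_recr//= mulrDr IH !exprS -!natr1; ring.
have h2 : (1 - q) ^+ 2 * \sum_(0 <= j < N) j.+1%:R * q ^+ j <= 1.
  rewrite h exprS -natr1; have qN : 0 <= q ^+ N by rewrite exprn_ge0.
  have : N%:R * (q * q ^+ N) <= N%:R * q ^+ N by rewrite ler_wpM2l// ler_piMl// ltW.
  by move: (N%:R * (q * q ^+ N)) => x; rewrite mulrDl mul1r; lra.
rewrite ler_pdivlMr ?exprn_gt0// mulrC.
apply: (@le_trans _ _ ((1 - q) ^+ 2 * (2 * \sum_(0 <= j < N) j.+1%:R * q ^+ j))).
  rewrite ler_wpM2l ?exprn_ge0 ?(ltW q1')// mulr_sumr; apply: ler_sum => j _.
  rewrite mulrA ler_wpM2r ?exprn_ge0// -natrM ler_nat; lia.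
by rewrite mulrCA; lra.
Qed.

End geometric.

Section coefficients.
Variables (R : realType) (d : nat) (theta : 'cV[R]_d.+1).
Hypothesis theta_pe : theta \in @Theta_pe R d.
Local Notation B := (companion theta).
Local Notation A := (invmx (companion theta)).
Implicit Type t : 'cV[R]_d.+1.

(** The coefficient of the innovation [Z (n + j + 1)] in [dotp t (U n)]. *)
Definition future_coef t (j : nat) : R := - (t^T *m A ^+ j.+1) 0 ord0.

Lemma future_coef_shift t j : future_coef (B^T *m t) j = - (t^T *m A ^+ j) 0 ord0.
Proof.
rewrite /future_coef trmx_mul trmxK exprS -mulmxE mulmxA mulmxK//.
exact: companion_unit.
Qed.

Lemma future_coefS t j : future_coef (B^T *m t) j.+1 = future_coef t j.
Proof. by rewrite future_coef_shift. Qed.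

Lemma future_coef0 t : future_coef (B^T *m t) 0 = - t ord0 0.
Proof. by rewrite future_coef_shift expr0 mulmx1 mxE. Qed.

Lemma future_coef_decay t : exists C q, [/\ 0 < C, 0 < q, q < 1 &
  forall j, `|future_coef t j| <= C * q ^+ j].
Proof.
have [C [q [C0 q0 q1 h]]] := inv_companion_decay theta_pe.
exists (1 + \sum_i `|t i 0| * C), q; split => //.
  by rewrite ltr_pwDl// sumr_ge0// => i _; rewrite mulr_ge0// ltW.
move=> j; rewrite /future_coef normrN mxE (le_trans (ler_norm_sum _ _ _))//.
rewrite mulrDl mul1r ler_wpDl ?exprn_ge0 ?(ltW q0)// mulr_suml; apply: ler_sum => i _.
rewrite normrM !mxE -mulrA ler_wpM2l// (le_trans (h _ _ _))// ler_wpM2l ?(ltW C0)//.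
by rewrite exprS ler_piMl ?(ltW q1)// exprn_ge0// ltW.
Qed.

Lemma future_coef_tail t : exists r : nat -> R,
  (forall m N, \sum_(m <= j < N) future_coef t j ^+ 2 <= r m) /\ r m @[m --> \oo] --> 0.
Proof.
have [C [q [C0 q0 q1 h]]] := future_coef_decay t.
have q2 : 0 <= q ^+ 2 < 1 by rewrite exprn_ge0 ?(ltW q0)//= expr_lt1 ?(ltW q0).
exists (fun m => C ^+ 2 * ((q ^+ 2) ^+ m / (1 - q ^+ 2))); split.
  move=> m N; rewrite (le_trans _ (ler_wpM2l (sqr_ge0 C) (geometric_tail m N q2)))//.
  rewrite mulr_sumr; apply: ler_sum => j _; rewrite exprAC -exprMn -[leLHS]real_normK ?num_real//.
  by rewrite lerXn2r ?nnegrE// (le_trans _ (h j)).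
rewrite -(mulr0 (C ^+ 2)) -(mul0r (1 - q ^+ 2)^-1).
apply: cvgMr; apply: cvgMl; apply: cvg_expr; rewrite ger0_norm; by case/andP: q2.
Qed.

(** The variance of [dotp t (U n)], in units of the variance of an innovation. *)
Definition future_norm t : R := lim ((\sum_(0 <= j < N) future_coef t j ^+ 2) @[N --> \oo]).

Lemma future_norm_cvg t : \sum_(0 <= j < N) future_coef t j ^+ 2 @[N --> \oo] --> future_norm t.
Proof.
rewrite /future_norm; have [r [hr _]] := future_coef_tail t.
have : cvgn (fun N => \sum_(0 <= j < N) future_coef t j ^+ 2).
  apply: nondecreasing_is_cvgn.
    apply/nondecreasing_seqP => n; rewrite big_nat_recr//= lerDl sqr_ge0//.
  by exists (r 0%N) => _ [N _ <-].
by [].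
Qed.

(** Passing from [t] to [B^T *m t] puts the coefficient [- t ord0 0] in front of
    the sequence of those of [t]. *)
Lemma future_norm_shift t : future_norm (B^T *m t) = future_norm t + t ord0 0 ^+ 2.
Proof.
have h := @future_norm_cvg (B^T *m t).
rewrite -(cvg_shiftS (fun N => \sum_(0 <= j < N) _)) in h.
apply: (cvg_unique _ h); first exact: norm_hausdorff.
rewrite (_ : (fun N => _) = (fun N => \sum_(0 <= j < N) future_coef t j ^+ 2 + t ord0 0 ^+ 2)).
  by apply: cvgD; [exact: future_norm_cvg|exact: cvg_cst].
apply/funext => N; rewrite big_nat_recl//= future_coef0 sqrrN addrC; congr (_ + _).
by apply: eq_bigr => j _; rewrite future_coefS.
Qed.

Lemma future_norm_ge0 t : 0 <= future_norm t.
Proof.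
rewrite /future_norm; apply: limr_ge; first exact: cvgP (@future_norm_cvg t).
by apply: nearW => n; apply: sumr_ge0 => j _; exact: sqr_ge0.
Qed.

Lemma companion_trE t i : (B^T *m t) i 0 = theta i 0 * t ord0 0 +
  (if (i.+1 < d.+1)%N then t (inord i.+1) 0 else 0).
Proof.
rewrite mxE (bigD1 ord0)//= !mxE eqxx; congr (_ + _).
have E k : k != ord0 -> B^T i k * t k 0 = (i.+1 == k :> nat)%:R * t k 0.
  by move=> k0; rewrite !mxE (negbTE k0).
rewrite (eq_bigr _ E); case: ifP => id.
  have ik : inord i.+1 != ord0 :> 'I_d.+1 by rewrite -val_eqE /= inordK.
  rewrite (bigD1 (inord i.+1))//= inordK// eqxx mul1r big1 ?addr0// => k /andP[_ ki].
  case: eqP => [e|]; last by rewrite mul0r.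
  by move: ki; rewrite -val_eqE /= inordK// e eqxx.
rewrite big1// => k _; case: eqP => [e|]; last by rewrite mul0r.
by move: id; rewrite e ltn_ord.
Qed.

(** If the norm vanishes at [t] it also vanishes at the preimage of [t] under
    the transposed companion matrix, whose first entry is then zero; since this
    matrix shifts the other entries, all entries of [t] vanish. *)
Lemma future_norm_eq0 t : future_norm t = 0 -> t = 0.
Proof.
move=> t0; apply/colP => i; rewrite mxE.
have H m : forall t, future_norm t = 0 -> forall i : 'I_d.+1, (d < i + m)%N -> t i 0 = 0.
  elim: m => [|m IH] {t0 i}t t0 i im; first by move: im; rewrite addn0 ltnNge -ltnS ltn_ord.
  pose s := (A^T *m t).
  have ts : t = B^T *m s by rewrite /s mulmxA -trmx_mul mulVmx ?companion_unit// trmx1 mul1mx.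
  have := future_norm_shift s; rewrite -ts t0 => /esym/eqP.
  rewrite paddr_eq0 ?future_norm_ge0 ?sqr_ge0// => /andP[/eqP s0 /eqP /eqP].
  rewrite sqrf_eq0 => /eqP s00.
  rewrite ts companion_trE s00 mulr0 add0r; case: ifP => // id.
  by apply: IH => //; rewrite inordK// addSn -addnS.
by apply: (H d.+1) => //; rewrite addnS ltnS leq_addl.
Qed.

End coefficients.

(** * Convergence of empirical second moments *)

Section second_moments.
Variable R : realType.

Lemma cesaro_last (a : nat -> R) (s : R) :
  n%:R^-1 * (\sum_(0 <= k < n) a k) @[n --> \oo] --> s -> n.+1%:R^-1 * a n @[n --> \oo] --> 0.
Proof.
move=> h; have h1 := h; rewrite -(cvg_shiftS (fun n => n%:R^-1 * (\sum_(0 <= k < n) a k))) in h1.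
have hr : n.+1%:R^-1 @[n --> \oo] --> (0 : R) by exact: cvg_harmonic.
have h2 : (1 - n.+1%:R^-1) * (n%:R^-1 * (\sum_(0 <= k < n) a k)) @[n --> \oo] --> (1 - 0) * s.
  by apply: cvgM => //; apply: cvgB => //; exact: cvg_cst.
rewrite -(subrr s) -[X in _ --> s - X]mul1r -[X in _ --> s - X * _](subr0 1).
rewrite (_ : (fun n => _) = (fun n => n.+1%:R^-1 * (\sum_(0 <= k < n.+1) a k) -
   (1 - n.+1%:R^-1) * (n%:R^-1 * (\sum_(0 <= k < n) a k)))).
  exact: cvgB.
apply/funext => n; rewrite big_nat_recr//=; case: n => [|n].
  by rewrite big_geq// add0r !mulr0 subr0.
have n1 : n.+1%:R != 0 :> R by [].
have n2 : n.+2%:R != 0 :> R by [].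
rewrite -[n.+2%:R]natr1 in n2 *.
by field; apply/andP.
Qed.

(** As [z m] is of smaller order than [sqrt m], and [sqrt (n + j + 1)] is at most
    [(j + 2) * sqrt n], the sum is of smaller order than [sqrt n] times the sum of
    the [(j + 2) * q ^+ j]. *)
Lemma future_sum_negligible (z c v : nat -> R) C q :
  0 <= C -> 0 <= q < 1 -> (forall j, `|c j| <= C * q ^+ j) ->
  n.+1%:R^-1 * z n ^+ 2 @[n --> \oo] --> 0 ->
  (forall n, \sum_(0 <= j < N) c j * z (n + j)%N @[N --> \oo] --> v n) ->
  n%:R^-1 * v n ^+ 2 @[n --> \oo] --> 0.
Proof.
move=> C0 q01 cC z0 cv; have [q0 q1] := andP q01.
pose S := 2 / (1 - q) ^+ 2.
have S0 : 0 < S by rewrite divr_gt0// exprn_gt0// subr_gt0.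
apply/cvgr0Pnorm_le => e e0.
pose k := e / (C * S + 1) ^+ 2.
have CS0 : 0 < C * S + 1 by rewrite ltr_wpDl// mulr_ge0// ltW.
have k0 : 0 < k by rewrite divr_gt0// exprn_gt0.
move/cvgr0Pnorm_le/(_ _ k0) : z0 => [N0 _ hN].
have zb m : (N0 <= m)%N -> `|z m| <= Num.sqrt k * Num.sqrt m.+1%:R.
  move=> /hN /=; rewrite normrM [`|_ ^+ 2|]ger0_norm ?sqr_ge0// [`|_|]ger0_norm// mulrC ler_pdivrMr// => h.
  by rewrite -sqrtrM ?(ltW k0)// -sqrtr_sqr ler_wsqrtr.
near=> n.
have n0 : (0 < n)%N by near: n; exists 1%N.
have nN : (N0 <= n)%N by near: n; exists N0.
have vb : `|v n| <= C * S * (Num.sqrt k * Num.sqrt n%:R).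
  have cn : `|\sum_(0 <= j < N) c j * z (n + j)%N| @[N --> \oo] --> `|v n| by apply: cvg_norm; exact: cv.
  rewrite -(cvg_lim _ cn)//; apply: limr_le; first exact: cvgP cn.
  apply: nearW => N; rewrite (le_trans (ler_norm_sum _ _ _))//.
  apply: (@le_trans _ _ (\sum_(0 <= j < N) C * (Num.sqrt k * Num.sqrt n%:R) * (j.+2%:R * q ^+ j))).
    apply: ler_sum => j _; rewrite normrM.
    have h1 := cC j; have h2 := zb (n + j)%N (leq_trans nN (leq_addr _ _)).
    have h3 : Num.sqrt (n + j).+1%:R <= Num.sqrt n%:R * j.+2%:R :> R.
      rewrite -[X in _ * X]ger0_norm// -sqrtr_sqr -sqrtrM// ler_wsqrtr// -natrX -natrM ler_nat.
      rewrite expnS expn1 mulnA (leq_trans _ (leq_pmulr _ _))// mulnS -addnS leq_add2l.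
      exact: leq_pmull.
    apply: (le_trans (ler_pM (normr_ge0 _) (normr_ge0 _) h1 h2)).
    rewrite -!mulrA ler_wpM2l// mulrCA ler_wpM2l ?sqrtr_ge0// mulrA [leRHS]mulrC.
    by rewrite ler_wpM2l ?exprn_ge0.
  rewrite -mulr_sumr (mulrAC C S) ler_wpM2l ?mulr_ge0 ?sqrtr_ge0//.
  exact: arith_geometric_sum.
rewrite normrM [`|_ ^+ 2|]ger0_norm ?sqr_ge0// [`|_|]ger0_norm// mulrC ler_pdivrMr ?ltr0n//.
rewrite -real_normK ?num_real//.
apply: (@le_trans _ _ ((C * S * (Num.sqrt k * Num.sqrt n%:R)) ^+ 2)).
  by rewrite lerXn2r ?nnegrE// (le_trans _ vb).
rewrite exprMn [X in _ * X <= _]exprMn !sqr_sqrtr ?(ltW k0)// mulrA ler_wpM2r//.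
rewrite /k mulrA ler_pdivrMr ?exprn_gt0// mulrC ler_wpM2l ?(ltW e0)//.
have CS : 0 <= C * S by rewrite mulr_ge0// ltW.
by rewrite lerXn2r ?nnegrE ?(ltW CS0)// lerDl.
Unshelve. all: end_near. Qed.

End second_moments.

Section lyapunov.
Variables (R : realType) (d : nat) (theta : 'cV[R]_d.+1).
Hypothesis theta_pe : theta \in @Theta_pe R d.
Local Notation B := (companion theta).
Local Notation A := (invmx (companion theta)).

Definition entry_norm (M : 'M[R]_d.+1) : R := \sum_i \sum_j `|M i j|.

Lemma entry_norm_ge0 M : 0 <= entry_norm M.
Proof. by apply: sumr_ge0 => i _; apply: sumr_ge0. Qed.

Lemma entry_norm_le (M : 'M[R]_d.+1) i j : `|M i j| <= entry_norm M.
Proof.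
rewrite /entry_norm (bigD1 i)//= (bigD1 j)//= -addrA lerDl addr_ge0//; first exact: sumr_ge0.
by apply: sumr_ge0 => k _; exact: sumr_ge0.
Qed.

Lemma entry_normD M N : entry_norm (M + N) <= entry_norm M + entry_norm N.
Proof.
rewrite /entry_norm -big_split; apply: ler_sum => i _; rewrite -big_split; apply: ler_sum => j _.
by rewrite mxE ler_normD.
Qed.

Lemma entry_norm_conj (P M : 'M[R]_d.+1) p : (forall i j, `|P i j| <= p) ->
  entry_norm (P *m M *m P^T) <= d.+1%:R ^+ 2 * p ^+ 2 * entry_norm M.
Proof.
move=> Pp; have p0 : 0 <= p by exact: le_trans (Pp 0 0).
have h i j : `|(P *m M *m P^T) i j| <= p ^+ 2 * entry_norm M.
  rewrite mxE (le_trans (ler_norm_sum _ _ _))//.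
  rewrite /entry_norm exchange_big /= mulr_sumr; apply: ler_sum => k _.
  rewrite normrM !mxE expr2 -mulrA [leRHS]mulrC; apply: ler_pM => //.
  rewrite (le_trans (ler_norm_sum _ _ _))// mulr_sumr; apply: ler_sum => l _.
  by rewrite normrM ler_pM.
apply: (@le_trans _ _ (\sum_(i < d.+1) \sum_(j < d.+1) (p ^+ 2 * entry_norm M))).
  by apply: ler_sum => i _; apply: ler_sum => j _; exact: h.
by rewrite sumr_const card_ord sumr_const card_ord -mulrnA -[leLHS]mulr_natl natrM expr2 mulrA.
Qed.

(** The discrete Lyapunov equation for the expanding matrix [B] is stable:
    conjugating by a high power of [A] contracts. *)
Lemma lyapunov_stable : exists K, 0 <= K /\ forall D F : 'M[R]_d.+1,
  B *m D *m B^T = D + F -> entry_norm D <= K * entry_norm F.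
Proof.
have [C [r [C0 r0 r1 hA]]] := inv_companion_decay theta_pe.
pose c := d.+1%:R ^+ 2 * C ^+ 2.
have c0 : 0 < c by rewrite mulr_gt0 ?exprn_gt0.
have : c * r ^+ n @[n --> \oo] --> c * 0.
  by apply: cvgMr; apply: cvg_expr; rewrite ger0_norm// ltW.
have h2 : 0 < 2^-1 :> R by rewrite invr_gt0.
rewrite mulr0 => /cvgr0Pnorm_le/(_ _ h2)[m _ /(_ m (leqnn m)) /= hm].
exists (2 * (m%:R * c)); split; first by rewrite !mulr_ge0// ltW.
move=> D F BD.
have BA : B^T *m A^T = 1%:M by rewrite -trmx_mul mulVmx ?trmx1// companion_unit.
have AD : D = A *m D *m A^T + A *m F *m A^T.
  rewrite -mulmxDl -mulmxDr -BD !mulmxA mulVmx ?companion_unit// mul1mx -mulmxA BA.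
  by rewrite mulmx1.
pose phi k := A ^+ k *m D *m (A ^+ k)^T.
have phiS k : phi k = phi k.+1 + A ^+ k.+1 *m F *m (A ^+ k.+1)^T.
  rewrite /phi {1}AD mulmxDr mulmxDl exprSr -mulmxE !trmx_mul.
  by rewrite !mulmxA.
have cst k i j : `|(A ^+ k) i j| <= C.
  by rewrite (le_trans (hA k i j))// ler_piMr ?(ltW C0)// exprn_ile1 ?ltW.
have step k : entry_norm D <= entry_norm (phi k) + k%:R * (c * entry_norm F).
  elim: k => [|k IH]; first by rewrite /phi expr0 mul1mx trmx1 mulmx1 mul0r addr0.
  have h1 := entry_norm_conj F (cst k.+1); rewrite -/c in h1.
  have := entry_normD (phi k.+1) (A ^+ k.+1 *m F *m (A ^+ k.+1)^T); rewrite -phiS -natr1 mulrDl mul1r.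
  move: h1 IH; move: (entry_norm D) (entry_norm (phi k)) (entry_norm (phi k.+1)) (entry_norm (A ^+ k.+1 *m _ *m _)) => a b f g.
  by clearbody c; lra.
have last : entry_norm (phi m) <= 2^-1 * entry_norm D.
  have rm0 : 0 <= r ^+ m by rewrite exprn_ge0 ?ltW.
  rewrite (le_trans (entry_norm_conj _ (hA m)))// ler_wpM2r ?entry_norm_ge0//.
  rewrite exprMn mulrA -/c (le_trans _ (le_trans (ler_norm _) hm))// ler_wpM2l ?(ltW c0)//.
  by rewrite expr2 ler_piMl// exprn_ile1 ?ltW.
have := le_trans (step m) (lerD last (lexx _)).
rewrite -!mulrA; move: (m%:R * _) (entry_norm D) => x y; lra.
Qed.

Lemma entry_norm_cvg0 (M : nat -> 'M[R]_d.+1) :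
  (forall i j, M n i j @[n --> \oo] --> 0) -> entry_norm (M n) @[n --> \oo] --> 0.
Proof.
move=> h; have -> : (0 : R) = \sum_(i < d.+1) \sum_(j < d.+1) 0 by rewrite big1// => i _; rewrite big1.
apply: cvg_sumr => i; apply: cvg_sumr => j.
by rewrite -(normr0 R); apply: cvg_norm; exact: h.
Qed.

Lemma outer_entry n (u v : 'cV[R]_n) i j : (u *m v^T) i j = u i 0 * v j 0.
Proof. by rewrite mxE big_ord1 mxE. Qed.

(** By the recursion, conjugating the mean Gram matrix by [B] changes it by a
    telescoping boundary term, by cross products of noise and state, and by the
    mean squared noise.  So it solves the Lyapunov equation of [G] up to an error
    that tends to zero, and [lyapunov_stable] applies to the difference. *)
Lemma empirical_covariance (x : nat -> 'cV[R]_d.+1) (z : nat -> R) (G : 'M[R]_d.+1) (s : R) :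
  (forall n, x n.+1 = B *m x n + z n *: delta_mx ord0 0) ->
  n%:R^-1 * (\sum_(0 <= k < n) z k ^+ 2) @[n --> \oo] --> s ->
  (forall i, n%:R^-1 * (\sum_(0 <= k < n) z k * x k.+1 i 0) @[n --> \oo] --> 0) ->
  (forall i, n%:R^-1 * x n i 0 ^+ 2 @[n --> \oo] --> 0) ->
  B *m G *m B^T = G + s *: (delta_mx ord0 0 *m (delta_mx ord0 0 : 'cV[R]_d.+1)^T) ->
  forall i j, (n%:R^-1 *: \sum_(0 <= k < n) x k *m (x k)^T) i j @[n --> \oo] --> G i j.
Proof.
move=> xB zs zx xx GB.
pose e : 'cV[R]_d.+1 := delta_mx ord0 0.
pose M n := n%:R^-1 *: \sum_(0 <= k < n) x k *m (x k)^T.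
pose F n := B *m M n *m B^T - M n.
have FE n i j : F n i j = n%:R^-1 * (x n i 0 * x n j 0) - n%:R^-1 * (x 0%N i 0 * x 0%N j 0)
    - e j 0 * (n%:R^-1 * (\sum_(0 <= k < n) z k * x k.+1 i 0))
    - e i 0 * (n%:R^-1 * (\sum_(0 <= k < n) z k * x k.+1 j 0))
    + e i 0 * e j 0 * (n%:R^-1 * (\sum_(0 <= k < n) z k ^+ 2)).
  have E : B *m M n *m B^T = n%:R^-1 *: \sum_(0 <= k < n) (x k.+1 - z k *: e) *m (x k.+1 - z k *: e)^T.
    rewrite /M -scalemxAr -scalemxAl mulmx_sumr mulmx_suml; congr (_ *: _); apply: eq_bigr => k _.
    by rewrite xB -/e addrK trmx_mul !mulmxA.
  rewrite /F E /M -scalerBr -sumrB mxE summxE.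
  have -> : \sum_(0 <= k < n) ((x k.+1 - z k *: e) *m (x k.+1 - z k *: e)^T - x k *m (x k)^T) i j =
    \sum_(0 <= k < n) ((x k.+1 i 0 * x k.+1 j 0 - x k i 0 * x k j 0)
      - e j 0 * (z k * x k.+1 i 0) - e i 0 * (z k * x k.+1 j 0) + e i 0 * e j 0 * z k ^+ 2).
    by apply: eq_bigr => k _; rewrite mxE [(- (_ *m _)) i j]mxE !outer_entry !mxE; ring.
  rewrite big_split sumrB sumrB /= (telescope_sumr (fun k => x k i 0 * x k j 0))//.
  by rewrite -!mulr_sumr; ring.
have inv0 : n%:R^-1 @[n --> \oo] --> (0 : R).
  by rewrite -(cvg_shiftS (fun n => n%:R^-1 : R)); exact: cvg_harmonic.
have xij i j : n%:R^-1 * (x n i 0 * x n j 0) @[n --> \oo] --> 0.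
  have h0 : n%:R^-1 * x n i 0 ^+ 2 + n%:R^-1 * x n j 0 ^+ 2 @[n --> \oo] --> (0 + 0 : R).
    by apply: cvgD; exact: xx.
  rewrite addr0 in h0; apply: norm_cvg0.
  apply: (squeeze_cvgr _ (cvg_cst 0) h0); apply: nearW => n.
  rewrite normr_ge0 normrM [`|_^-1|]ger0_norm// -mulrDr ler_wpM2l// normrM.
  rewrite -(real_normK (num_real (x n i 0))) -(real_normK (num_real (x n j 0))).
  by have := normr_ge0 (x n i 0); have := normr_ge0 (x n j 0); move: `|_| `|_| => a b; nra.
have Fcvg i j : (F n - s *: (e *m e^T)) i j @[n --> \oo] --> 0.
  have -> : (fun n => (F n - s *: (e *m e^T)) i j) = (fun n => F n i j - s * (e i 0 * e j 0)).
    apply/funext => n; move: (F n) => L.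
    by rewrite -(outer_entry e e i j) !mxE.
  have -> : (0 : R) = (0 - 0 * (x 0%N i 0 * x 0%N j 0) - e j 0 * 0 - e i 0 * 0 + e i 0 * e j 0 * s) - s * (e i 0 * e j 0).
    by ring.
  apply: cvgB; last exact: cvg_cst.
  under eq_fun do rewrite FE.
  apply: cvgD; last exact: cvgMr.
  apply: cvgB; last exact: cvgMr.
  apply: cvgB; last exact: cvgMr.
  apply: cvgB; first exact: xij.
  exact: cvgMl.
have [K [K0 hK]] := lyapunov_stable.
have hn n : entry_norm (M n - G) <= K * entry_norm (F n - s *: (e *m e^T)).
  apply: hK; rewrite mulmxBr mulmxBl GB /F -/e.
  move: (B *m M n *m B^T) (M n) (s *: _) => b m q.
  by apply/matrixP => i j; rewrite !mxE; ring.
move=> i j; apply/subr_cvg0; apply: norm_cvg0.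
have h0 : K * entry_norm (F n - s *: (e *m e^T)) @[n --> \oo] --> K * 0.
  by apply: cvgMr; exact: entry_norm_cvg0.
rewrite mulr0 in h0.
apply: (squeeze_cvgr _ (cvg_cst 0) h0); apply: nearW => n.
rewrite normr_ge0 (le_trans _ (hn n))// (le_trans _ (entry_norm_le _ i j))//.
by rewrite -/(M n); move: (M n) => m; rewrite !mxE.
Qed.

End lyapunov.

(** * Time reversal of the normal equations *)

Section reversal.
Variables (R : realType) (d : nat) (theta : 'cV[R]_d.+1).
Hypothesis theta_last : theta ord_max 0 != 0.
Implicit Types (y z : nat -> R).

Lemma sum_shift (g : nat -> R) G n a : (forall k, (k < a)%N -> `|g k| <= G) ->
  (forall k, (k < a)%N -> `|g (n + k)%N| <= G) ->
  `|\sum_(0 <= k < n) g (k + a)%N - \sum_(0 <= k < n) g k| <= a%:R * (2 * G).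
Proof.
elim: a => [|a IH] h1 h2.
  by under eq_bigr do rewrite addn0; rewrite subrr normr0 mul0r.
have h := IH (fun k ka => h1 k (ltnW ka)) (fun k ka => h2 k (ltnW ka)).
have step : \sum_(0 <= k < n) g (k + a.+1)%N - \sum_(0 <= k < n) g (k + a)%N = g (n + a)%N - g a.
  rewrite -sumrB; under eq_bigr do rewrite addnS -addSn.
  by rewrite (telescope_sumr (fun k => g (k + a)%N)).
rewrite -(subrK (\sum_(0 <= k < n) g (k + a)%N) (\sum_(0 <= k < n) g (k + a.+1)%N)) -addrA step.
rewrite (le_trans (ler_normD _ _))// (le_trans (lerD (ler_normB _ _) h))//.
by have := h1 a (ltnSn a); have := h2 a (ltnSn a); rewrite -natr1 mulrDl mul1r; lra.
Qed.

(** Dominates all products of two terms of the series taken among the finitely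
    many at the beginning and at the end of the observation window. *)
Definition boundary y n : R := \sum_(a < d.+1.*2.+1) (y a ^+ 2 + y (n + a)%N ^+ 2).

Lemma boundary_ge y n a : (a <= d.+1.*2)%N -> y a ^+ 2 + y (n + a)%N ^+ 2 <= boundary y n.
Proof.
move=> ad; have aD : (a < d.+1.*2.+1)%N by [].
rewrite /boundary (bigD1 (Ordinal aD))//= lerDl sumr_ge0// => k _.
by rewrite addr_ge0 ?sqr_ge0.
Qed.

Lemma norm_mul_le_sqr (a b : R) : `|a * b| <= a ^+ 2 / 2 + b ^+ 2 / 2.
Proof.
rewrite normrM -(real_normK (num_real a)) -(real_normK (num_real b)).
by move: `|a| `|b| => u v; have := sqr_ge0 (u - v); nra.
Qed.

Lemma boundary_lag y n a b : (a <= d.+1.*2)%N -> (b <= d.+1.*2)%N ->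
  `|y a * y b| <= boundary y n /\ `|y (n + a)%N * y (n + b)%N| <= boundary y n.
Proof.
move=> ad bd; have ha := boundary_ge y n ad; have hb := boundary_ge y n bd.
have := sqr_ge0 (y a); have := sqr_ge0 (y b).
have := sqr_ge0 (y (n + a)%N); have := sqr_ge0 (y (n + b)%N).
have h1 := norm_mul_le_sqr (y a) (y b).
have h2 := norm_mul_le_sqr (y (n + a)%N) (y (n + b)%N).
by move: (boundary y n) (y a ^+ 2) (y b ^+ 2) (y (n + a)%N ^+ 2) (y (n + b)%N ^+ 2) ha hb h1 h2 => *; split; lra.
Qed.

(** The two sums run over products of terms at the same distance from each other
    and differ by a shift of the summation index. *)
Lemma lag_sum_reversal y n p q p' q' : (p + p' = q + q')%N ->
  (p <= d.+1)%N -> (q <= d.+1)%N -> (p' <= d.+1)%N -> (q' <= d.+1)%N ->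
  `|\sum_(0 <= k < n) y (k + p)%N * y (k + q)%N - \sum_(0 <= k < n) y (k + p')%N * y (k + q')%N| <=
  4 * d.+1%:R * boundary y n.
Proof.
wlog pq : p q p' q' / (p <= q)%N.
  move=> H e hp hq hp' hq'; have [pq|/ltnW qp] := leqP p q; first exact: H.
  under eq_bigr do rewrite mulrC; under [X in _ - X]eq_bigr do rewrite mulrC.
  exact: H.
move=> e hp hq hp' hq'; pose g k := y k * y (k + (q - p))%N.
have -> : \sum_(0 <= k < n) y (k + p)%N * y (k + q)%N = \sum_(0 <= k < n) g (k + p)%N.
  by apply: eq_bigr => k _; rewrite /g; congr (_ * y _); lia.
have -> : \sum_(0 <= k < n) y (k + p')%N * y (k + q')%N = \sum_(0 <= k < n) g (k + q')%N.
  by apply: eq_bigr => k _; rewrite mulrC /g; congr (_ * y _); lia.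
have b0 : 0 <= boundary y n by apply: sumr_ge0 => k _; rewrite addr_ge0 ?sqr_ge0.
have h a : (a <= d.+1)%N -> `|\sum_(0 <= k < n) g (k + a)%N - \sum_(0 <= k < n) g k| <= 2 * d.+1%:R * boundary y n.
  move=> ad; apply: (@le_trans _ _ (a%:R * (2 * boundary y n))).
    apply: sum_shift => k ka.
      by apply: (@boundary_lag y n k (k + (q - p))%N _ _).1; lia.
    by rewrite /g -addnA; apply: (@boundary_lag y n k (k + (q - p))%N _ _).2; lia.
  by rewrite mulrA [a%:R * 2]mulrC ler_wpM2r// ler_wpM2l// ler_nat.
rewrite (le_trans (ler_distD (\sum_(0 <= k < n) g k) _ _))//.
rewrite [X in _ + X]distrC.
by have := h q' hq'; have := h p hp; lra.
Qed.

(** The recursion is solved for its oldest term. *)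
Lemma backward_recursion y z k :
  y (k + d.+1)%N = \sum_(i < d.+1) theta i 0 * y (k + (d - i))%N + z k ->
  y k - \sum_(j < d.+1) theta_star theta j 0 * y (k + j.+1)%N = - (theta ord_max 0)^-1 * z k.
Proof.
move=> yk; have -> : z k = y (k + d.+1)%N - \sum_(i < d.+1) theta i 0 * y (k + (d - i))%N.
  by rewrite yk addrC addKr.
rewrite !big_ord_recr /= subnn addn0 !mxE eqxx.
rewrite (reindex_inj rev_ord_inj) /=.
have -> : \sum_(i < d) theta_star theta (widen_ord (leqnSn d) (rev_ord i)) 0 * y (k + (d - i.+1).+1)%N =
   - (theta ord_max 0)^-1 * \sum_(i < d) theta (widen_ord (leqnSn d) i) 0 * y (k + (d - i))%N.
  rewrite mulr_sumr; apply: eq_bigr => i _; rewrite mxE.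
  have id := ltn_ord i.
  have -> : (widen_ord (leqnSn d) (rev_ord i) == ord_max) = false.
    by apply/negbTE; rewrite -val_eqE /=; lia.
  have -> : inord (d - (widen_ord (leqnSn d) (rev_ord i)).+1) = widen_ord (leqnSn d) i.
    by apply: val_inj; rewrite /= inordK; lia.
  have -> : (d - i.+1).+1 = (d - i)%N by lia.
  by field.
by field.
Qed.

(** The least squares normal equations are, up to boundary terms, those of the
    time-reversed series, for which [theta_star theta] has residuals
    proportional to the innovations. *)
Lemma normal_equations y z n (i : 'I_d.+1) :
  (forall k, y (k + d.+1)%N = \sum_(i < d.+1) theta i 0 * y (k + (d - i))%N + z k) ->
  `|\sum_(0 <= k < n) y (k + (d - i))%N * (y (k + d.+1)%N - \sum_(j < d.+1) theta_star theta j 0 * y (k + (d - j))%N)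
    + (theta ord_max 0)^-1 * \sum_(0 <= k < n) z k * y (k + i.+1)%N|
  <= (1 + \sum_j `|theta_star theta j 0|) * (4 * d.+1%:R) * boundary y n.
Proof.
move=> yr; have id := ltn_ord i.
have -> : (theta ord_max 0)^-1 * \sum_(0 <= k < n) z k * y (k + i.+1)%N =
   - (\sum_(0 <= k < n) y (k + i.+1)%N * (y (k + 0)%N - \sum_(j < d.+1) theta_star theta j 0 * y (k + j.+1)%N)).
  rewrite mulr_sumr -sumrN; apply: eq_bigr => k _.
  by rewrite addn0 (backward_recursion (yr k)); ring.
have E (p q : nat) (r : nat -> nat) : \sum_(0 <= k < n) y (k + p)%N * (y (k + q)%N - \sum_(j < d.+1) theta_star theta j 0 * y (k + r j)%N)
    = \sum_(0 <= k < n) y (k + p)%N * y (k + q)%N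
      - \sum_(j < d.+1) theta_star theta j 0 * \sum_(0 <= k < n) y (k + p)%N * y (k + r j)%N.
  under [X in _ = _ - X]eq_bigr do rewrite mulr_sumr.
  rewrite [X in _ = _ - X]exchange_big /= -sumrB; apply: eq_bigr => k _.
  by rewrite mulrBr mulr_sumr; congr (_ - _); apply: eq_bigr => j _; ring.
rewrite (E (d - i)%N d.+1 (fun j => (d - j)%N)) (E i.+1 0%N (fun j => j.+1)).
have R4 (a s b t : R) : a - s - (b - t) = (a - b) + (t - s) by ring.
rewrite R4 -[X in _ + X]sumrB -mulrA mulrDl mul1r.
rewrite (le_trans (ler_normD _ _))// lerD//.
  by apply: lag_sum_reversal; lia.
rewrite (le_trans (ler_norm_sum _ _ _))// mulr_suml; apply: ler_sum => j _.
rewrite -mulrBr normrM ler_wpM2l//.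
have jd := ltn_ord j.
by rewrite distrC; apply: lag_sum_reversal; lia.
Qed.

End reversal.

(** * Convergence in probability *)

Section negligible_sequences.
Context {disp : measure_display} {T : measurableType disp} {R : realType}
  (P : probability T R).
Implicit Types (X Y V : nat -> T -> R).

Lemma capped_add (x y : R) : capped (x + y) <= capped x + capped y.
Proof.
rewrite /capped; have := ler_normD x y; have := normr_ge0 x; have := normr_ge0 y.
by rewrite !minEle; do 3 case: ifPn; rewrite -?ltNge => *; lra.
Qed.

Lemma capped_mul (x y : R) : capped (x * y) <= capped x + capped y.
Proof.
rewrite /capped normrM; have := normr_ge0 x; have := normr_ge0 y.
move: `|x| `|y| => a b b0 a0.
by rewrite !minEle; do 3 case: ifPn; rewrite -?ltNge => *; nra.
Qed.

Lemma capped_scale (c x : R) : capped (c * x) <= (1 + `|c|) * capped x.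
Proof.
rewrite /capped normrM; have := normr_ge0 x; have := normr_ge0 c.
move: `|x| `|c| => a b b0 a0.
by rewrite !minEle; do 2 case: ifPn; rewrite -?ltNge => *; nra.
Qed.

(** Convergence in probability to zero, in the metric [Ex P (capped _)]. *)
Definition vanishes X : Prop :=
  (forall n, measurable_fun setT (X n)) /\ Ex P (fun w => capped (X n w)) @[n --> \oo] --> 0.

Lemma vanishes_le X (b : nat -> R) : (forall n, measurable_fun setT (X n)) ->
  (forall n, Ex P (fun w => capped (X n w)) <= b n) -> b n @[n --> \oo] --> 0 -> vanishes X.
Proof.
move=> mX Xb b0; split => //; apply: (squeeze_cvgr _ (cvg_cst 0) b0); apply: nearW => n.
by rewrite Xb andbT Ex_ge0// => w; exact: capped_ge0.
Qed.

Lemma vanishes_as X : (forall n, measurable_fun setT (X n)) ->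
  {ae P, forall w, X n w @[n --> \oo] --> 0} -> vanishes X.
Proof.
move=> mX X0; split => //.
have [] := @Ex_dct _ _ _ P (fun n w => capped (X n w)) (fun=> 0) (fun=> 1).
- by move=> n; exact: intg_meas (intg_capped _ _).
- exact: measurable_cst.
- exact: intg_cst.
- apply: filterS X0 => w X0.
  have h : `|X n w| @[n --> \oo] --> (0 : R) by rewrite -(normr0 R); exact: cvg_norm.
  by apply: (squeeze_cvgr _ (cvg_cst 0) h); apply: nearW => n; rewrite capped_ge0 capped_le_norm.
- by move=> n w; rewrite ger0_norm ?capped_ge0// capped_le1.
by rewrite Ex_cst.
Qed.

Lemma vanishes_L1 X (b : nat -> R) : (forall n, intg P (X n)) ->
  (forall n, Ex P (fun w => `|X n w|) <= b n) -> b n @[n --> \oo] --> 0 -> vanishes X.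
Proof.
move=> iX Xb b0; have mX n : measurable_fun setT (X n) by exact: intg_meas (iX n).
apply: (vanishes_le mX _ b0) => n; apply: le_trans (Xb n); apply: Ex_le.
- exact: intg_capped.
- exact: intg_abs.
- by move=> w; exact: capped_le_norm.
Qed.

Lemma vanishesD X Y : vanishes X -> vanishes Y -> vanishes (fun n w => X n w + Y n w).
Proof.
move=> [mX X0] [mY Y0].
apply: (@vanishes_le _ (fun n => Ex P (fun w => capped (X n w)) + Ex P (fun w => capped (Y n w)))).
- by move=> n; exact: measurable_funD.
- move=> n; rewrite -ExD; [|exact: intg_capped|exact: intg_capped].
  apply: Ex_le; [apply: intg_capped; exact: measurable_funD|by apply: intgD; exact: intg_capped|].
  by move=> w; exact: capped_add.
- by rewrite -(addr0 0); exact: cvgD.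
Qed.

Lemma vanishesM X Y : vanishes X -> vanishes Y -> vanishes (fun n w => X n w * Y n w).
Proof.
move=> [mX X0] [mY Y0].
apply: (@vanishes_le _ (fun n => Ex P (fun w => capped (X n w)) + Ex P (fun w => capped (Y n w)))).
- by move=> n; exact: measurable_funM.
- move=> n; rewrite -ExD; [|exact: intg_capped|exact: intg_capped].
  apply: Ex_le; [apply: intg_capped; exact: measurable_funM|by apply: intgD; exact: intg_capped|].
  by move=> w; exact: capped_mul.
- by rewrite -(addr0 0); exact: cvgD.
Qed.

Lemma vanishesZ c X : vanishes X -> vanishes (fun n w => c * X n w).
Proof.
move=> [mX X0].
apply: (@vanishes_le _ (fun n => (1 + `|c|) * Ex P (fun w => capped (X n w)))).
- by move=> n; exact: measurable_funM.
- move=> n; rewrite -ExZ; last exact: intg_capped.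
  apply: Ex_le; [apply: intg_capped; exact: measurable_funM|by apply: intgZ; exact: intg_capped|].
  by move=> w; exact: capped_scale.
- by rewrite -(mulr0 (1 + `|c|)); exact: cvgMr.
Qed.

Lemma vanishes0 : vanishes (fun _ _ => 0).
Proof. by apply: vanishes_as => // ; apply: nearW => w; exact: cvg_cst. Qed.

Lemma vanishes_sum (I : Type) (s : seq I) (X : I -> nat -> T -> R) :
  (forall i, vanishes (X i)) -> vanishes (fun n w => \sum_(i <- s) X i n w).
Proof.
move=> vX; elim: s => [|i s IH].
  rewrite (_ : (fun _ _ => _) = (fun _ _ => 0)); first exact: vanishes0.
  by apply/funext => n; apply/funext => w; rewrite big_nil.
rewrite (_ : (fun _ _ => _) = (fun n w => X i n w + \sum_(i <- s) X i n w)); first exact: vanishesD.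
by apply/funext => n; apply/funext => w; rewrite big_cons.
Qed.

(** The product is split as [(K * X n) * (V n / K)]: with [K] large the second
    factor is small in expectation, uniformly in [n], and for fixed [K] the first
    one vanishes. *)
Lemma vanishesM_bounded X V C : vanishes X -> (forall n, L2 P (V n)) ->
  (forall n, Ex P (fun w => V n w ^+ 2) <= C) -> vanishes (fun n w => X n w * V n w).
Proof.
move=> [mX X0] lV VC.
have C0 : 0 <= C by apply: le_trans (VC 0%N); apply: Ex_ge0 => w; exact: sqr_ge0.
have mV n : measurable_fun setT (V n) by exact: (lV n).1.
have EV n : Ex P (fun w => `|V n w|) <= C + 1 by exact: Ex_abs_le_sqr (VC n).
split; first by move=> n; exact: measurable_funM.
apply/cvgr0Pnorm_le => e e0.
pose K := 2 * (C + 1) / e.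
have K0 : 0 < K by rewrite divr_gt0// mulr_gt0//; lra.
have h : (1 + `|K|) * Ex P (fun w => capped (X n w)) @[n --> \oo] --> (1 + `|K|) * 0 by exact: cvgMr.
have e20 : 0 < e / 2 by rewrite divr_gt0.
rewrite mulr0 in h; move/cvgr0Pnorm_le/(_ _ e20) : h; apply: filterS => n hn.
rewrite ger0_norm; last by apply: Ex_ge0 => w; exact: capped_ge0.
apply: (@le_trans _ _ (Ex P (fun w => (1 + `|K|) * capped (X n w) + K^-1 * `|V n w|))).
  apply: Ex_le.
  - by apply: intg_capped; exact: measurable_funM.
  - apply: intgD; first by apply: intgZ; exact: intg_capped.
    by apply: intgZ; apply: intg_abs; exact: L2_intg.
  - move=> w; have -> : X n w * V n w = (K * X n w) * (K^-1 * V n w).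
      by rewrite mulrACA divff ?gt_eqF// mul1r.
    rewrite (le_trans (capped_mul _ _))// lerD ?capped_scale// (le_trans (capped_le_norm _))//.
    by rewrite normrM ger0_norm// invr_ge0 ltW.
rewrite ExD; last 2 first.
- by apply: intgZ; exact: intg_capped.
- by apply: intgZ; apply: intg_abs; exact: L2_intg.
rewrite !ExZ; [|by apply: intg_abs; exact: L2_intg|exact: intg_capped].
have h2 : K^-1 * Ex P (fun w => `|V n w|) <= e / 2.
  apply: (@le_trans _ _ (K^-1 * (C + 1))); first by rewrite ler_wpM2l// invr_ge0 ltW.
  have C1 : C + 1 != 0 by apply: lt0r_neq0; lra.
  rewrite /K le_eqVlt; apply/orP; left; apply/eqP; field.
  by rewrite C1 gt_eqF.
by have := le_trans (ler_norm _) hn; lra.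
Qed.

Lemma cos_sub_le_capped (a b : R) : `|cos a - cos b| <= 2 * capped (a - b).
Proof.
have h1 := cos_lip a b.
have h2 : `|cos a - cos b| <= 2.
  by rewrite (le_trans (ler_normB _ _))//; have := cos_max a; have := cos_max b; lra.
rewrite /capped minEle; case: ifPn => _; first by rewrite mulr1.
by have := normr_ge0 (a - b); lra.
Qed.

Lemma vanishes_cos X Y (c l : R) : (forall n, measurable_fun setT (Y n)) -> vanishes (fun n w => X n w - Y n w) ->
  Ex P (fun w => cos (Y n w + c)) @[n --> \oo] --> l -> Ex P (fun w => cos (X n w + c)) @[n --> \oo] --> l.
Proof.
move=> mY [mD D0] Yl.
have mX n : measurable_fun setT (X n).
  rewrite (_ : X n = (fun w => (X n w - Y n w) + Y n w)); first exact: measurable_funD.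
  by apply/funext => w; rewrite subrK.
have icos (F : T -> R) : measurable_fun setT F -> intg P (fun w => cos (F w + c)).
  move=> mF; apply: (@intg_bd _ _ _ _ _ 1) => [|w]; last exact: cos_max.
  by apply: measurableT_comp; [exact: measurable_cos|exact: measurable_funD].
have diff0 : Ex P (fun w => cos (X n w + c)) - Ex P (fun w => cos (Y n w + c)) @[n --> \oo] --> 0.
  apply: norm_cvg0.
  have h : 2 * Ex P (fun w => capped (X n w - Y n w)) @[n --> \oo] --> 2 * (0 : R) by exact: cvgMr.
  rewrite mulr0 in h; apply: (squeeze_cvgr _ (cvg_cst 0) h); apply: nearW => n.
  rewrite normr_ge0 -ExB; [|exact: icos|exact: icos].
  rewrite (le_trans (Ex_abs (intgB (icos _ (mX n)) (icos _ (mY n)))))// -ExZ; last exact: intg_capped.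
  apply: Ex_le.
  - by apply: intg_abs; apply: intgB; exact: icos.
  - by apply: intgZ; exact: intg_capped.
  - move=> w; rewrite (le_trans (cos_sub_le_capped _ _))// opprD addrACA subrr addr0//.
rewrite -(add0r l) (_ : (fun n => _) = (fun n => (Ex P (fun w => cos (X n w + c))
   - Ex P (fun w => cos (Y n w + c))) + Ex P (fun w => cos (Y n w + c)))); first exact: cvgD.
by apply/funext => n; rewrite subrK.
Qed.

End negligible_sequences.

Section tight_perturbation.
Context {disp : measure_display} {T : measurableType disp} {R : realType}
  (P : probability T R).
Implicit Types (X V : nat -> T -> R).

(** Bounded second moments give tightness, and a vanishing perturbation keeps it. *)
Lemma vanishes_tight X V C e : (forall n, L2 P (V n)) -> (forall n, Ex P (fun w => V n w ^+ 2) <= C) ->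
  vanishes P (fun n w => X n w - V n w) -> 0 < e ->
  exists2 K : R, 0 < K & \forall n \near \oo, Ex P (fun w => capped (X n w / K)) <= e.
Proof.
move=> lV VC [mD D0] e0.
have C0 : 0 <= C by apply: le_trans (VC 0%N); apply: Ex_ge0 => w; exact: sqr_ge0.
pose K := 2 * (C + 1) / e + 1.
have K1 : 1 <= K by rewrite lerDr divr_ge0 ?(ltW e0)// mulr_ge0//; lra.
have K0 : 0 < K by exact: lt_le_trans K1.
exists K => //.
have e20 : 0 < e / 2 by rewrite divr_gt0.
move/cvgr0Pnorm_le/(_ _ e20) : D0; apply: filterS => n hn.
have iV : intg P (fun w => `|V n w|) by apply: intg_abs; exact: L2_intg.
have mX : measurable_fun setT (X n).
  rewrite (_ : X n = (fun w => (X n w - V n w) + V n w)); first by apply: measurable_funD => //; exact: (lV n).1.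
  by apply/funext => w; rewrite subrK.
apply: (@le_trans _ _ (Ex P (fun w => capped (X n w - V n w) + K^-1 * `|V n w|))).
  apply: Ex_le.
  - by apply: intg_capped; exact: measurable_funM.
  - by apply: intgD; [exact: intg_capped|exact: intgZ].
  - move=> w; rewrite -{1}(subrK (V n w) (X n w)) mulrDl (le_trans (capped_add _ _))// lerD//.
      by apply: capped_mono; rewrite normrM ler_piMr// ger0_norm ?invr_ge0 ?(ltW K0)// invf_le1.
    rewrite (le_trans (capped_le_norm _))// normrM mulrC ler_wpM2r// ger0_norm// invr_ge0.
    exact: ltW.
rewrite ExD; [|exact: intg_capped|exact: intgZ].
rewrite ExZ//.
have h2 : K^-1 * Ex P (fun w => `|V n w|) <= e / 2.
  apply: (@le_trans _ _ (K^-1 * (C + 1))).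
    by rewrite ler_wpM2l ?invr_ge0 ?(ltW K0)// Ex_abs_le_sqr.
  rewrite mulrC ler_pdivrMr// /K mulrDr mulr1.
  rewrite (_ : e / 2 * _ = C + 1); first by rewrite lerDl ltW.
  by field; rewrite gt_eqF.
by have := le_trans (ler_norm _) hn; lra.
Qed.

End tight_perturbation.

(** * Measurability and continuity of matrix inversion *)

Section inverse_matrix.
Variable R : realType.

(** The functions [x / (x ^+ 2 + 1 / n)] are continuous and converge to [x^-1] also
    at zero, where all of them vanish. *)
Lemma measurable_invr : measurable_fun setT (fun x : R => x^-1).
Proof.
pose f (n : nat) (x : R) := x * (x ^+ 2 + n.+1%:R^-1)^-1.
have den n (x : R) : x ^+ 2 + n.+1%:R^-1 != 0 by rewrite gt_eqF// ltr_wpDl ?sqr_ge0// invr_gt0.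
apply: (@measurable_fun_cvg _ _ _ _ f).
  move=> n; apply: continuous_measurable_fun => x; apply: cvgM; first exact: cvg_id.
  apply: cvgV => //; apply: cvgD; last exact: cvg_cst.
  exact: exprn_continuous.
move=> x _; have [->|x0] := eqVneq x 0.
  by rewrite invr0 /f; under eq_fun do rewrite mul0r; exact: cvg_cst.
have -> : x^-1 = x * (x ^+ 2 + 0)^-1 by field.
apply: cvgMr; apply: cvgV; first by rewrite addr0 expf_neq0.
by apply: cvgD; [exact: cvg_cst|exact: cvg_harmonic].
Qed.

(** As [0^-1 = 0], the adjugate formula holds for singular matrices too; it
    yields measurability without a case distinction. *)
Lemma invmx0E n (M : 'M[R]_n) : invmx0 M = (\det M)^-1 *: \adj M.
Proof.
rewrite /invmx0 /invmx unitmxE unitfE; case: eqP => [->|] //=.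
by rewrite invr0 scale0r.
Qed.

Lemma invmx0Z n (M : 'M[R]_n) a : a != 0 -> invmx0 (a *: M) = a^-1 *: invmx0 M.
Proof.
move=> a0; have u : (a *: M \in unitmx) = (M \in unitmx).
  by rewrite !unitmxE detZ unitrM unitrX ?unitfE.
rewrite /invmx0 u; case: ifP => [Mu|_]; last by rewrite scaler0.
by rewrite invmxZ// u.
Qed.

Lemma measurable_det {disp} {T : measurableType disp} n (M : T -> 'M[R]_n) :
  (forall i j, measurable_fun setT (fun w => M w i j)) -> measurable_fun setT (fun w => \det (M w)).
Proof.
move=> mM; apply: measurable_sum => s; apply: measurable_funM => //.
by apply: measurable_prod => i _; exact: mM.
Qed.

Lemma measurable_invmx0 {disp} {T : measurableType disp} n (M : T -> 'M[R]_n) :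
  (forall i j, measurable_fun setT (fun w => M w i j)) ->
  forall i j, measurable_fun setT (fun w => invmx0 (M w) i j).
Proof.
move=> mM i j; under eq_fun do rewrite invmx0E mxE.
apply: measurable_funM.
  by apply: measurableT_comp; [exact: measurable_invr|exact: measurable_det].
under eq_fun do rewrite mxE; apply: measurable_funM => //.
by apply: measurable_det => k l; under eq_fun do rewrite !mxE; exact: mM.
Qed.

Lemma cvg_det n (M : nat -> 'M[R]_n) (G : 'M[R]_n) :
  (forall i j, M m i j @[m --> \oo] --> G i j) -> \det (M m) @[m --> \oo] --> \det G.
Proof.
move=> MG; apply: cvg_sumr => s; apply: cvgMr; apply: cvg_prodr => i; exact: MG.
Qed.

Lemma cvg_invmx0 n (M : nat -> 'M[R]_n) (G : 'M[R]_n) : G \in unitmx ->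
  (forall i j, M m i j @[m --> \oo] --> G i j) ->
  (forall i j, invmx0 (M m) i j @[m --> \oo] --> invmx G i j) /\
  \forall m \near \oo, M m \in unitmx.
Proof.
move=> Gu MG; have dG : \det G != 0 by rewrite -unitfE -unitmxE.
split=> [i j|].
  have -> : invmx G = (\det G)^-1 *: \adj G by rewrite /invmx Gu.
  rewrite mxE; under eq_fun do rewrite invmx0E mxE.
  apply: cvgM; first by apply: cvgV => //; exact: cvg_det.
  rewrite mxE; under eq_fun do rewrite mxE.
  apply: cvgMr; apply: cvg_det => k l; rewrite !mxE; under eq_fun do rewrite !mxE.
  exact: MG.
have h : \forall m \near \oo, \det (M m) != 0 by exact: (cvgr_neq0 _ (cvg_det MG) dG).
by apply: filterS h => m; rewrite -unitfE -unitmxE.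
Qed.

End inverse_matrix.

(** * The explosive autoregression *)

Section process.
Context {disp : measure_display} {T : measurableType disp} {R : realType}
  (P : probability T R) (d : nat) (theta : 'cV[R]_d.+1)
  (Z : nat -> {RV P >-> R}) (sigma : R) (Y : int -> {RV P >-> R}).
Local Notation B := (companion theta).
Local Notation A := (invmx (companion theta)).
Local Notation X := (U d Y).
Local Notation Gam := (Gamma d Y).
Local Notation thd := (theta ord_max 0).
Local Notation ths := (theta_star theta).
Implicit Types (t x : 'cV[R]_d.+1).

Lemma measurable_coord n i : measurable_fun setT (fun w => X n w i 0).
Proof.
rewrite (_ : (fun w => _) = Y (n%:Z - i%:Z)); first exact: measurable_funP.
by apply/funext => w; rewrite mxE.
Qed.

Lemma measurable_state t n : measurable_fun setT (fun w => dotp t (X n w)).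
Proof. by apply: measurable_dotp => i; exact: measurable_coord. Qed.

Lemma state_shift n w (i : 'I_d.+1) (h : (i.+1 < d.+1)%N) : X n.+1 w (Ordinal h) 0 = X n w i 0.
Proof. by rewrite !mxE; congr (Y _ w) => /=; lia. Qed.

(** The scalar series indexed from its first observation on; a state lists
    [d.+1] consecutive values of it, from the latest to the oldest. *)
Definition last_coord w (m : nat) : R := X m w ord_max 0.

Lemma state_last w k (i : 'I_d.+1) : X k w i 0 = last_coord w (k + (d - i))%N.
Proof. by rewrite /last_coord !mxE; congr (Y _ w) => /=; have := ltn_ord i; lia. Qed.

Lemma obs_last w k : Y k.+1%:Z w = last_coord w (k + d.+1)%N.
Proof. by rewrite /last_coord !mxE; congr (Y _ w) => /=; lia. Qed.

Lemma GammaE i j : Gamma d Y i j = Ex P (fun w => X 0 w i 0 * X 0 w j 0).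
Proof.
rewrite mxE; congr fine; rewrite unlock; apply: eq_integral => w _.
by rewrite mxE big_ord1 !mxE.
Qed.

Lemma Gamma_sym : (Gamma d Y)^T = Gamma d Y.
Proof.
apply/matrixP => i j; rewrite mxE !GammaE; congr Ex; apply/funext => w.
by rewrite mulrC.
Qed.

Definition gram n w : 'M[R]_d.+1 := \sum_(0 <= k < n) X k w *m (X k w)^T.

Definition mean_gram n w : 'M[R]_d.+1 := n%:R^-1 *: gram n w.

(** The normal equations have residual [score] at [theta_star theta]. *)
Definition score n w : 'cV[R]_d.+1 := \sum_(0 <= k < n) (Y k.+1%:Z w - dotp ths (X k w)) *: X k w.

Lemma gramZ n w : (0 < n)%N -> gram n w = n%:R *: mean_gram n w.
Proof. by move=> n0; rewrite scalerA divff ?scale1r// pnatr_eq0 -lt0n. Qed.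

Lemma theta_hatE n w : theta_hat d Y n w = invmx0 (gram n w) *m (score n w + gram n w *m ths).
Proof.
rewrite /theta_hat !big_add1 /=; congr (_ *m _); rewrite /score /gram mulmx_suml -big_split /=.
apply: eq_bigr => k _; rewrite scalerBl -mulmxA.
have -> : (X k w)^T *m ths = (dotp ths (X k w))%:M.
  rewrite [LHS]mx11_scalar; congr (_%:M); rewrite mxE; apply: eq_bigr => i _.
  by rewrite mxE mulrC.
by rewrite mul_mx_scalar subrK.
Qed.

Lemma estimation_error n w : (0 < n)%N -> mean_gram n w \in unitmx ->
  theta_hat d Y n w - ths = invmx0 (mean_gram n w) *m (n%:R^-1 *: score n w).
Proof.
move=> n0 Mu; have n1 : n%:R != 0 :> R by rewrite pnatr_eq0 -lt0n.
have Gu : gram n w \in unitmx.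
  by rewrite gramZ// unitmxE detZ unitrM unitrX ?unitfE//= -unitfE -unitmxE.
rewrite theta_hatE mulmxDr mulmxA {2}/invmx0 Gu mulVmx// mul1mx addrK gramZ// invmx0Z//.
by rewrite -scalemxAl -scalemxAr.
Qed.

Lemma measurable_gram n i j : measurable_fun setT (fun w => gram n w i j).
Proof.
rewrite /gram; under eq_fun do rewrite summxE.
apply: measurable_sum => k; under eq_fun do rewrite outer_entry.
by apply: measurable_funM; exact: measurable_coord.
Qed.

Lemma measurable_score n i : measurable_fun setT (fun w => score n w i 0).
Proof.
rewrite /score; under eq_fun do rewrite summxE.
apply: measurable_sum => k; under eq_fun do rewrite mxE.
apply: measurable_funM; last exact: measurable_coord.
apply: measurable_funB; first exact: measurable_funP.
exact: measurable_state.
Qed.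

Lemma measurable_theta_hat n i : measurable_fun setT (fun w => theta_hat d Y n w i 0).
Proof.
under eq_fun do rewrite theta_hatE mxE.
apply: measurable_sum => j; apply: measurable_funM.
  by apply: measurable_invmx0 => k l; exact: measurable_gram.
under eq_fun do rewrite mxE.
apply: measurable_funD; first exact: measurable_score.
under eq_fun do rewrite mxE.
by apply: measurable_sum => k; apply: measurable_funM => //; exact: measurable_gram.
Qed.

Definition scaled_error n w : 'cV[R]_d.+1 := Num.sqrt n%:R *: (theta_hat d Y n w - ths).

Lemma measurable_scaled_error n i : measurable_fun setT (fun w => scaled_error n w i 0).
Proof.
have E w : scaled_error n w i 0 = Num.sqrt n%:R * (theta_hat d Y n w i 0 - ths i 0).
  by rewrite /scaled_error; move: (theta_hat d Y n w) => h; rewrite !mxE.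
under eq_fun do rewrite E; apply: measurable_funM => //; apply: measurable_funB => //.
exact: measurable_theta_hat.
Qed.

Definition scaled_noise (s : 'cV[R]_d.+1) n w : R :=
  (Num.sqrt n%:R)^-1 * \sum_(0 <= k < n) Z k.+1 w * dotp s (X k.+1 w).

Lemma scaled_noise_sum (a : 'I_d.+1 -> R) n w :
  \sum_j a j * scaled_noise (delta_mx (rev_ord j) 0) n w = scaled_noise (\col_j a (rev_ord j)) n w.
Proof.
rewrite (reindex_inj rev_ord_inj) /= /scaled_noise.
under eq_bigr do rewrite rev_ordK mulrCA.
rewrite -mulr_sumr; congr (_ * _); under eq_bigr do rewrite mulr_sumr.
rewrite exchange_big /=; apply: eq_bigr => k _; rewrite /dotp mulr_sumr; apply: eq_bigr => j _.
by rewrite -/(dotp _ _) dotp_deltal mxE; ring.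
Qed.

Hypothesis Y_rec : AR_recursion theta Z Y.

Lemma state_rec n w : X n.+1 w = B *m X n w + Z n.+1 w *: delta_mx ord0 0.
Proof.
apply/colP => i; rewrite [RHS]mxE [X in _ = X + _]mxE !mxE eqxx andbT.
have [->|i0] := eqVneq i ord0.
  rewrite subr0 Y_rec// mulr1; congr (_ + _); apply: eq_bigr => j _.
  by rewrite !mxE eqxx; congr (_ * Y _ w); lia.
rewrite mulr0 addr0 (bigD1 (inord i.-1))//= !mxE (negbTE i0).
have ip : (0 < i)%N by rewrite lt0n -val_eqE in i0 *.
have il : (i.-1 < d.+1)%N by rewrite (leq_ltn_trans (leq_pred _)).
rewrite inordK// prednK// eqxx mul1r big1 ?addr0 => [|j ji].
  by congr (Y _ w); lia.
rewrite !mxE (negbTE i0); case: eqP => [e|]; last by rewrite mul0r.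
by move: ji; rewrite -val_eqE /= inordK// -e eqxx.
Qed.

Lemma dotp_state_rec t n w : dotp t (X n.+1 w) = dotp (B^T *m t) (X n w) + Z n.+1 w * t ord0 0.
Proof.
rewrite state_rec -dotp_mull !dotpE mulmxDr mxE; congr (_ + _).
by rewrite -scalemxAr mxE -colE !mxE.
Qed.

Hypotheses (Z_iid : iid (fun n => Z n.+1))
  (Z_L2 : (Z 1%N : T -> R) \in Lfun P 2%:E)
  (Z_mean : ('E_P[Z 1%N] = 0)%E)
  (sigma_gt0 : 0 < sigma)
  (Z_var : ('V_P[Z 1%N] = (sigma ^+ 2)%:E)%E)
  (theta_pe : theta \in @Theta_pe R d)
  (Y_start : explosive_start theta Z Y).

Lemma innov_L2 : L2 P (Z 1%N).
Proof. by split => //; have := Lfun2_integrable_sqr Z_L2. Qed.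

Lemma innov_mean : Ex P (Z 1%N) = 0.
Proof. by apply: EFin_inj; rewrite -ExE//; exact: L2_intg innov_L2. Qed.

Lemma innov_var : Ex P (fun w => Z 1%N w ^+ 2) = sigma ^+ 2.
Proof.
apply: EFin_inj; rewrite -Z_var varianceE// Z_mean expe2 mule0 sube0 -ExE//.
exact: innov_L2.2.
Qed.

(** The representation of the initial state is the assumption on it, and one step
    of the recursion shifts the coefficients, the innovation that has become past
    cancelling against the noise ([future_coef0]). *)
Lemma state_future n t : {ae P, forall w,
  \sum_(0 <= j < N) future_coef theta t j * Z (n + j).+1 w @[N --> \oo] --> dotp t (X n w)}.
Proof.
elim: n t => [|n IH] t.
  apply: filterS Y_start => w h.
  pose v N : 'cV[R]_d.+1 := - (\sum_(1 <= j < N) A ^+ j *m W d Z j w).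
  have hv i : v N i 0 @[N --> \oo] --> X 0 w i 0.
    exact: (cvg_comp _ _ h (@coord_continuous _ _ _ i 0 _)).
  have hd : dotp t (v N) @[N --> \oo] --> dotp t (X 0 w).
    by apply: cvg_sumr => i; apply: cvgMr; exact: hv.
  rewrite -(cvg_shiftS (fun N => dotp t (v N))) in hd.
  rewrite (_ : (fun N => _) = (fun N => dotp t (v N.+1)))//; apply/funext => N.
  rewrite /v big_add1 /= dotpE mulmxN mulmx_sumr mxE summxE -sumrN; apply: eq_bigr => j _.
  rewrite /W add0n /future_coef mulNr; congr (- _).
  by rewrite -!scalemxAr mulmxA [RHS]mxE mulrC -colE [in RHS]mxE.
apply: filterS (IH (B^T *m t)) => w h.
rewrite dotp_state_rec; rewrite -(cvg_shiftS (fun N => \sum_(0 <= j < N) _)) in h.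
have := @cvgD _ _ _ _ _ _ _ _ _ h (cvg_cst (Z n.+1 w * t ord0 0)).
move=> h2; rewrite (_ : (fun N => _) = (fun N => \sum_(0 <= j < N.+1)
  future_coef theta (B^T *m t) j * Z (n + j).+1 w + Z n.+1 w * t ord0 0)); first exact: h2.
apply/funext => N.
rewrite big_nat_recl//= future_coef0// addn0 addrC mulNr mulrC addrA subrr add0r.
by apply: eq_bigr => j _; rewrite future_coefS// addnS.
Qed.

Lemma state_L2 t n : L2 P (fun w => dotp t (X n w)).
Proof.
have [r [br _]] := future_coef_tail theta_pe t.
exact: (@lin_L2 _ _ _ P _ Z_iid innov_L2 innov_mean _ _ (fun n w => dotp t (X n w)) br
  (measurable_state t) (state_future ^~ t) n).
Qed.

Lemma state_second_moment t n : Ex P (fun w => dotp t (X n w) ^+ 2) = sigma ^+ 2 * future_norm theta t.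
Proof.
have [r [br r0]] := future_coef_tail theta_pe t.
rewrite -innov_var.
exact: (@lin_second_moment _ _ _ P _ Z_iid innov_L2 innov_mean _ _ _ (fun n w => dotp t (X n w)) br r0
  (@future_norm_cvg _ _ _ theta_pe t) (measurable_state t) (state_future ^~ t) n).
Qed.

Lemma noise_state_moment t : exists C, forall n,
  L2 P (fun w => \sum_(0 <= k < n) Z k.+1 w * dotp t (X k.+1 w)) /\
  Ex P (fun w => (\sum_(0 <= k < n) Z k.+1 w * dotp t (X k.+1 w)) ^+ 2) <= C * n%:R.
Proof.
have [r [br _]] := future_coef_tail theta_pe t.
exists (sigma ^+ 2 ^+ 2 * r 0%N) => n; rewrite -innov_var.
exact: (@lin_tail0 _ _ _ P _ Z_iid innov_L2 innov_mean _ _ (fun n w => dotp t (X n w)) br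
  (measurable_state t) (state_future ^~ t) 0 n).
Qed.

Lemma noise_state_slln t : {ae P, forall w,
  n%:R^-1 * (\sum_(0 <= k < n) Z k.+1 w * dotp t (X k.+1 w)) @[n --> \oo] --> 0}.
Proof.
have [r [br _]] := future_coef_tail theta_pe t.
exact: (@lin_slln _ _ _ P _ Z_iid innov_L2 innov_mean _ _ (fun n w => dotp t (X n w)) br
  (measurable_state t) (state_future ^~ t)).
Qed.

Lemma noise_state_clt t c :
  Ex P (fun w => cos ((Num.sqrt n%:R)^-1 * (\sum_(0 <= k < n) Z k.+1 w * dotp t (X k.+1 w)) + c))
    @[n --> \oo] --> expR (- (sigma ^+ 4 * future_norm theta t) / 2) * cos c.
Proof.
have [r [br r0]] := future_coef_tail theta_pe t.
have := @lin_clt _ _ _ P _ Z_iid innov_L2 innov_mean _ _ _ (fun n w => dotp t (X n w)) br r0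
  (@future_norm_cvg _ _ _ theta_pe t) (measurable_state t) (state_future ^~ t) c.
by rewrite innov_var -exprM.
Qed.

Lemma state_coord_L2 n i : L2 P (fun w => X n w i 0).
Proof. by have := state_L2 (delta_mx i 0) n; under eq_fun do rewrite dotp_deltal. Qed.

(** By polarisation of [state_second_moment], the second moments are the same at all
    times. *)
Lemma state_product_moment n i j : Ex P (fun w => X n w i 0 * X n w j 0) = Gamma d Y i j.
Proof.
have polar m : Ex P (fun w => X m w i 0 * X m w j 0) =
    (Ex P (fun w => dotp (delta_mx i 0 + delta_mx j 0) (X m w) ^+ 2)
     - Ex P (fun w => dotp (delta_mx i 0) (X m w) ^+ 2)
     - Ex P (fun w => dotp (delta_mx j 0) (X m w) ^+ 2)) / 2.
  have [h1 h2 h3] := And3 (state_L2 (delta_mx i 0 + delta_mx j 0) m) (state_L2 (delta_mx i 0) m)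
     (state_L2 (delta_mx j 0) m).
  rewrite -(ExB h1.2 h2.2) -(ExB (intgB h1.2 h2.2) h3.2).
  rewrite mulrC -ExZ; last by apply: intgB; [apply: intgB; [exact: h1.2|exact: h2.2]|exact: h3.2].
  by congr Ex; apply/funext => w; rewrite dotpDl !dotp_deltal; field.
by rewrite GammaE !polar !state_second_moment.
Qed.

Lemma Gamma_quad t : (t^T *m Gamma d Y *m t) 0 0 = sigma ^+ 2 * future_norm theta t.
Proof.
rewrite -(state_second_moment t 0).
have iX i j : intg P (fun w => t i 0 * t j 0 * (X 0 w i 0 * X 0 w j 0)).
  by apply: intgZ; apply: L2M; exact: state_coord_L2.
rewrite (_ : (fun w => _) = (fun w => \sum_i \sum_j t i 0 * t j 0 * (X 0 w i 0 * X 0 w j 0))).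
  rewrite (@Ex_sum _ _ _ P _ _ (fun i w => \sum_j t i 0 * t j 0 * (X 0 w i 0 * X 0 w j 0))); last first.
    by move=> i; apply: intg_sum => j _; exact: iX.
  rewrite [LHS]mxE.
  under [RHS]eq_bigr => i _ do rewrite (@Ex_sum _ _ _ P _ _ (fun j w => t i 0 * t j 0 * (X 0 w i 0 * X 0 w j 0)) (iX i)).
  under [LHS]eq_bigr => i _ do rewrite mxE mulr_suml.
  rewrite [LHS]exchange_big /=; apply: eq_bigr => i _; apply: eq_bigr => j _.
  rewrite ExZ; last by apply: L2M; exact: state_coord_L2.
  by rewrite state_product_moment mxE mulrAC.
apply/funext => w; rewrite expr2 /dotp mulr_suml; apply: eq_bigr => i _.
by rewrite mulr_sumr; apply: eq_bigr => j _; ring.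
Qed.

Lemma Gamma_posdef : posdef (Gamma d Y).
Proof.
split=> [|t t0]; first exact: Gamma_sym.
rewrite Gamma_quad mulr_gt0 ?exprn_gt0// lt_neqAle future_norm_ge0// andbT eq_sym.
by apply: contraNneq t0 => /(future_norm_eq0 theta_pe) ->.
Qed.

(** The quadratic form of the left side at [t] is that of the covariance matrix at
    [B^T *m t], which [future_norm_shift] computes. *)
Lemma Gamma_stationary :
  B *m Gamma d Y *m B^T = Gamma d Y + sigma ^+ 2 *: (delta_mx ord0 0 *m (delta_mx ord0 0 : 'cV[R]_d.+1)^T).
Proof.
apply: sym_quad_eq.
- by rewrite !trmx_mul trmxK Gamma_sym mulmxA.
- by rewrite linearD linearZ /= trmx_mul trmxK Gamma_sym.
move=> t; have := Gamma_quad (B^T *m t); rewrite trmx_mul trmxK !mulmxA future_norm_shift// mulrDr -Gamma_quad => ->.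
rewrite mulmxDr mulmxDl [RHS]mxE; congr (_ + _).
rewrite -scalemxAr -scalemxAl mxE expr2; congr (_ * _).
by rewrite mulmxA -colE -mulmxA trmx_delta -rowE [RHS]mxE big_ord1 !mxE.
Qed.

(** Consecutive states have the same second moments and share all coordinates but
    one, up to a shift. *)
Lemma Gamma_toeplitz (i j : 'I_d.+1) (hi : (i.+1 < d.+1)%N) (hj : (j.+1 < d.+1)%N) :
  Gamma d Y (Ordinal hi) (Ordinal hj) = Gamma d Y i j.
Proof.
rewrite -(state_product_moment 1) -(state_product_moment 0).
by congr Ex; apply/funext => w; rewrite !state_shift.
Qed.

Lemma Gamma_lag (i j : 'I_d.+1) : (i <= j)%N -> Gamma d Y i j = Gamma d Y ord0 (inord (j - i)).
Proof.
case: i j => i hi [j hj] /=; elim: i j hi hj => [|i IH] j hi hj ij.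
  by congr (Gamma d Y _ _); apply: val_inj => //=; rewrite subn0 inordK.
have hi' : (i < d.+1)%N by exact: ltnW.
case: j hj ij => // j hj ij; have hj' : (j < d.+1)%N by exact: ltnW.
by rewrite (@Gamma_toeplitz (Ordinal hi') (Ordinal hj')) IH// subSS.
Qed.

(** By [Gamma_lag] an entry depends only on the distance of its two indices, which
    reversal preserves. *)
Lemma Gamma_rev (i j : 'I_d.+1) : Gamma d Y (rev_ord i) (rev_ord j) = Gamma d Y i j.
Proof.
have sy a b : Gamma d Y a b = Gamma d Y b a by rewrite -[in LHS]Gamma_sym mxE.
wlog ij : i j / (i <= j)%N.
  move=> H; have [/H //|/ltnW /H] := leqP i j.
  by rewrite sy (sy j) => ->.
rewrite (Gamma_lag ij) -[in LHS]Gamma_sym mxE Gamma_lag /=; last by lia.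
by congr (Gamma d Y _ (inord _)); have := ltn_ord i; have := ltn_ord j; lia.
Qed.

(** * Consistency of the estimator *)

Lemma innov_sq_slln : {ae P, forall w,
  n%:R^-1 * (\sum_(0 <= k < n) Z k.+1 w ^+ 2) @[n --> \oo] --> sigma ^+ 2}.
Proof.
have isq : intg P (fun w => Z 1%N w ^+ 2) by exact: innov_L2.2.
have msq : measurable_fun setT (fun x : R => x ^+ 2) by exact: measurable_funX.
by have := @slln_iid _ _ _ P _ Z_iid (fun x : R => x ^+ 2) msq (@sqr_ge0 _) isq; rewrite innov_var.
Qed.

Lemma noise_coord_slln : {ae P, forall w, forall i,
  n%:R^-1 * (\sum_(0 <= k < n) Z k.+1 w * X k.+1 w i 0) @[n --> \oo] --> 0}.
Proof.
apply: filter_forall => i; apply: filterS (noise_state_slln (delta_mx i 0)) => w.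
by under [X in X @ _ --> _ -> _]eq_fun do under eq_bigr do rewrite dotp_deltal.
Qed.

(** The mean of the squared innovations converges, so the [n]-th squared innovation
    is of smaller order than [n]; by the representation in the future the same
    holds for the states. *)
Lemma state_negligible : {ae P, forall w, forall i, n%:R^-1 * X n w i 0 ^+ 2 @[n --> \oo] --> 0}.
Proof.
have fut : {ae P, forall w, forall i n, \sum_(0 <= j < N) future_coef theta (delta_mx i 0) j * Z (n + j).+1 w
    @[N --> \oo] --> X n w i 0}.
  apply: filter_forall => i; apply: ae_all => n.
  by apply: filterS (state_future n (delta_mx i 0)) => w; rewrite dotp_deltal.
move: innov_sq_slln fut; apply: filterS2 => w sq fut.
move=> i; have [C [q [C0 q0 q1 hc]]] := future_coef_decay theta_pe (delta_mx i 0).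
apply: (future_sum_negligible (z := fun k => Z k.+1 w) (C := C) (q := q) _ _ hc (cesaro_last sq)).
- exact: ltW.
- by rewrite (ltW q0).
- by move=> n; exact: fut.
Qed.

Lemma gram_cvg : {ae P, forall w, forall i j, mean_gram n w i j @[n --> \oo] --> Gam i j}.
Proof.
move: innov_sq_slln noise_coord_slln state_negligible; apply: filterS3 => w sq zx xx.
apply: (empirical_covariance theta_pe (x := fun n => X n w) (z := fun n => Z n.+1 w) _ sq zx xx Gamma_stationary).
by move=> n; exact: state_rec.
Qed.

(** The boundary terms by which the score differs from a sum of products of
    innovations and states. *)
Definition score_error n w (i : 'I_d.+1) : R :=
  score n w i 0 + thd^-1 * \sum_(0 <= k < n) Z k.+1 w * X k.+1 w (rev_ord i) 0.

Definition error_cst : R := (1 + \sum_j `|ths j 0|) * (4 * d.+1%:R).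

Lemma score_error_le n w i : `|score_error n w i| <= error_cst * boundary d (last_coord w) n.
Proof.
have rec k : last_coord w (k + d.+1)%N =
    \sum_(i < d.+1) theta i 0 * last_coord w (k + (d - i))%N + Z k.+1 w.
  rewrite -obs_last Y_rec//; congr (_ + _); apply: eq_bigr => j _.
  by rewrite -state_last mxE; congr (_ * Y _ w); lia.
have := normal_equations (theta_last_neq0 theta_pe) n i rec.
rewrite /score_error /score summxE.
have -> : \sum_(0 <= k < n) ((Y k.+1%:Z w - dotp ths (X k w)) *: X k w) i 0 =
  \sum_(0 <= k < n) last_coord w (k + (d - i))%N *
      (last_coord w (k + d.+1)%N - \sum_(j < d.+1) ths j 0 * last_coord w (k + (d - j))%N).
  apply: eq_bigr => k _; rewrite mxE mulrC state_last obs_last /dotp.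
  by congr (_ * (_ - _)); apply: eq_bigr => j _; rewrite state_last.
have -> : \sum_(0 <= k < n) Z k.+1 w * X k.+1 w (rev_ord i) 0 =
    \sum_(0 <= k < n) Z k.+1 w * last_coord w (k + i.+1)%N.
  apply: eq_bigr => k _; rewrite state_last; congr (_ * last_coord w _) => /=.
  by have := ltn_ord i; lia.
by [].
Qed.

Lemma boundary_negligible : {ae P, forall w, n%:R^-1 * boundary d (last_coord w) n @[n --> \oo] --> 0}.
Proof.
apply: filterS state_negligible => w /(_ ord_max) h.
have inv0 : n%:R^-1 @[n --> \oo] --> (0 : R).
  by rewrite -(cvg_shiftS (fun n => n%:R^-1 : R)); exact: cvg_harmonic.
rewrite [X in _ --> X](_ : 0 = \sum_(a < d.+1.*2.+1) 0); last by rewrite big1.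
under eq_fun do rewrite mulr_sumr.
apply: cvg_sumr => a; rewrite -[X in _ --> X](addr0 (0 : R)).
under eq_fun do rewrite mulrDr.
apply: cvgD.
  by rewrite -(mul0r (last_coord w a ^+ 2)); exact: cvgMl.
have ha : a.+1%:R * ((n + a)%:R^-1 * last_coord w (n + a)%N ^+ 2) @[n --> \oo] --> a.+1%:R * (0 : R).
  by apply: cvgMr; rewrite (cvg_shiftn a (fun n => n%:R^-1 * last_coord w n ^+ 2)).
rewrite mulr0 in ha; apply: (squeeze_cvgr _ (cvg_cst 0) ha); near=> n.
have n0 : (0 < n)%N by near: n; exists 1%N.
rewrite mulr_ge0 ?sqr_ge0//= mulrA ler_wpM2r ?sqr_ge0//.
rewrite ler_pdivlMr ?ltr0n ?addn_gt0 ?n0// mulrC ler_pdivrMr ?ltr0n// -natrM ler_nat.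
by rewrite mulSn leq_add2l leq_pmulr.
Unshelve. all: end_near. Qed.

Lemma boundary_intg n : intg P (fun w => boundary d (last_coord w) n) /\
  Ex P (fun w => boundary d (last_coord w) n) = d.+1.*2.+1%:R * (2 * Gam ord_max ord_max).
Proof.
have i1 m : intg P (fun w => last_coord w m ^+ 2) by exact: (state_coord_L2 m ord_max).2.
have e1 m : Ex P (fun w => last_coord w m ^+ 2) = Gam ord_max ord_max.
  by rewrite -(state_product_moment m); congr Ex; apply/funext => w; rewrite expr2.
have i2 (a : 'I_d.+1.*2.+1) : intg P (fun w => last_coord w a ^+ 2 + last_coord w (n + a)%N ^+ 2).
  exact: intgD.
split; first by apply: intg_sum => a _; exact: i2.
rewrite /boundary (@Ex_sum _ _ _ P _ _ (fun (a : 'I_d.+1.*2.+1) w => last_coord w a ^+ 2 + last_coord w (n + a)%N ^+ 2))//.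
under eq_bigr do rewrite ExD// !e1.
by rewrite sumr_const card_ord -[LHS]mulr_natl; congr (_ * _); ring.
Qed.

Lemma score_negligible : {ae P, forall w, forall i, (n%:R^-1 *: score n w) i 0 @[n --> \oo] --> 0}.
Proof.
move: noise_coord_slln boundary_negligible; apply: filterS2 => w zx bd i.
have err : n%:R^-1 * score_error n w i @[n --> \oo] --> 0.
  apply: norm_cvg0.
  have h : error_cst * (n%:R^-1 * boundary d (last_coord w) n) @[n --> \oo] --> error_cst * 0 by exact: cvgMr.
  rewrite mulr0 in h; apply: (squeeze_cvgr _ (cvg_cst 0) h); apply: nearW => n.
  rewrite normr_ge0 normrM [`|_^-1|]ger0_norm// mulrCA ler_wpM2l//.
  exact: score_error_le.
rewrite (_ : (fun n => _) = (fun n => n%:R^-1 * score_error n w i -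
  thd^-1 * (n%:R^-1 * \sum_(0 <= k < n) Z k.+1 w * X k.+1 w (rev_ord i) 0))).
  rewrite [X in _ --> X](_ : 0 = 0 - thd^-1 * 0); last by ring.
  by apply: cvgB => //; apply: cvgMr; exact: zx.
by apply/funext => n; rewrite mxE /score_error; ring.
Qed.

Lemma consistency : {ae P, forall w, theta_hat d Y n w @[n --> \oo] --> ths}.
Proof.
have Gu := posdef_unit Gamma_posdef.
move: gram_cvg score_negligible; apply: filterS2 => w gw sw.
have [hi hu] := cvg_invmx0 Gu gw.
apply: vector_cvg => i; apply/subr_cvg0.
have h : \sum_j invmx0 (mean_gram n w) i j * (n%:R^-1 *: score n w) j 0 @[n --> \oo] -->
    \sum_j invmx Gam i j * 0.
  by apply: cvg_sumr => j; apply: cvgM; [exact: hi|exact: sw].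
rewrite big1 in h; last by move=> j _; rewrite mulr0.
apply: cvg_trans h; apply: near_eq_cvg; near=> n.
have n0 : (0 < n)%N by near: n; exists 1%N.
have Mu : mean_gram n w \in unitmx by near: n.
have := congr1 (fun v : 'cV_d.+1 => v i 0) (estimation_error n0 Mu).
have subE (u v : 'cV[R]_d.+1) : (u - v) i 0 = u i 0 - v i 0 by rewrite !mxE.
by rewrite subE => ->; rewrite mxE.
Unshelve. all: end_near. Qed.

(** * Asymptotic normality of the estimator *)

Lemma scaled_noise_moment s : exists C, forall n, L2 P (scaled_noise s n) /\
  Ex P (fun w => scaled_noise s n w ^+ 2) <= C.
Proof.
have [C hC] := noise_state_moment s; exists `|C| => n; have [l e] := hC n.
split; first exact: L2Z.
under [X in Ex P X]eq_fun do rewrite exprMn.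
rewrite ExZ; last exact: l.2.
rewrite exprVn sqr_sqrtr//; have [->|n0] := posnP n; first by rewrite invr0 mul0r.
by rewrite mulrC ler_pdivrMr ?ltr0n// (le_trans e)// ler_wpM2r// ler_norm.
Qed.

Lemma score_error_vanishes j : vanishes P (fun n w => (Num.sqrt n%:R)^-1 * score_error n w j).
Proof.
have mse n : measurable_fun setT (fun w => score_error n w j).
  apply: measurable_funD; first exact: measurable_score.
  apply: measurable_funM => //; apply: measurable_sum => k.
  by apply: measurable_funM; [exact: measurable_funP|exact: measurable_coord].
have e0 : 0 <= error_cst by rewrite mulr_ge0// addr_ge0// sumr_ge0.
have [ib eb] := all_and2 boundary_intg.
have ise n : intg P (fun w => score_error n w j).
  apply: (intg_le (mse n) (fun w => score_error_le n w j)).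
  by apply: intgZ.
pose C := error_cst * (d.+1.*2.+1%:R * (2 * Gam ord_max ord_max)).
apply: (@vanishes_L1 _ _ _ P _ (fun n => (Num.sqrt n%:R)^-1 * C)).
- by move=> n; exact: intgZ.
- move=> n; under [X in Ex P X]eq_fun do rewrite normrM.
  rewrite ExZ; last exact: intg_abs.
  rewrite ger0_norm ?invr_ge0 ?sqrtr_ge0// ler_wpM2l ?invr_ge0 ?sqrtr_ge0//.
  rewrite /C -(eb n) -ExZ//; apply: Ex_le; [exact: intg_abs|exact: intgZ|].
  by move=> w; exact: score_error_le.
- by rewrite -(mul0r C); apply: cvgMl; exact: cvg_invsqrt.
Qed.

(** The direction in which the noise is seen by the limit of [dotp t]: the vector
    [invmx Gamma *m t] with its coordinates reversed, divided by [- theta_d]. *)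
Definition limit_weight (t : 'cV[R]_d.+1) : 'cV[R]_d.+1 :=
  \col_j (- thd^-1 * \sum_i t i 0 * invmx Gam i (rev_ord j)).

(** Slutsky's argument: the random weights given by the inverse mean Gram matrix
    are replaced by their limits. *)
Lemma scaled_error_asymptotics t :
  vanishes P (fun n w => dotp t (scaled_error n w) - scaled_noise (limit_weight t) n w).
Proof.
have Gu := posdef_unit Gamma_posdef.
pose g (j : 'I_d.+1) := \sum_i t i 0 * invmx Gam i j.
pose gn (j : 'I_d.+1) n w := \sum_i t i 0 * invmx0 (mean_gram n w) i j.
pose N (j : 'I_d.+1) n w := scaled_noise (delta_mx (rev_ord j) 0) n w.
have mgn j n : measurable_fun setT (gn j n).
  apply: measurable_sum => i; apply: measurable_funM => //.
  apply: measurable_invmx0 => k l; under eq_fun do rewrite mxE.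
  by apply: measurable_funM => //; exact: measurable_gram.
have vg j : vanishes P (fun n w => gn j n w - g j).
  apply: vanishes_as => [n|]; first exact: measurable_funB.
  apply: filterS gram_cvg => w gw; have [hi _] := cvg_invmx0 Gu gw.
  by apply/subr_cvg0; apply: cvg_sumr => i; apply: cvgMr; exact: hi.
have mse n : measurable_fun setT (fun w => dotp t (scaled_error n w)).
  by apply: measurable_dotp => i; exact: measurable_scaled_error.
(* on the event that the Gram matrix is regular the error is exactly linear in the score *)
have v1 : vanishes P (fun n w => dotp t (scaled_error n w) -
    \sum_j gn j n w * ((Num.sqrt n%:R)^-1 * score n w j 0)).
  apply: vanishes_as => [n|].
    apply: measurable_funB => //; apply: measurable_sum => j; apply: measurable_funM => //.
    by apply: measurable_funM => //; exact: measurable_score.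
  apply: filterS gram_cvg => w gw; have [_ hu] := cvg_invmx0 Gu gw.
  apply: cvg_near_cst; near=> n.
  have n0 : (0 < n)%N by near: n; exists 1%N.
  have Mu : mean_gram n w \in unitmx by near: n.
  apply/eqP; rewrite subr_eq0; apply/eqP.
  rewrite /scaled_error estimation_error// /dotp.
  under eq_bigr do rewrite mxE mxE mulrCA !mulr_sumr.
  rewrite exchange_big /=; apply: eq_bigr => j _; rewrite /gn mulr_suml; apply: eq_bigr => i _.
  have sn : Num.sqrt n%:R * n%:R^-1 = (Num.sqrt n%:R)^-1 :> R.
    rewrite -{2}[n%:R]sqr_sqrtr// expr2 invfM mulrA divff ?mul1r// gt_eqF// sqrtr_gt0 ltr0n//.
  have zE (a : R) (u : 'cV[R]_d.+1) : (a *: u) j 0 = a * u j 0 by rewrite mxE.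
  by rewrite zE -sn; ring.
have v2 : vanishes P (fun n w => \sum_j (g j * ((Num.sqrt n%:R)^-1 * score_error n w j)
    + (gn j n w - g j) * ((Num.sqrt n%:R)^-1 * score_error n w j))).
  apply: vanishes_sum => j; apply: vanishesD; first by apply: vanishesZ; exact: score_error_vanishes.
  by apply: vanishesM => //; exact: score_error_vanishes.
have v3 : vanishes P (fun n w => \sum_j - thd^-1 * ((gn j n w - g j) * N j n w)).
  apply: vanishes_sum => j; apply: vanishesZ.
  have [C hC] := scaled_noise_moment (delta_mx (rev_ord j) 0).
  by apply: (@vanishesM_bounded _ _ _ P _ _ C) => // n; have [] := hC n.
have := vanishesD (vanishesD v1 v2) v3.
congr (vanishes P _); apply/funext => n; apply/funext => w.
have -> : scaled_noise (limit_weight t) n w = \sum_j (- thd^-1 * g j) * N j n w.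
  by rewrite scaled_noise_sum /limit_weight.
rewrite -!addrA; congr (_ + _); rewrite -!sumrN -!big_split /=; apply: eq_bigr => j _.
rewrite /score_error.
have -> : (Num.sqrt n%:R)^-1 * (score n w j 0 + thd^-1 * \sum_(0 <= k < n) Z k.+1 w * X k.+1 w (rev_ord j) 0) =
   (Num.sqrt n%:R)^-1 * score n w j 0 + thd^-1 * N j n w.
  rewrite mulrDr mulrCA /N /scaled_noise; congr (_ + _ * (_ * _)).
  by apply: eq_bigr => k _; rewrite dotp_deltal.
by ring.
Unshelve. all: end_near. Qed.

(** Reversing the coordinates of a vector does not change its quadratic form for
    [Gamma], which is invariant under reversal. *)
Lemma limit_variance t : sigma ^+ 4 * future_norm theta (limit_weight t) =
  (sigma / thd) ^+ 2 * (t^T *m invmx Gam *m t) 0 0.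
Proof.
have Gu := posdef_unit Gamma_posdef.
have -> : sigma ^+ 4 * future_norm theta (limit_weight t) =
    sigma ^+ 2 * ((limit_weight t)^T *m Gam *m limit_weight t) 0 0.
  by rewrite Gamma_quad mulrA -exprD.
pose g : 'cV[R]_d.+1 := invmx Gam *m t.
have iGs : (invmx Gam)^T = invmx Gam by rewrite trmx_inv Gamma_sym.
have gE j : limit_weight t j 0 = - thd^-1 * g (rev_ord j) 0.
  rewrite !mxE; congr (_ * _); apply: eq_bigr => i _.
  by rewrite mulrC -[in RHS]iGs mxE.
have quadE (v : 'cV[R]_d.+1) : (v^T *m Gam *m v) 0 0 = \sum_j \sum_i v i 0 * Gam i j * v j 0.
  rewrite mxE; apply: eq_bigr => j _; rewrite mxE mulr_suml; apply: eq_bigr => i _.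
  by rewrite mxE.
have -> : ((limit_weight t)^T *m Gam *m limit_weight t) 0 0 = thd^-1 ^+ 2 * (g^T *m Gam *m g) 0 0.
  rewrite !quadE (reindex_inj rev_ord_inj) mulr_sumr; apply: eq_bigr => j _.
  rewrite (reindex_inj rev_ord_inj) mulr_sumr; apply: eq_bigr => i _.
  by rewrite /= !gE !rev_ordK Gamma_rev; ring.
rewrite /g trmx_mul iGs -!mulmxA (mulmxA Gam) mulmxV// mul1mx mulmxA.
by rewrite exprMn mulrA.
Qed.

Section gaussian_limit.
Context {disp' : measure_display} {T' : measurableType disp'} (P' : probability T' R)
  (N : 'I_d.+1 -> {RV P' >-> R}).
Hypothesis N_normal : std_normal_vector N.
Local Notation limit := (fun w => (sigma / thd) *: (invmx (sqrtmx Gam) *m rvec N w)).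

Lemma gaussian_limit_cf t c : Ex P' (fun w => cos (dotp t (limit w) + c)) =
  expR (- (sigma ^+ 4 * future_norm theta (limit_weight t)) / 2) * cos c.
Proof.
have [Sp SS] := sqrtmxP Gamma_posdef; set S := sqrtmx Gam in Sp SS *.
pose v := (sigma / thd) *: (invmx S *m t).
have iSs : (invmx S)^T = invmx S by rewrite trmx_inv Sp.1.
have -> : (fun w => cos (dotp t (limit w) + c)) = (fun w => cos (\sum_i v i 0 * N i w + c)).
  apply/funext => w; congr (cos (_ + _)); rewrite dotpE -scalemxAr mulmxA.
  have -> : t^T *m invmx S = (invmx S *m t)^T by rewrite trmx_mul iSs.
  rewrite mxE mxE mulr_sumr; apply: eq_bigr => i _.
  by rewrite [in RHS]mxE mulrA; congr (_ * _ * _); rewrite mxE.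
rewrite (Ex_cos_normal_vector (fun i => v i 0) c N_normal).
suff -> : \sum_i v i 0 ^+ 2 = sigma ^+ 4 * future_norm theta (limit_weight t) by rewrite mulNr.
rewrite [RHS]limit_variance.
have -> : invmx Gam = invmx S *m invmx S.
  have Su := posdef_unit Sp; have Gu := posdef_unit Gamma_posdef.
  have e : Gam *m (invmx S *m invmx S) = 1%:M.
    by rewrite -{1}SS mulmxA mulmxK// mulmxV.
  by rewrite -[LHS]mulmx1 -e mulmxA mulVmx// mul1mx.
have -> : t^T *m (invmx S *m invmx S) *m t = (invmx S *m t)^T *m (invmx S *m t).
  by rewrite trmx_mul iSs !mulmxA.
rewrite mxE mulr_sumr; apply: eq_bigr => i _.
have zE (a : R) (u : 'cV[R]_d.+1) : (a *: u) i 0 = a * u i 0 by rewrite mxE.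
by rewrite /v zE [(_^T) 0 i]mxE; ring.
Qed.

Lemma asymptotic_normality : cvg_in_distribution P scaled_error P' limit.
Proof.
apply: levy_cvg.
- exact: measurable_scaled_error.
- move=> i; under eq_fun do rewrite mxE mxE; apply: measurable_funM => //.
  apply: measurable_sum => j; apply: measurable_funM => //.
  by under eq_fun do rewrite mxE; exact: measurable_funP.
- move=> i e e0; have [C hC] := scaled_noise_moment (limit_weight (delta_mx i 0)).
  apply: (@vanishes_tight _ _ _ P _ (scaled_noise (limit_weight (delta_mx i 0))) C) => //.
  + by move=> n; have [] := hC n.
  + by move=> n; have [] := hC n.
  + have := scaled_error_asymptotics (delta_mx i 0).
    by congr (vanishes P _); apply/funext => n; apply/funext => w; rewrite dotp_deltal.
- move=> t c; rewrite gaussian_limit_cf.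
  apply: (vanishes_cos _ (scaled_error_asymptotics t)); last exact: noise_state_clt.
  by move=> n; have [C hC] := scaled_noise_moment (limit_weight t); exact: (hC n).1.1.
Qed.

End gaussian_limit.
End process.

Theorem proposition3p3
  (R : realType) (disp : measure_display) (T : measurableType disp)
  (P : probability T R) (d : nat) (theta : 'cV[R]_d.+1)
  (Z : nat -> {RV P >-> R}) (sigma : R) (Y : int -> {RV P >-> R})
  (Z_iid : iid (fun n => Z n.+1))
  (Z_L2 : (Z 1%N : T -> R) \in Lfun P 2%:E)
  (Z_mean : ('E_P[Z 1%N] = 0)%E)
  (sigma_gt0 : 0 < sigma)
  (Z_var : ('V_P[Z 1%N] = (sigma ^+ 2)%:E)%E)
  (theta_pe : theta \in @Theta_pe R d)
  (Y_rec : AR_recursion theta Z Y)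
  (Y_start : explosive_start theta Z Y)
  (disp' : measure_display) (T' : measurableType disp')
  (P' : probability T' R) (N : 'I_d.+1 -> {RV P' >-> R})
  (N_normal : std_normal_vector N) :
  {ae P, forall w, theta_hat d Y n w @[n --> \oo] --> theta_star theta} /\
  cvg_in_distribution P
    (fun n w => Num.sqrt n%:R *: (theta_hat d Y n w - theta_star theta))
    P'
    (fun w => (sigma / theta ord_max 0) *: (invmx (sqrtmx (Gamma d Y)) *m rvec N w)).
Proof.
split; first exact: (consistency Y_rec Z_iid Z_L2 Z_mean sigma_gt0 Z_var theta_pe Y_start).
exact: (asymptotic_normality Y_rec Z_iid Z_L2 Z_mean sigma_gt0 Z_var theta_pe Y_start N_normal).
Qed.
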